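(* Let $b\in\mathbb{R}$, $\sigma>0$, let $\mu_0$ be a Borel probability measure on $\mathbb{R}_+$, and for each $n\ge2$ let $\nu^{(n)}$ be a permutation-invariant Borel probability measure on $\mathbb{R}_+^n$ with all one-dimensional marginals equal to $\mu_0$, such that if $X^n_0\sim\nu^{(n)}$ then $\frac1n\sum_{i\in[n]}\delta_{X^n_{0,i}}\to\mu_0$ in probability (weak topology) as $n\to\infty$. Let $(\Xi,\mathcal A,Q)$ be a probability space carrying, for each $n\ge2$, real random variables $\{\rho^n_{ij}: i,j\in[n],\,i\neq j\}$ such that: (1) for some $\varepsilon_\rho>0$ and every $\xi\in\Xi$, $n\ge2$, $i\ne j$ in $[n]$, $|\rho^n_{ij}(\xi)|\le1-\varepsilon_\rho$; (2) the mean $a:=\int\rho^n_{ij}(\xi)\,Q(d\xi)$ does not depend on $n,i,j$; (3) for every $n$ and $i\in[n]$, the $n-1$ random variables $\rho^n_{ij}$, $j\in[n]\setminus\{i\}$, are mutually independent under $Q$. Let the quenched measures $Q_\xi$, $\xi\in\Xi$, the annealed measure $\mathbb{Q}$, and the processes $(\hat X^n,\hat L^n)$, which satisfy $$\hat X^n_i(t)=\hat X^n_{0,i}+\hat W^n_i(t)+\hat L^n_i(t)+\frac1{n-1}\sum_{j\neq i}\rho^n_{ij}\hat L^n_j(t),\qquad i\in[n],\ t\ge0,$$ be as defined in the context, and let $$\hat\mu^n_t=\frac1n\sum_{i\in[n]}\delta_{(\hat X^n_i(t),\hat L^n_i(t))},\qquad \hat\lambda^n(t)=\frac1n\sum_{i\in[n]}\hat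 L^n_i(t).$$ Let $(\overline X,\overline L,\lambda)$ be the pathwise unique strong solution of $$\overline X(t)=\overline X_0+\overline W(t)+\overline L(t)+a\lambda(t),\qquad\lambda(t)=\mathbb{E}\,\overline L(t),\qquad t\ge0,$$ with $\overline X_0\sim\mu_0$ and $\overline W$ a $(b,\sigma)$-BM independent of $\overline X_0$, let $(\overline X_i,\overline L_i)$, $i\in\mathbb{N}$, be independent copies of $(\overline X,\overline L)$, and let $\mu_t$ be the law of $(\overline X(t),\overline L(t))$. Let $k\in\mathbb{N}$. Then under $\mathbb{Q}$, as well as for $Q$-a.e. $\xi\in\Xi$ under $Q_\xi$, one has, as $n\to\infty$, $(\hat X^n_i,\hat L^n_i)_{i\in[k]}\Rightarrow(\overline X_i,\overline L_i)_{i\in[k]}$ in $C(\mathbb{R}_+,\mathbb{R}^{2k})$ and $(\hat\mu^n,\hat\lambda^n)\to(\mu,\lambda)$ in $C(\mathbb{R}_+,\mathcal{P}(\mathbb{R}^2))\times C(\mathbb{R}_+,\mathbb{R})$ in probability.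
   Context: Notation: $\mathbb{R}_+=[0,\infty)$, $[n]=\{1,\dots,n\}$. For a Polish space $E$, $C(\mathbb{R}_+,E)$ is the space of continuous paths with the topology of uniform convergence on compacts, and $\mathcal{P}(E)$ is the set of Borel probability measures on $E$ with the weak topology. $\Rightarrow$ denotes convergence in distribution. $C_+(\mathbb{R}_+,\mathbb{R}_+)$ is the set of continuous nondecreasing functions $\mathbb{R}_+\to\mathbb{R}_+$ starting at $0$. $C^{(m)}=C(\mathbb{R}_+,\mathbb{R}^m)$ with Borel $\sigma$-algebra $\mathcal C^{(m)}$; $S^{(n)}=\mathbb{R}_+^n$ with Borel $\sigma$-algebra $\mathcal S^{(n)}$. An $(n,b,\sigma)$-BM is an $n$-dimensional Brownian motion starting at $0$ whose components are i.i.d. Brownian motions with drift coefficient $b$ and diffusion coefficient $\sigma$; a $(b,\sigma)$-BM is a $(1,b,\sigma)$-BM. Reflection map: let $\mathcal R^{(n)}$ be the set of $n\times n$ matrices $R=\mathbf I_n+A$ such that the matrix $|A|$ of absolute values of the entries of $A$ has spectral radius $<1$. For $R\in\mathcal R^{(n)}$ and continuous $w:\mathbb{R}_+\to\mathbb{R}^n$ with $w(0)\in\mathbb{R}_+^n$, $(x,\ell)=\Gamma^{(n)}(w;R)$ denotes the unique pair of continuous paths with $x=w+R\ell$, $x(t)\in\mathbb{R}_+^n$ for all $t$, $\ell_i\in C_+(\mathbb{R}_+,\mathbb{R}_+)$ and $\int_0^\infty x_i\,d\ell_i=0$ for all $i\in[n]$ (Harrison–Reiman map). It is known to be well defined and jointly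 measurable in $(w,R)$. Random reflection matrix: $\hat R^{(n)}_{ii}=1$, $\hat R^{(n)}_{ij}=\rho^n_{ij}/(n-1)$ for $i\ne j$; by (1), $\hat R^{(n)}(\xi)\in\mathcal R^{(n)}$ for all $\xi$. Quenched measure: let $(\hat\Xi,\hat{\mathcal A})=\big(\prod_{n\ge2}S^{(n)}\times C^{(3n)},\ \bigotimes_{n\ge2}\mathcal S^{(n)}\otimes\mathcal C^{(3n)}\big)$ with canonical process $(\hat X^n_0,\hat W^n,\hat X^n,\hat L^n)_{n\ge2}$. For every $\xi\in\Xi$, $Q_\xi$ is a probability measure on $(\hat\Xi,\hat{\mathcal A})$ under which, for each $n$, $\hat X^n_0\sim\nu^{(n)}$, $\hat W^n$ is an $(n,b,\sigma)$-BM independent of $\hat X^n_0$, and $Q_\xi$-a.s. $(\hat X^n,\hat L^n)=\Gamma^{(n)}(\hat X^n_0+\hat W^n;\hat R^{(n)}(\xi))$; the map $\xi\mapsto Q_\xi(\hat A)$ is $\mathcal A$-measurable for every $\hat A\in\hat{\mathcal A}$. Annealed measure: $\mathbb{Q}$ is the probability measure on $(\Xi\times\hat\Xi,\mathcal A\otimes\hat{\mathcal A})$ with $\mathbb{Q}(A\times\hat A)=\int_A Q_\xi(\hat A)\,Q(d\xi)$ for $A\in\mathcal A$, $\hat A\in\hat{\mathcal A}$. On this space $\hat X^n_0,\hat W^n,\hat X^n,\hat L^n$ are functions of the second coordinate and $\rho^n$ is a function of the first coordinate. Solution of the limiting equation: $\overline X$ is continuous and $\mathbb{R}_+$-valued,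 $\overline L\in C_+(\mathbb{R}_+,\mathbb{R}_+)$, $\int_{[0,\infty)}\overline X\,d\overline L=0$ a.s., and $\lambda$ is finite and continuous; a pathwise unique strong solution exists for every $a>-1$. *)

(* Defs.v *)
From HB Require Import structures.
From mathcomp Require Import all_boot all_order all_algebra all_fingroup.
From mathcomp Require Import all_classical all_reals all_analysis.
From mathcomp Require Import measurable_realfun lra.

Set Implicit Arguments.
Unset Strict Implicit.
Unset Printing Implicit Defensive.

Import Order.TTheory GRing.Theory Num.Theory.
Import numFieldTopology.Exports numFieldNormedType.Exports.

Local Open Scope classical_set_scope.
Local Open Scope ring_scope.

HB.instance Definition _ (E F : ptopologicalType) := Pointed.on (E * F)%type.
HB.instance Definition _ (E F : puniformType) := Pointed.on (E * F)%type.

Definition borel (E : ptopologicalType) : measurableType (@open E).-sigma :=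
  g_sigma_algebraType (@open E).

Lemma continuous_borel (E F : ptopologicalType) (f : E -> F) :
  continuous f -> measurable_fun [set: borel E] (f : borel E -> borel F).
Proof.
move=> cf; apply: (@measurability _ _ (borel E) (borel F) _ _ (@open F)) => //.
move=> _ [B oB <-]; rewrite setTI; apply: sub_sigma_algebra.
by move/continuousP : cf; exact.
Qed.

Lemma continuous_borelR (E : ptopologicalType) (R : realType) (f : E -> R) :
  continuous f -> measurable_fun [set: borel E] (f : borel E -> R).
Proof.
move=> cf.
apply: (measurability _ (RGenOpens.measurableE R)) => //.
move=> _ [_ [a [b ->]] <-]; rewrite setTI; apply: sub_sigma_algebra.
move/continuousP : cf; apply; exact: interval_open.
Qed.

Definition Rplus (R : realType) : Type := set_type [set x : R | 0 <= x].

HB.instance Definition _ (R : realType) :=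
  PseudoMetric.copy (Rplus R) (set_type [set x : R | 0 <= x]).

Definition Rplus_of (R : realType) (x : R) (x0 : 0 <= x) : Rplus R :=
  exist _ x (mem_set x0).

Definition Rplus0 (R : realType) : Rplus R := Rplus_of (lexx (0 : R)).

HB.instance Definition _ (R : realType) := isPointed.Build (Rplus R) (Rplus0 R).

Definition Rplus_val {R : realType} (t : Rplus R) : R := \val t.

Lemma max0_ge0 (R : realType) (x : R) : 0 <= Num.max 0 x.
Proof. by rewrite le_max lexx. Qed.

Definition pos_part (R : realType) (x : R) : Rplus R := Rplus_of (max0_ge0 x).

Lemma Rplus_val_continuous (R : realType) : continuous (@Rplus_val R).
Proof. exact: (@initial_continuous _ _ (@Rplus_val R)). Qed.

Lemma pos_part_continuous (R : realType) : continuous (@pos_part R).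
Proof.
apply: (@continuous_comp_initial _ _ _ (@Rplus_val R)) => x.
apply: (@continuous_max R R (fun=> 0) id x); [exact: cvg_cst|exact: cvg_id].
Qed.

Lemma Rplus_valK (R : realType) : cancel Rplus_val (@pos_part R).
Proof.
move=> t; apply: val_inj => /=; rewrite /pos_part /=.
by apply/max_idPr; move: (set_mem (valP t)).
Qed.

Definition cpath (R : realType) (E : uniformType) : Type :=
  continuousType (Rplus R) E.

(* [{family compact, _}] carries the uniform structure of uniform convergence
   on compact sets. *)
HB.instance Definition _ (R : realType) (E : uniformType) :=
  Uniform.copy (cpath R E)
    (@initial_topology (continuousType (Rplus R) E)
       {family compact, Rplus R -> E} (fun x => x : Rplus R -> E)).

Definition mkpath (R : realType) (E : uniformType) (f : Rplus R -> E)
  (cf : continuous f) : cpath R E := mkcts cf.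

Lemma const_continuous (R : realType) (E : uniformType) (e : E) :
  continuous (fun _ : Rplus R => e).
Proof. by move=> t; apply: cvg_cst; exact: nbhs_filter. Qed.

Definition const_path (R : realType) (E : uniformType) (e : E) : cpath R E :=
  mkpath (@const_continuous R E e).

HB.instance Definition _ (R : realType) (E : puniformType) :=
  isPointed.Build (cpath R E) (@const_path R E point).

Definition path_map (R : realType) (E F : uniformType) (f : E -> F)
    (cf : continuous f) (x : cpath R E) : cpath R F :=
  mkpath (fun t => continuous_comp (@cts_fun _ _ x t) (cf (x t))).

Lemma path_eval_continuous (R : realType) (E : uniformType) (t : Rplus R) :
  continuous (fun x : cpath R E => x t).
Proof.
move=> x A /=; rewrite -nbhs_entourageE => -[V entV VA].
have nV : nbhs (x : {family compact, Rplus R -> E})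
    [set g | forall y, [set t] y -> V (x y, g y)].
  by apply: fam_nbhs => //; exact: compact_set1.
have nV' : nbhs x [set y : cpath R E | V (x t, y t)].
  have := @initial_continuous _ {family compact, Rplus R -> E}
    (fun x : continuousType (Rplus R) E => x : Rplus R -> E) x _ nV.
  rewrite nbhs_simpl => nV'.
  by apply: (@filterS _ (nbhs x) _ _ _ _ nV') => y /= /(_ t erefl).
by apply: filterS nV' => y /= Vy; apply: VA; exact/mem_set.
Qed.

Lemma mx_continuous (T E : topologicalType) m n (f : T -> 'M[E]_(m, n)) :
  (forall i j, continuous (fun x => f x i j)) -> continuous f.
Proof.
move=> cf x A [P fP PA]; rewrite /= nbhs_simpl.
have : \forall y \near x, forall i j, P i j (f y i j).
  by apply: filter_forall => i; apply: filter_forall => j; exact: cf (fP i j).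
by apply: filterS => y Py; exact: PA.
Qed.

Lemma mx_entry_continuous (E : topologicalType) m n (i : 'I_m) (j : 'I_n) :
  continuous (fun M : 'M[E]_(m, n) => M i j).
Proof.
move=> M A MA; exists (fun i' j' => [set x | i' = i /\ j' = j -> A x]).
  move=> i' j' /=; have [[-> ->]|ne] := pselect (i' = i /\ j' = j).
    by apply: filterS MA => x Ax _.
  by apply: filterE => x /ne.
by move=> N /= /(_ i j); exact.
Qed.

Lemma usubmx_continuous (E : topologicalType) m1 m2 n :
  continuous (@usubmx E m1 m2 n).
Proof.
apply: mx_continuous => i j.
under eq_fun do rewrite mxE; exact: mx_entry_continuous.
Qed.

Lemma dsubmx_continuous (E : topologicalType) m1 m2 n :
  continuous (@dsubmx E m1 m2 n).
Proof.
apply: mx_continuous => i j.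
under eq_fun do rewrite mxE; exact: mx_entry_continuous.
Qed.

Definition bounded_continuous (R : realType) (E : topologicalType) : Type :=
  {f : E -> R | continuous f /\ exists M, forall x, `|f x| <= M}.

Definition Prob (R : realType) (E : ptopologicalType) : Type :=
  probability (borel E) R.

HB.instance Definition _ (R : realType) (E : ptopologicalType) :=
  gen_eqMixin (Prob R E).
HB.instance Definition _ (R : realType) (E : ptopologicalType) :=
  gen_choiceMixin (Prob R E).
HB.instance Definition _ (R : realType) (E : ptopologicalType) :=
  isPointed.Build (Prob R E) (\d_(point : borel E) : probability (borel E) R).

Definition Prob_integrals (R : realType) (E : ptopologicalType) (mu : Prob R E)
    : prod_topology (fun _ : bounded_continuous R E => R) :=
  fun f => (\int[mu]_x sval f x)%R.

(* The coarsest uniform structure making [mu |-> \int f dmu] uniformly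
   continuous for every bounded continuous [f]; it induces the weak topology. *)
HB.instance Definition _ (R : realType) (E : ptopologicalType) :=
  Uniform.copy (Prob R E) (initial_topology (@Prob_integrals R E)).

Lemma Prob_continuous (R : realType) (T : topologicalType)
    (E : ptopologicalType) (m : T -> Prob R E) :
  (forall f : bounded_continuous R E,
    continuous (fun t => (\int[m t]_x sval f x)%R)) ->
  continuous m.
Proof.
move=> cm; apply: continuous_comp_initial => t.
apply/cvg_sup => f; apply: (@continuous_comp_initial _ T R
  (@proj _ (fun _ : bounded_continuous R E => R) f)).
exact: cm.
Qed.

Section empirical_measure.
Context (R : realType) (E : ptopologicalType) (n : nat) (x : 'I_n.+1 -> E).

Definition empirical (A : set (borel E)) : \bar R :=
  ((n.+1%:R^-1)%:E * \sum_(i < n.+1) \d_(x i : borel E) A)%E.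

Let inv_ge0 : 0 <= n.+1%:R^-1 :> R.
Proof. by rewrite invr_ge0. Qed.

Let empirical_sum := msum (fun k => \d_(x (inord k) : borel E)
  : {measure set (borel E) -> \bar R}) n.+1.

Let empiricalE : empirical = mscale (NngNum inv_ge0) empirical_sum.
Proof.
apply/funext => A; rewrite /empirical /mscale/= /msum.
by congr (_ * _)%E; apply: eq_bigr => i _; rewrite inord_val.
Qed.

Let empirical0 : empirical set0 = 0%E.
Proof. by rewrite empiricalE measure0. Qed.

Let empirical_ge0 A : (0 <= empirical A)%E.
Proof. by rewrite empiricalE measure_ge0. Qed.

Let empirical_sigma_additive : semi_sigma_additive empirical.
Proof. by rewrite empiricalE; exact: measure_semi_sigma_additive. Qed.

HB.instance Definition _ := isMeasure.Build _ _ _ empirical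
  empirical0 empirical_ge0 empirical_sigma_additive.

Let empirical_setT : empirical setT = 1%E.
Proof.
rewrite /empirical (eq_bigr (fun=> 1%:E)); last first.
  by move=> i _; rewrite diracT.
rewrite sumEFin -EFinM big_const_ord iter_addr_0.
by rewrite mulVf.
Qed.

HB.instance Definition _ :=
  Measure_isProbability.Build _ _ _ empirical empirical_setT.

Definition empirical_measure : Prob R E := empirical.

Lemma Rintegral_empirical (f : bounded_continuous R E) :
  (\int[empirical_measure]_y sval f y)%R = n.+1%:R^-1 * \sum_i sval f (x i).
Proof.
have mf : measurable_fun [set: borel E] (sval f).
  by apply: continuous_borelR; case: f => f [].
have ge0 (g : E -> R) :
    (forall y, 0 <= g y) -> measurable_fun [set: borel E] g ->
    (\int[empirical]_y (g y)%:E = (n.+1%:R^-1 * \sum_i g (x i))%R%:E)%E.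
  move=> g0 mg.
  rewrite (_ : integral _ _ _ =
    (\int[mscale (NngNum inv_ge0) empirical_sum]_y (g y)%:E)%E); last first.
    by congr integral; exact: empiricalE.
  rewrite ge0_integral_mscale//; last 2 first.
  - exact/measurable_EFinP.
  - by move=> y _; rewrite lee_fin.
  rewrite ge0_integral_measure_sum//; last 2 first.
  - by move=> y _; rewrite lee_fin.
  - exact/measurable_EFinP.
  rewrite EFinM -sumEFin; congr (_ * _)%E; apply: eq_bigr => i _.
  rewrite integral_dirac//; last exact/measurable_EFinP.
  by rewrite diracT mul1e inord_val.
rewrite /Rintegral integralE.
rewrite (_ : (fun y => _)^\+%E = (fun y => (Num.max (sval f y) 0)%:E));
  last first.
  by apply/funext => y; rewrite funeposE EFin_max.
rewrite (_ : (fun y => _)^\-%E = (fun y => (Num.max (- sval f y) 0)%:E));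
  last first.
  by apply/funext => y; rewrite funenegE EFin_max.
rewrite !ge0 /=; last 4 first.
- by move=> y; rewrite le_max lexx orbT.
- by apply: measurable_maxr => //; exact: measurableT_comp.
- by move=> y; rewrite le_max lexx orbT.
- by apply: measurable_maxr.
rewrite -mulrBr -sumrB; congr (_ * _); apply: eq_bigr => i _.
by rewrite /Num.max; case: ltP => h1; case: ltP => h2; lra.
Qed.

End empirical_measure.

Lemma average_continuous (R : realType) (T : topologicalType) n
    (g : 'I_n -> T -> R) (c : R) :
  (forall i, continuous (g i)) -> continuous (fun t => c * \sum_i g i t).
Proof.
move=> cg t; apply: cvgMl_tmp; apply: cvg_big; last by move=> i _; exact: cg.
exact: add_continuous.
Qed.

Definition empirical_path (R : realType) (E : puniformType) n
    (x : 'I_n.+1 -> cpath R E) (t : Rplus R) : Prob R E :=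
  empirical_measure R (fun i => x i t).

Lemma empirical_path_continuous (R : realType) (E : puniformType) n
    (x : 'I_n.+1 -> cpath R E) :
  continuous (empirical_path x).
Proof.
apply: Prob_continuous => f.
under eq_fun do rewrite /empirical_path Rintegral_empirical.
apply: average_continuous => i t.
apply: (@continuous_comp _ _ _ (x i) (sval f)); first exact: cts_fun.
by have [cf _] := svalP f; exact: cf.
Qed.

Section law_path.
Context (R : realType) (E : puniformType) d (T : measurableType d).
Context (P : probability T R) (X : {RV P >-> borel (cpath R E)}).

Definition RV_at (t : Rplus R) (w : T) : borel E := (X w : cpath R E) t.

Lemma measurable_RV_at (t : Rplus R) : measurable_fun [set: T] (RV_at t).
Proof.
have := continuous_borel (@path_eval_continuous R E t).
by move/measurableT_comp; apply.
Qed.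

HB.instance Definition _ t :=
  isMeasurableFun.Build _ _ _ _ (RV_at t) (measurable_RV_at t).

Definition law_at (t : Rplus R) : Prob R E :=
  distribution P (RV_at t).

Let integrable_RV_at (f : bounded_continuous R E) (t : Rplus R) :
  P.-integrable [set: T] (EFin \o (fun w => sval f (RV_at t w))).
Proof.
case: f => f [/= cf [M fM]]; apply: measurable_bounded_integrable => //.
- by apply: (le_lt_trans (probability_le1 P measurableT)); rewrite ltry.
- exact: measurableT_comp (continuous_borelR cf) (measurable_RV_at t).
- exists M; split; [exact: num_real|move=> y My z _].
  exact: le_trans (fM _) (ltW My).
Qed.

Let continuous_Rintegral_RV_at (f : bounded_continuous R E) :
  continuous (fun s : R => (\int[P]_w sval f (RV_at (pos_part s) w))%R).
Proof.
have [cf [M fM]] := svalP f; move=> s.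
apply: (@continuity_under_integral _ _ _ P
  (fun s w => sval f (RV_at (pos_part s) w)) _ measurableT (s - 1) (s + 1) _ _
  (fun=> M)).
- by move=> x _; exact: integrable_RV_at.
- apply: aeW => w _ x _.
  apply: (@continuous_comp _ _ _ (fun x => RV_at (pos_part x) w) (sval f)).
    apply: (@continuous_comp _ _ _ (@pos_part R) (X w : cpath R E)).
      exact: pos_part_continuous.
    exact: cts_fun.
  exact: cf.
- exact: (finite_measure_integrable_cst P M).
- by move=> x _; exact: aeW.
- by rewrite inE/= in_itv/=; apply/andP; split; lra.
Qed.

Lemma law_at_continuous : continuous law_at.
Proof.
apply: Prob_continuous => f.
have -> : (fun t => (\int[law_at t]_x sval f x)%R) =
    (fun s : R => (\int[P]_w sval f (RV_at (pos_part s) w))%R) \o @Rplus_val R.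
  apply/funext => t /=; rewrite Rplus_valK /Rintegral /law_at.
  rewrite integral_distribution//; last exact: integrable_RV_at.
  apply/measurable_EFinP; apply: continuous_borelR.
  by have [] := svalP f.
move=> t; apply: continuous_comp; first exact: Rplus_val_continuous.
exact: continuous_Rintegral_RV_at.
Qed.

Definition law_path : cpath R (Prob R E) := mkpath law_at_continuous.

End law_path.

Arguments law_path {R E d T} P X.

Definition cvg_in_law (R : realType) d (T : measurableType d)
    (P : probability T R) (E : ptopologicalType) (X : nat -> T -> E)
    d' (T' : measurableType d') (P' : probability T' R) (Y : T' -> E) : Prop :=
  forall f : bounded_continuous R E,
    (\int[P]_w sval f (X n w))%R @[n --> \oo] --> (\int[P']_w sval f (Y w))%R.

Definition cvg_in_probability (R : realType) (d : nat -> measure_display)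
    (T : forall n, measurableType (d n)) (P : forall n, probability (T n) R)
    (E : topologicalType) (X : forall n, T n -> E) (c : E) : Prop :=
  forall U : set E, open U -> U c ->
    P n (X n @^-1` (~` U)) @[n --> \oo] --> 0%E.

Definition independent_family (R : realType) d (T : measurableType d)
    (P : probability T R) (I : eqType) (J : pred I) d' (E : measurableType d')
    (X : I -> T -> E) : Prop :=
  forall (s : seq I) (B : I -> set E),
    uniq s -> {in s, forall i, J i} -> (forall i, measurable (B i)) ->
    P (\bigcap_(i in [set` s]) (X i @^-1` B i)) =
      (\prod_(i <- s) P (X i @^-1` B i))%E.

Definition independent_pair (R : realType) d (T : measurableType d)
    (P : probability T R) d1 (E1 : measurableType d1) d2
    (E2 : measurableType d2) (X : T -> E1) (Y : T -> E2) : Prop :=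
  forall (A : set E1) (B : set E2), measurable A -> measurable B ->
    P (X @^-1` A `&` Y @^-1` B) = (P (X @^-1` A) * P (Y @^-1` B))%E.

Definition path_entry (R : realType) n (i : 'I_n) (x : cpath R 'cV[R]_n) :
    cpath R R :=
  path_map (@mx_entry_continuous R n 1 i ord0) x.

Lemma path_pair_continuous (R : realType) (E F : uniformType)
    (x : cpath R E) (y : cpath R F) :
  continuous (fun t => (x t, y t)).
Proof.
move=> t; apply: cvg_pair; first exact: nbhs_filter.
- exact: (@cts_fun _ _ x).
- exact: (@cts_fun _ _ y).
Qed.

Definition path_pair (R : realType) (E F : uniformType)
    (x : cpath R E) (y : cpath R F) : cpath R (E * F)%type :=
  mkpath (@path_pair_continuous R E F x y).

Lemma path_row_continuous (R : realType) (E : uniformType) k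
    (x : 'I_k -> cpath R E) :
  continuous (fun t => \row_(i < k) x i t).
Proof.
apply: mx_continuous => i j; under eq_fun do rewrite mxE; exact: cts_fun.
Qed.

Definition path_row (R : realType) (E : uniformType) k
    (x : 'I_k -> cpath R E) : cpath R 'rV[E]_k :=
  mkpath (@path_row_continuous R E k x).

Lemma path_average_continuous (R : realType) n (x : 'I_n -> cpath R R) :
  continuous (fun t => n%:R^-1 * \sum_i x i t).
Proof. by apply: average_continuous => i; exact: cts_fun. Qed.

Definition path_average (R : realType) n (x : 'I_n -> cpath R R) : cpath R R :=
  mkpath (@path_average_continuous R n x).

(* Drift coefficient [b] and diffusion coefficient [sigma]:
   [b * t + sigma * B t] with [B] standard, so that increments over [s, t] have
   standard deviation [sigma * sqrt (t - s)], the second argument of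
   [normal_prob]. *)
Definition brownian_motion (R : realType) d (T : measurableType d)
    (P : probability T R) (b sigma : R) (W : T -> cpath R R) : Prop :=
  [/\ measurable_fun setT (W : T -> borel (cpath R R)),
      {ae P, forall w, W w (Rplus0 R) = 0},
      forall s t : Rplus R, Rplus_val s < Rplus_val t ->
        forall A : set R, measurable A ->
          P ((fun w => W w t - W w s) @^-1` A) =
          normal_prob (b * (Rplus_val t - Rplus_val s))
            (sigma * Num.sqrt (Rplus_val t - Rplus_val s)) A
    & forall (k : nat) (t : nat -> Rplus R),
        (forall i j, (i <= j)%N -> Rplus_val (t i) <= Rplus_val (t j)) ->
        independent_family P predT
          (fun (i : 'I_k) w => W w (t i.+1) - W w (t i))].

Definition brownian_motion_n (R : realType) n d (T : measurableType d)
    (P : probability T R) (b sigma : R) (W : T -> cpath R 'cV[R]_n) : Prop :=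
  [/\ measurable_fun setT (W : T -> borel (cpath R 'cV[R]_n)),
      forall i, brownian_motion P b sigma (fun w => path_entry i (W w))
    & independent_family P predT
        (fun i w => path_entry i (W w) : borel (cpath R R))].

(* [x] and [l] take values in R_+, [l] is nondecreasing from 0 and
   [\int x dl = 0], the integral being with respect to the Stieltjes measure of
   [l] extended by [l 0] to the negative half-line. *)
Definition complementary (R : realType) (x l : cpath R R) : Prop :=
  [/\ forall t, 0 <= x t,
      l (Rplus0 R) = 0,
      forall s t : Rplus R, Rplus_val s <= Rplus_val t -> l s <= l t
    & exists F : cumulative R R,
        (forall s, F s = l (pos_part s)) /\
        (\int[lebesgue_stieltjes_measure F]_(s in `[0%R, +oo[)
           (x (pos_part s))%:E = 0)%E].

(* The graph of the Harrison-Reiman map: [(x, l) = Gamma(w; M)]. *)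
Definition reflection_map (R : realType) n (w : Rplus R -> 'cV[R]_n)
    (M : 'M[R]_n) (x l : cpath R 'cV[R]_n) : Prop :=
  (forall t, x t = w t + M *m l t) /\
  (forall i, complementary (path_entry i x) (path_entry i l)).

Definition reflection_matrix (R : realType) n (rho : 'I_n -> 'I_n -> R) :
    'M[R]_n :=
  \matrix_(i, j) if i == j then 1 else rho i j / n.-1%:R.

(* The index [m] stands for the dimension [n = m.+2], so that it ranges over
   all [n >= 2]; [n + (n + n)] is [3n], for the processes W, X and L. *)
Definition hat_component (R : realType) (n : nat) :=
  (borel 'cV[Rplus R]_n * borel (cpath R 'cV[R]_(n + (n + n))))%type.

Definition hat_product (R : realType) : Type :=
  forall m : nat, hat_component R m.+2.

Definition hat_cylinders (R : realType) : set (set (hat_product R)) :=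
  [set A | exists m (B : set (hat_component R m.+2)),
     measurable B /\ A = (fun w => w m) @^-1` B].

Definition hat_space (R : realType) :
    measurableType (@hat_cylinders R).-sigma :=
  g_sigma_algebraType (@hat_cylinders R).

Section canonical_process.
Context (R : realType) (m : nat) (w : hat_space R).
Let n := m.+2.

Definition hat_X0 : borel 'cV[Rplus R]_n := (w m).1.

Definition hat_W : cpath R 'cV[R]_n :=
  path_map (@usubmx_continuous R n (n + n) 1) (w m).2.

Definition hat_X : cpath R 'cV[R]_n :=
  path_map (@usubmx_continuous R n n 1)
    (path_map (@dsubmx_continuous R n (n + n) 1) (w m).2).

Definition hat_L : cpath R 'cV[R]_n :=
  path_map (@dsubmx_continuous R n n 1)
    (path_map (@dsubmx_continuous R n (n + n) 1) (w m).2).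

Definition hat_XL (i : 'I_n) : cpath R (R * R)%type :=
  path_pair (path_entry i hat_X) (path_entry i hat_L).

Definition hat_mu : cpath R (Prob R (R * R)%type) :=
  mkpath (@empirical_path_continuous R (R * R)%type m.+1 hat_XL).

Definition hat_lambda : cpath R R :=
  path_average (fun i => path_entry i hat_L).

(* The first [k] particles. For [n < k] the default value of [inord] stands in
   for the missing ones, which is irrelevant in the limit. *)
Definition hat_tagged (k : nat) : cpath R 'rV[(R * R)%type]_k :=
  path_row (fun i : 'I_k => hat_XL (inord i)).

End canonical_process.

Definition exchangeable (R : realType) n (nu : Prob R 'cV[Rplus R]_n) : Prop :=
  forall (s : 'S_n) (A : set (borel 'cV[Rplus R]_n)), measurable A ->
    nu (row_perm s @^-1` A) = nu A.

Definition has_marginals (R : realType) n (nu : Prob R 'cV[Rplus R]_n)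
    (mu0 : Prob R (Rplus R)) : Prop :=
  forall (i : 'I_n) (A : set (borel (Rplus R))), measurable A ->
    nu ((fun x => x i ord0) @^-1` A) = mu0 A.

Definition quenched_law (R : realType) (b sigma : R)
    (nu : forall m, Prob R 'cV[Rplus R]_m.+2)
    (rho : forall m, 'I_m.+2 -> 'I_m.+2 -> R)
    (P : probability (hat_space R) R) : Prop :=
  forall m : nat,
    [/\ forall A : set (borel 'cV[Rplus R]_m.+2), measurable A ->
          P (@hat_X0 R m @^-1` A) = nu m A,
        brownian_motion_n P b sigma (@hat_W R m),
        independent_pair P (@hat_X0 R m)
          (@hat_W R m : hat_space R -> borel (cpath R 'cV[R]_m.+2))
      & {ae P, forall w, reflection_map
          (fun t => map_mx (@Rplus_val R) (hat_X0 m w) + hat_W m w t)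
          (reflection_matrix (rho m)) (hat_X m w) (hat_L m w)}].

Lemma fst_continuous (E F : topologicalType) : continuous (@fst E F).
Proof. by move=> p; exact: cvg_fst. Qed.

Lemma snd_continuous (E F : topologicalType) : continuous (@snd E F).
Proof. by move=> p; exact: cvg_snd. Qed.

Definition history (R : realType) d (T : measurableType d)
    (X0 : T -> Rplus R) (W : T -> cpath R R) (t : Rplus R) : set (set T) :=
  <<s [set A |
    (exists B : set (borel (Rplus R)), measurable B /\ A = X0 @^-1` B) \/
    (exists (s : Rplus R) (B : set R),
       [/\ Rplus_val s <= Rplus_val t, measurable B &
           A = (fun w => W w s) @^-1` B])] >>.

(* [XL] is the pair of paths (X, L); the last item says that the solution is
   strong, i.e. adapted to the completed history of [X0] and [W]. *)
Definition limit_solution (R : realType) d (T : measurableType d)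
    (P : probability T R) (b sigma a : R) (mu0 : Prob R (Rplus R))
    (X0 : T -> Rplus R) (W : T -> cpath R R)
    (XL : T -> cpath R (R * R)%type) (lambda : cpath R R) : Prop :=
  let X w := path_map (@fst_continuous R R) (XL w) in
  let L w := path_map (@snd_continuous R R) (XL w) in
  [/\ measurable_fun setT (X0 : T -> borel (Rplus R)) /\
        (forall A : set (borel (Rplus R)), measurable A ->
           P (X0 @^-1` A) = mu0 A),
      brownian_motion P b sigma W,
      independent_pair P (X0 : T -> borel (Rplus R))
        (W : T -> borel (cpath R R)),
      {ae P, forall w,
         (forall t, X w t = Rplus_val (X0 w) + W w t + L w t + a * lambda t) /\
         complementary (X w) (L w)} /\
      (forall t, 'E_P[fun w => L w t] = (lambda t)%:E)%E
    & forall (t : Rplus R) (A : set (borel (R * R)%type)), measurable A ->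
        exists2 B, history X0 W t B &
          P.-negligible (((fun w => XL w t) @^-1` A) `+` B)].

(* Main.v *)
Require Import Defs.
From HB Require Import structures.
From mathcomp Require Import all_boot all_order all_algebra all_fingroup.
From mathcomp Require Import all_classical all_reals all_analysis.
From mathcomp Require Import measurable_realfun ring lra.

(* The particles are coupled with the copies of the limit driven by their own
   initial positions and noises; freezing [lambda], each copy is an explicit
   Lipschitz functional of its data by Skorokhod's formula for the
   one-dimensional reflection.  By the same formula, the sup-distance Delta_i
   between the local times of particle i and of its copy satisfies
   Delta_i <= average_j |rho_ij| Delta_j + e_i, where e_i is the sup over a time
   interval of |average_j rho_ij Lbar_j - a lambda|.  As |rho_ij| <= 1 - eps,
   averaging over i closes the estimate.  Second moments, exchangeability and
   the law of large numbers for the initial positions make E e_i small for all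
   weights in [-1, 1], once row averages of rho are close to a; an exponential
   moment bound and the Borel-Cantelli lemma give the latter for Q-almost every
   rho.  Convergence in law is tested on bounded Lipschitz functionals and
   extended by inf-convolution.  The annealed statements follow from the
   quenched ones by dominated convergence. *)

Import Defs.

Set Implicit Arguments.
Unset Strict Implicit.
Unset Printing Implicit Defensive.

Import Order.TTheory GRing.Theory Num.Theory.
Import numFieldTopology.Exports numFieldNormedType.Exports.

Local Open Scope classical_set_scope.
Local Open Scope ring_scope.

(** * Bounded random variables and independence *)

(** No joint law on path space is ever built. Independence and equality of laws are used through
    expectations of products of bounded functions of the separate data, and are transferred by
    rounding real quantities to finitely many values. This is why test functions are Lipschitz for
    an explicit distance between paths: up to a small error they depend on finitely many real
    numbers, through piecewise linear interpolation or through a partition of unity around a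
    countable dense set of paths. Two difficulties shape the estimates. The local times are
    unbounded and only their mean [lambda] is known; the law of large numbers is therefore applied
    to truncated local times, and the excess is controlled by its mean, which vanishes as the
    truncation level grows. The error e_i moreover contains a supremum over time; since local times
    and [lambda] are nondecreasing, it reduces to finitely many times. Suprema over time and events
    are not integrated themselves: they are dominated by measurable variables of small mean
    ([mean_le]), which sidesteps their measurability. *)

Section expectation.
Context d (T : measurableType d) (R : realType) (P : probability T R).
Implicit Types f g : T -> R.

Definition bounded_rv f := measurable_fun setT f /\ exists M, forall x, `|f x| <= M.

Definition Ex f : R := (\int[P]_x f x)%R.

Lemma bounded_rv_integrable f : bounded_rv f -> P.-integrable setT (EFin \o f).
Proof.
move=> [mf [M fM]]; apply: measurable_bounded_integrable => //.
  by apply: (le_lt_trans (probability_le1 P measurableT)); rewrite ltry.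
exists M; split; [exact: num_real|move=> y My z _].
exact: le_trans (fM _) (ltW My).
Qed.

Lemma EFin_Ex f : bounded_rv f -> ((Ex f)%:E = \int[P]_x (f x)%:E)%E.
Proof.
move=> bf; rewrite /Ex /Rintegral fineK//; apply: integrable_fin_num => //.
exact: bounded_rv_integrable.
Qed.

Lemma bounded_rv_cst c : bounded_rv (fun=> c).
Proof. by split; [exact: measurable_cst|exists `|c|]. Qed.

Lemma bounded_rvD f g : bounded_rv f -> bounded_rv g ->
  bounded_rv (fun x => f x + g x).
Proof.
move=> [mf [M fM]] [mg [N gN]]; split; first exact: measurable_funD.
by exists (M + N) => x; rewrite (le_trans (ler_normD _ _))// lerD.
Qed.

Lemma bounded_rvM f g : bounded_rv f -> bounded_rv g ->
  bounded_rv (fun x => f x * g x).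
Proof.
move=> [mf [M fM]] [mg [N gN]]; split; first exact: measurable_funM.
by exists (M * N) => x; rewrite normrM ler_pM.
Qed.

Lemma bounded_rvZ c f : bounded_rv f -> bounded_rv (fun x => c * f x).
Proof. exact/bounded_rvM/bounded_rv_cst. Qed.

Lemma bounded_rvN f : bounded_rv f -> bounded_rv (fun x => - f x).
Proof.
move=> [mf [M fM]]; split; first exact: measurable_funN.
by exists M => x; rewrite normrN.
Qed.

Lemma bounded_rvB f g : bounded_rv f -> bounded_rv g ->
  bounded_rv (fun x => f x - g x).
Proof. by move=> bf bg; apply: bounded_rvD => //; exact: bounded_rvN. Qed.

Lemma bounded_rv_norm f : bounded_rv f -> bounded_rv (fun x => `|f x|).
Proof.
move=> [mf [M fM]]; split; first exact: measurableT_comp.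
by exists M => x; rewrite normr_id.
Qed.

Lemma bounded_rv_sum I (s : seq I) (p : pred I) (F : I -> T -> R) :
  (forall i, bounded_rv (F i)) -> bounded_rv (fun x => \sum_(i <- s | p i) F i x).
Proof.
move=> bF; elim: s => [|i s IH].
  by under eq_fun do rewrite big_nil; exact: bounded_rv_cst.
under eq_fun do rewrite big_cons; case: (p i) => //.
exact: bounded_rvD.
Qed.

Lemma bounded_rv_prod I (s : seq I) (p : pred I) (F : I -> T -> R) :
  (forall i, bounded_rv (F i)) -> bounded_rv (fun x => \prod_(i <- s | p i) F i x).
Proof.
move=> bF; elim: s => [|i s IH].
  by under eq_fun do rewrite big_nil; exact: bounded_rv_cst.
under eq_fun do rewrite big_cons; case: (p i) => //.
exact: bounded_rvM.
Qed.

Lemma bounded_rv_indic (A : set T) : measurable A -> bounded_rv \1_A.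
Proof.
move=> mA; split; first exact: measurable_indic.
by exists 1 => x; rewrite indicE; case: (_ \in _); rewrite ?normr1 ?normr0.
Qed.

Lemma Ex_cst c : Ex (fun=> c) = c.
Proof. by rewrite /Ex Rintegral_cst//= [P _]probability_setT mulr1. Qed.

Lemma ExD f g : bounded_rv f -> bounded_rv g ->
  Ex (fun x => f x + g x) = Ex f + Ex g.
Proof. by move=> bf bg; apply: RintegralD => //; exact: bounded_rv_integrable. Qed.

Lemma ExZ c f : bounded_rv f -> Ex (fun x => c * f x) = c * Ex f.
Proof. by move=> bf; apply: RintegralZl => //; exact: bounded_rv_integrable. Qed.

Lemma ExB f g : bounded_rv f -> bounded_rv g ->
  Ex (fun x => f x - g x) = Ex f - Ex g.
Proof. by move=> bf bg; apply: RintegralB => //; exact: bounded_rv_integrable. Qed.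

Lemma Ex_sum I (s : seq I) (p : pred I) (F : I -> T -> R) :
  (forall i, bounded_rv (F i)) ->
  Ex (fun x => \sum_(i <- s | p i) F i x) = \sum_(i <- s | p i) Ex (F i).
Proof.
move=> bF; elim: s => [|i s IH].
  by under eq_fun do rewrite big_nil; rewrite big_nil Ex_cst.
under eq_fun do rewrite big_cons; rewrite big_cons; case: (p i) => //.
by rewrite ExD// ?IH//; exact: bounded_rv_sum.
Qed.

Lemma Ex_le f g : bounded_rv f -> bounded_rv g -> (forall x, f x <= g x) ->
  Ex f <= Ex g.
Proof.
by move=> bf bg fg; apply: le_Rintegral => //; exact: bounded_rv_integrable.
Qed.

Lemma Ex_ge0 f : (forall x, 0 <= f x) -> 0 <= Ex f.
Proof. by move=> f0; apply: Rintegral_ge0. Qed.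

Lemma le_norm_Ex f : bounded_rv f -> `|Ex f| <= Ex (fun x => `|f x|).
Proof. by move=> bf; apply: le_normr_Rintegral => //; exact: bounded_rv_integrable. Qed.

Lemma norm_Ex_le f M : bounded_rv f -> (forall x, `|f x| <= M) -> `|Ex f| <= M.
Proof.
move=> bf fM; rewrite (le_trans (le_norm_Ex bf))// -[leRHS]Ex_cst.
by apply: Ex_le => //; [exact: bounded_rv_norm|exact: bounded_rv_cst].
Qed.

Lemma Ex_near f g e : bounded_rv f -> bounded_rv g ->
  (forall x, `|f x - g x| <= e) -> `|Ex f - Ex g| <= e.
Proof.
by move=> bf bg fg; rewrite -ExB//; apply: norm_Ex_le => //; exact: bounded_rvB.
Qed.

Lemma Ex_indic (A : set T) : measurable A -> ((Ex \1_A)%:E = P A)%E.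
Proof. by move=> mA; rewrite EFin_Ex ?integral_indic ?setIT//; exact: bounded_rv_indic. Qed.

Lemma Ex_indicE (A : set T) : measurable A -> Ex \1_A = fine (P A).
Proof. by move=> mA; rewrite -Ex_indic. Qed.

Lemma eq_ae_Ex f g : bounded_rv f -> bounded_rv g ->
  {ae P, forall x, f x = g x} -> Ex f = Ex g.
Proof.
move=> [mf _] [mg _] fg; rewrite /Ex /Rintegral; congr fine.
apply: ae_eq_integral => //; [exact/measurable_EFinP|exact/measurable_EFinP|].
by apply: filterS fg => x /= -> _.
Qed.

Lemma Ex_le_integral f (V : T -> R) : bounded_rv f ->
  measurable_fun setT V -> (forall x, 0 <= V x) ->
  {ae P, forall x, `|f x| <= V x} ->
  (`|Ex f|%:E <= \int[P]_x (V x)%:E)%E.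
Proof.
move=> bf mV V0 fV.
rewrite EFin_normr_Rintegral//; last exact: bounded_rv_integrable.
have [mf _] := bf.
apply: (le_trans (le_abse_integral _ _ _)) => //; first exact/measurable_EFinP.
apply: ae_ge0_le_integral => //=.
- by apply/measurable_EFinP; exact: measurableT_comp.
- by move=> x _; rewrite lee_fin.
- exact/measurable_EFinP.
- by apply: filterS fV => x /= h _; rewrite lee_fin.
Qed.

Lemma Ex_cvg (F : nat -> T -> R) f M : (forall n, measurable_fun setT (F n)) ->
  (forall n x, `|F n x| <= M) -> (forall x, F n x @[n --> \oo] --> f x) ->
  Ex (F n) @[n --> \oo] --> Ex f.
Proof.
move=> mF FM Ff.
have mf : measurable_fun setT f.
  by apply: (measurable_fun_cvg (h := F)) => // x _; exact: Ff.
have fM x : `|f x| <= M.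
  have h : `|F n x| @[n --> \oo] --> `|f x| by apply: cvg_norm; exact: Ff.
  by rewrite -(cvg_lim _ h)//; apply: limr_le; [apply/cvg_ex; eexists; exact: h|exact: nearW].
suff : (\int[P]_x (F n x)%:E @[n --> \oo] --> (Ex f)%:E)%E by move/fine_cvgP => [].
rewrite EFin_Ex; last by split => //; exists M.
apply: (@dominated_cvg _ _ _ P setT measurableT (fun n x => (F n x)%:E) _ (fun=> M%:E)) => //.
- by move=> n; exact/measurable_EFinP.
- by move=> x _; apply: cvg_EFin; [exact: nearW|exact: Ff].
- by apply: bounded_rv_integrable; exact: bounded_rv_cst.
- by move=> n x _; rewrite /= lee_fin.
Qed.

Lemma bounded_rv_cvg (F : nat -> T -> R) f M : (forall n, measurable_fun setT (F n)) ->
  (forall n x, `|F n x| <= M) -> (forall x, F n x @[n --> \oo] --> f x) ->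
  bounded_rv f.
Proof.
move=> mF FM Ff; split.
  by apply: (measurable_fun_cvg (h := F)) => // x _; exact: Ff.
exists M => x; have h : `|F n x| @[n --> \oo] --> `|f x| by apply: cvg_norm; exact: Ff.
by rewrite -(cvg_lim _ h)//; apply: limr_le; [apply/cvg_ex; eexists; exact: h|exact: nearW].
Qed.

End expectation.

(** * Rounding real numbers to a finite grid *)

Section quantizer.
Context (R : realType).
Implicit Types z : R.

(** The interval [-(m+1), m+1] is cut with mesh 1/(m+1), which gives 2(m+1)^2 + 1 grid points.
    Outside the interval the index is meaningless, but every fixed [z] lies inside for large [m]. *)
Definition qidx (m : nat) z : 'I_(2 * m.+1 * m.+1).+1 :=
  inord (Num.truncn (m.+1%:R * (z + m.+1%:R))).

Definition qpt (m : nat) (v : 'I_(2 * m.+1 * m.+1).+1) : R :=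
  v%:R / m.+1%:R - m.+1%:R.

Lemma qidx_near m z : `|z| <= m.+1%:R -> `|qpt (qidx m z) - z| <= m.+1%:R^-1.
Proof.
move=> zm; rewrite /qpt /qidx; set u := m.+1%:R * _.
have m0 : (0 : R) < m.+1%:R by [].
have u0 : 0 <= u by rewrite mulr_ge0// -lerBlDr sub0r; move: zm; rewrite ler_norml => /andP[].
have /andP[u1 u2] := truncn_itv u0.
rewrite inordK; last first.
  rewrite ltnS -(ler_nat R) (le_trans u1)// /u !natrM.
  rewrite [leRHS]mulrAC mulrC ler_wpM2r//.
  by move: zm; rewrite ler_norml => /andP[_ zm]; lra.
have -> : z = u / m.+1%:R - m.+1%:R by rewrite /u mulrAC divff ?mul1r ?addrK// gt_eqF.
rewrite opprB addrA subrK -mulrBl normrM [X in _ * X]ger0_norm ?invr_ge0//.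
rewrite ler_piMl ?invr_ge0// ler_norml; move: u1 u2; rewrite -natr1 => u1 u2.
by apply/andP; split; lra.
Qed.

Lemma qpt_cvg z : qpt (qidx m z) @[m --> \oo] --> z.
Proof.
apply/cvgrPdist_le => e e0; near=> m; rewrite distrC.
apply: (le_trans (qidx_near _)).
  near: m; exists (Num.truncn `|z|) => // m /= zm.
  by rewrite (le_trans (ltW (truncnS_gt _)))// ler_nat.
rewrite invf_ple ?posrE//; near: m; exists (Num.truncn e^-1) => // m /= zm.
by rewrite (le_trans (ltW (truncnS_gt _)))// ler_nat.
Unshelve. all: end_near. Qed.

Lemma measurable_qidx m v : measurable [set z | qidx m z = v].
Proof.
pose u z : R := m.+1%:R * (z + m.+1%:R).
pose A k := [set z | Num.truncn (u z) = k].
have mu : measurable_fun [set: R] u.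
  by apply: measurable_funM => //; apply: measurable_funD.
pose B k := [set z | (k < Num.truncn (u z))%N].
have mB k : measurable (B k).
  have -> : B k = u @^-1` `[k.+1%:R, +oo[.
    by apply/seteqP; split => z; rewrite /B /= in_itv/= andbT truncn_gt_nat.
  by rewrite -[_ @^-1` _]setTI; exact: mu.
have mA k : measurable (A k).
  case: k => [|k].
    have -> : A 0%N = ~` B 0%N.
      by apply/seteqP; split => z; rewrite /A /B /=; case: (Num.truncn _).
    exact: measurableC.
  have -> : A k.+1 = B k `\` B k.+1.
    apply/seteqP; split => z; rewrite /A /B /=; first by move=> ->; rewrite ltnn.
    by move=> [h1 h2]; apply/eqP; rewrite eqn_leq h1 andbT leqNgt; apply/negP.
  exact: measurableD.
rewrite (_ : mkset _ = \bigcup_(k in [set k | inord k = v]) A k); last first.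
  by apply/seteqP; split => z /= => [<-|[k /= <- <-//]]; eexists.
exact: bigcup_measurable.
Qed.

End quantizer.

Lemma norm_le_small_eq0 (R : realType) (x C : R) :
  (forall e, 0 < e -> `|x| <= C * e) -> x = 0.
Proof.
move=> h; apply/eqP; rewrite -normr_le0; apply/ler_addgt0Pr => e e0.
rewrite add0r; have C0 : 0 < Num.max C 1 by rewrite lt_max ltr01 orbT.
apply: (le_trans (h (e / Num.max C 1) _)); first exact: divr_gt0.
by rewrite mulrCA ler_piMr ?(ltW e0)// ler_pdivrMr// mul1r le_max lexx.
Qed.

Section simple_approximation.
Context (R : realType).

Lemma simple_approx (M e : R) : 0 < e ->
  exists n (c : 'I_n -> R) (B : 'I_n -> set R), (forall v, measurable (B v)) /\
    forall z, `|z| <= M -> `|z - \sum_v c v * \1_(B v) z| <= e.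
Proof.
(* Large enough for [-M, M] to lie inside the grid and for the mesh 1/(m+1) to be at most [e]. *)
move=> e0; pose m := (Num.truncn M + Num.truncn e^-1)%N.
exists _, (@qpt R m), (fun v => [set z | qidx m z = v]); split.
  by move=> v; exact: measurable_qidx.
move=> z zM; rewrite (bigD1 (qidx m z))//= indicE mem_set// mulr1.
rewrite big1 ?addr0; last first.
  move=> v vz; rewrite indicE memNset ?mulr0//= => h.
  by move: vz; rewrite h eqxx.
rewrite distrC (le_trans (qidx_near _))//.
  rewrite (le_trans zM)// (le_trans (ltW (truncnS_gt _)))// ler_nat.
  by rewrite ltnS leq_addr.
rewrite invf_ple ?posrE// (le_trans (ltW (truncnS_gt _)))// ler_nat.
by rewrite ltnS leq_addl.
Qed.

End simple_approximation.

Section independence.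
Context d (T : measurableType d) (R : realType) (P : probability T R).

Lemma bounded_rv_comp d' (E : measurableType d') (g : E -> R) (Y : T -> E) :
  measurable_fun setT Y -> bounded_rv g -> bounded_rv (g \o Y).
Proof.
move=> mY [mg [M gM]]; split; first exact: measurableT_comp.
by exists M => x; exact: gM.
Qed.

Lemma bounded_rv_indic_comp (g : T -> R) (B : set R) : measurable_fun setT g ->
  measurable B -> bounded_rv (fun x => \1_B (g x) : R).
Proof.
by move=> mg mB; apply: (bounded_rv_comp mg); exact: bounded_rv_indic.
Qed.

Lemma indic_preimage d' (E : measurableType d') (A : set E) (Y : T -> E) :
  (fun x => \1_A (Y x)) = \1_(Y @^-1` A) :> (T -> R).
Proof. by apply/funext => x; rewrite !indicE; congr (_%:R); apply/idP/idP; rewrite !inE. Qed.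

(** [g] is uniformly close to a simple function of its values; the hypothesis applies to the level
    sets of [g], and linearity does the rest. The two replacements cost at most N e each. *)
Lemma Ex_indep1 d' (E : measurableType d') (Y : T -> E) (Z : T -> R) (g : E -> R) :
  measurable_fun setT Y -> bounded_rv Z -> bounded_rv g ->
  (forall B, measurable B ->
    Ex P (fun x => Z x * \1_B (Y x)) = Ex P Z * Ex P (fun x => \1_B (Y x))) ->
  Ex P (fun x => Z x * g (Y x)) = Ex P Z * Ex P (fun x => g (Y x)).
Proof.
move=> mY bZ bg H; apply/eqP; rewrite -subr_eq0; apply/eqP.
have [mg [M gM]] := bg; have [mZ [N ZN]] := bZ.
have bgY : bounded_rv (fun x => g (Y x)) by exact: (bounded_rv_comp mY bg).
apply: (@norm_le_small_eq0 _ _ (N + N)) => e e0.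
have [n [c [B [mB approx]]]] := @simple_approx R M e e0.
pose s x := \sum_v c v * \1_(B v) (g (Y x)).
have mgY : measurable_fun setT (fun x => g (Y x)) by case: bgY.
have b1 v : bounded_rv (fun x => \1_(B v) (g (Y x)) : R).
  exact: (@bounded_rv_indic_comp (fun x => g (Y x))).
have bs : bounded_rv s by apply: bounded_rv_sum => v; exact: bounded_rvZ.
have E1 : Ex P (fun x => Z x * s x) = Ex P Z * Ex P s.
  have -> : (fun x => Z x * s x) = (fun x => \sum_v c v * (Z x * \1_(B v) (g (Y x)))).
    by apply/funext => x; rewrite /s mulr_sumr; apply: eq_bigr => v _; rewrite mulrCA.
  rewrite Ex_sum; last by move=> v; apply: bounded_rvZ; exact: bounded_rvM.
  rewrite /s Ex_sum; last by move=> v; exact: bounded_rvZ.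
  rewrite mulr_sumr; apply: eq_bigr => v _.
  rewrite !ExZ//; last exact: bounded_rvM.
  have mgB : measurable (g @^-1` B v) by rewrite -[X in measurable X]setTI; exact: mg.
  have -> : Ex P (fun x => Z x * \1_(B v) (g (Y x))) =
      Ex P Z * Ex P (fun x => \1_(B v) (g (Y x))) := H _ mgB.
  by rewrite mulrCA.
have -> : Ex P (fun x => Z x * g (Y x)) - Ex P Z * Ex P (fun x => g (Y x)) =
  (Ex P (fun x => Z x * g (Y x)) - Ex P (fun x => Z x * s x)) +
  Ex P Z * (Ex P s - Ex P (fun x => g (Y x))).
  by rewrite E1; ring.
have near_s x : `|g (Y x) - s x| <= e by exact: approx.
rewrite (le_trans (ler_normD _ _))// mulrDl lerD//.
  apply: Ex_near; [exact: bounded_rvM|exact: bounded_rvM|move=> x].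
  by rewrite -mulrBr normrM ler_pM.
rewrite normrM ler_pM//; first exact: norm_Ex_le.
by apply: Ex_near => // x; rewrite distrC.
Qed.

Lemma Ex_indep_pair d1 (E1 : measurableType d1) d2 (E2 : measurableType d2)
    (X : T -> E1) (Y : T -> E2) (f : E1 -> R) (g : E2 -> R) :
  measurable_fun setT X -> measurable_fun setT Y ->
  bounded_rv f -> bounded_rv g -> independent_pair P X Y ->
  Ex P (fun x => f (X x) * g (Y x)) = Ex P (f \o X) * Ex P (g \o Y).
Proof.
move=> mX mY bf bg XY; apply: (@Ex_indep1 _ _ Y (f \o X)) => //.
  exact: (bounded_rv_comp mX).
move=> B mB; rewrite mulrC; under eq_fun do rewrite mulrC.
have bB : bounded_rv (fun x => \1_B (Y x) : R).
  by apply: (bounded_rv_comp mY); exact: bounded_rv_indic.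
apply: (@Ex_indep1 _ _ X (fun x => \1_B (Y x))) => // A mA.
have mYB : measurable (Y @^-1` B) by rewrite -[X in measurable X]setTI; exact: mY.
have mXA : measurable (X @^-1` A) by rewrite -[X in measurable X]setTI; exact: mX.
have -> : (fun x => \1_B (Y x) * \1_A (X x)) = \1_(X @^-1` A `&` Y @^-1` B) :> (T -> R).
  by rewrite indicI -!indic_preimage; apply/funext => x /=; rewrite mulrC.
rewrite !indic_preimage; apply: EFin_inj; rewrite EFinM !Ex_indic//.
  by rewrite XY// muleC.
exact: measurableI.
Qed.

Lemma bounded_rv_prod_seq (I : eqType) (s : seq I) (F : I -> T -> R) :
  {in s, forall i, bounded_rv (F i)} -> bounded_rv (fun x => \prod_(i <- s) F i x).
Proof.
elim: s => [|i s IH] bF.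
  by under eq_fun do rewrite big_nil; exact: bounded_rv_cst.
under eq_fun do rewrite big_cons; apply: bounded_rvM.
  by apply: bF; rewrite mem_head.
by apply: IH => j js; apply: bF; rewrite in_cons js orbT.
Qed.

(** Factors are generalized one at a time: those indexed by [s1] are arbitrary, those by [s2] are
    indicators. For empty [s1] this is the definition of independence. In the inductive step the
    head of [s1] is first taken to be an indicator and moved to [s2], then made arbitrary by
    [Ex_indep1]. *)
Lemma Ex_indep_family (I : eqType) (J : pred I) d' (E : measurableType d')
    (X : I -> T -> E) (g : I -> E -> R) (s : seq I) :
  independent_family P J X -> uniq s -> {in s, forall i, J i} ->
  {in s, forall i, measurable_fun setT (X i)} -> (forall i, bounded_rv (g i)) ->
  Ex P (fun x => \prod_(i <- s) g i (X i x)) = \prod_(i <- s) Ex P (g i \o X i).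
Proof.
move=> ind us sJ mX bg.
suff : forall s1 s2 g, perm_eq s (s1 ++ s2) -> (forall i, bounded_rv (g i)) ->
    {in s2, forall i, exists2 B, measurable B & g i = \1_B} ->
    Ex P (fun x => \prod_(i <- s1 ++ s2) g i (X i x)) =
    \prod_(i <- s1 ++ s2) Ex P (g i \o X i).
  by move=> /(_ s [::] g); rewrite cats0; exact.
move=> {bg}{}s1; elim: s1 => [|i s1 IH] s2 {}g ps bg gind.
  rewrite /=; have us2 : uniq s2 by rewrite -(perm_uniq ps).
  have s2s : {subset s2 <= s} by move=> j; rewrite (perm_mem ps).
  pose B j := if pselect (j \in s2) is left js then s2val (cid2 (gind j js)) else set0.
  have mB j : measurable (B j).
    by rewrite /B; case: pselect => // js; case: cid2.
  have gB j : j \in s2 -> g j = \1_(B j).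
    by move=> js; rewrite /B; case: pselect => // js'; case: cid2.
  have mXB j : j \in s2 -> measurable (X j @^-1` B j).
    by move=> /s2s js; rewrite -[X in measurable X]setTI; exact: mX.
  have -> : (fun x => \prod_(j <- s2) g j (X j x)) =
      \1_(\bigcap_(j in [set` s2]) (X j @^-1` B j)) :> (T -> R).
    apply/funext => x; rewrite indicE.
    have [xB|xB] := pselect ((\bigcap_(j in [set` s2]) (X j @^-1` B j)) x).
      rewrite mem_set//= big_seq big1// => j js; rewrite gB// indicE mem_set//.
      exact: (xB j).
    rewrite memNset//=; have [j js nB] : exists2 j, j \in s2 & ~ B j (X j x).
      by move/existsNP : xB => [j /not_implyP[? ?]]; exists j.
    by rewrite (big_rem j)//= gB// indicE memNset// mul0r.
  apply: EFin_inj; rewrite Ex_indic; last first.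
    apply: fin_bigcap_measurable => [|j /= js]; [exact: finite_seq|exact: mXB].
  rewrite ind//; last by move=> j /s2s /sJ.
  rewrite -prodEFin big_seq [RHS]big_seq; apply: eq_bigr => j js.
  by rewrite gB// -(Ex_indic P (mXB j js)) -indic_preimage.
have us' : uniq ((i :: s1) ++ s2) by rewrite -(perm_uniq ps).
have ss : {subset (i :: s1) ++ s2 <= s} by move=> j; rewrite (perm_mem ps).
have is_ : i \in s by apply: ss; rewrite mem_head.
have ni : i \notin s1 ++ s2 by move: us' => /= /andP[].
have bgX : {in s1 ++ s2, forall j, bounded_rv (fun x => g j (X j x))}.
  move=> j js; apply: (bounded_rv_comp (mX j _) (bg j)).
  by apply: ss; rewrite in_cons js orbT.
(* The induction hypothesis with [i] moved to the indicators, and with the function at [i] left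
   free. *)
have key (h : E -> R) : bounded_rv h -> (exists2 B, measurable B & h = \1_B) ->
    Ex P (fun x => h (X i x) * \prod_(j <- s1 ++ s2) g j (X j x)) =
    Ex P (h \o X i) * \prod_(j <- s1 ++ s2) Ex P (g j \o X j).
  move=> bh [B mB hB].
  pose g' j := if j == i then h else g j.
  have pe : perm_eq (s1 ++ i :: s2) (i :: (s1 ++ s2)).
    by rewrite perm_sym -[i :: (s1 ++ s2)]/([:: i] ++ s1 ++ s2) perm_catCA.
  have g'E j : j \in s1 ++ s2 -> g' j = g j.
    by move=> js; rewrite /g'; case: eqP => // ji; move: ni; rewrite -ji js.
  have g'i : g' i = h by rewrite /g' eqxx.
  have := IH (i :: s2) g' _ _ _; rewrite (perm_big _ pe)/= big_cons g'i.
  rewrite (_ : (fun x => \prod_(_ <- _) _) =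
     fun x => h (X i x) * \prod_(j <- s1 ++ s2) g j (X j x)); last first.
    apply/funext => x; rewrite (perm_big _ pe)/= big_cons g'i; congr (_ * _).
    by rewrite big_seq [RHS]big_seq; apply: eq_bigr => j js; rewrite g'E.
  move=> ->.
  - by congr (_ * _); rewrite big_seq [RHS]big_seq; apply: eq_bigr => j js; rewrite g'E.
  - by rewrite (perm_trans ps)// perm_sym.
  - by move=> j; rewrite /g'; case: ifP.
  - move=> j; rewrite in_cons => /predU1P[->|js]; first by rewrite g'i; exists B.
    by rewrite g'E ?mem_cat ?js ?orbT//; exact: gind.
(* The constant 1 is the indicator of [setT]; choosing it at [i] removes that factor. *)
have key1 : Ex P (fun x => \prod_(j <- s1 ++ s2) g j (X j x)) =
    \prod_(j <- s1 ++ s2) Ex P (g j \o X j).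
  have h1 : exists2 B : set E, measurable B & cst 1 = \1_B :> (E -> R).
    by exists setT => //; rewrite indicT.
  have := key (cst 1) (bounded_rv_cst _ 1) h1.
  rewrite /= (_ : Ex P (cst 1 \o X i) = 1) ?mul1r; last exact: Ex_cst.
  by under eq_fun do rewrite /cst mul1r.
rewrite /= big_cons -key1 mulrC.
under eq_fun do rewrite big_cons mulrC.
apply: (@Ex_indep1 _ _ (X i)) => //.
- exact: mX.
- exact: bounded_rv_prod_seq.
- move=> B mB; have hB : exists2 B' : set E, measurable B' & \1_B = \1_B' :> (E -> R).
    by exists B.
  have := key \1_B (bounded_rv_indic _ mB) hB.
  by under eq_fun do rewrite mulrC; rewrite key1 mulrC.
Qed.

End independence.

(** * The topology of path space *)

Section path_topology.
Context (R : realType).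
Implicit Types (T : R) (t s : Rplus R).

Lemma Rplus_ge0 t : 0 <= Rplus_val t.
Proof. exact: (set_mem (valP t)). Qed.

Lemma Rplus_inj t s : Rplus_val t = Rplus_val s -> t = s.
Proof. exact: val_inj. Qed.

Lemma pos_partK (x : R) : 0 <= x -> Rplus_val (pos_part x) = x.
Proof. by move=> x0; rewrite /= /Rplus_val /=; apply/max_idPr. Qed.

Lemma compact_Rplus T : compact [set t : Rplus R | Rplus_val t <= T].
Proof.
have [T0|T0] := leP 0 T; last first.
  rewrite (_ : mkset _ = set0); first exact: compact0.
  apply/seteqP; split => t //= tT; have := lt_le_trans T0 (Rplus_ge0 t).
  by rewrite ltNge tT.
rewrite (_ : mkset _ = @pos_part R @` `[0, T]).
  apply: continuous_compact; last exact: segment_compact.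
  exact/continuous_subspaceT/pos_part_continuous.
apply/seteqP; split => [t /= tT|t /= [x]].
  by exists (Rplus_val t); [rewrite in_itv/= Rplus_ge0|exact: Rplus_valK].
by rewrite in_itv/= => /andP[x0 xT] <-; rewrite pos_partK.
Qed.

Lemma compact_Rplus_bounded (K : set (Rplus R)) : compact K ->
  exists T, forall t, K t -> Rplus_val t <= T.
Proof.
move=> cK; have : compact (@Rplus_val R @` K).
  apply: continuous_compact => //; exact/continuous_subspaceT/Rplus_val_continuous.
move=> /compact_bounded [M [_ MK]]; exists (M + 1) => t Kt.
apply: (le_trans (ler_norm _)); apply: (MK (M + 1)); first by rewrite ltrDl.
by exists t.
Qed.

Lemma cvg_cpath (E : uniformType) (I : Type) (F : set_system I) (FF : Filter F)
    (g : I -> cpath R E) (x : cpath R E) :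
  (forall T (V : set (E * E)), entourage V ->
    \forall i \near F, forall t, Rplus_val t <= T -> V (x t, g i t)) ->
  g @ F --> x.
Proof.
move=> H A /= [_ [[B oB <-] Bx sBA]].
have : (fun i => g i : Rplus R -> E) @ F -->
   ((x : Rplus R -> E) : {family compact, Rplus R -> E}).
  apply/fam_cvgP => K cK; have [T TK] := compact_Rplus_bounded cK.
  move=> P /= /uniform_nbhs [V [entV VP]].
  rewrite nbhs_simpl /=; apply: filterS (H T V entV) => i Hi.
  by apply: VP => t Kt; apply: Hi; exact: TK.
move/(_ B); rewrite nbhs_simpl => /(_ _)/= h.
have /h : nbhs ((x : Rplus R -> E) : {family compact, Rplus R -> E}) B.
  by apply: open_nbhs_nbhs; split.
by apply: filterS => i; exact: sBA.
Qed.

Lemma cpath_nbhs (E : uniformType) (x : cpath R E) T (V : set (E * E)) :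
  entourage V -> nbhs x [set y : cpath R E | forall t, Rplus_val t <= T -> V (x t, y t)].
Proof.
move=> entV.
have nV : nbhs (x : {family compact, Rplus R -> E})
    [set g | forall t, [set t | Rplus_val t <= T] t -> V (x t, g t)].
  by apply: fam_nbhs => //; exact: compact_Rplus.
exact: (@initial_continuous _ {family compact, Rplus R -> E}
  (fun x : continuousType (Rplus R) E => x : Rplus R -> E) x _ nV).
Qed.

(** Uniform continuity of [f] along the compact set x([0, T]): one radius serves for all base points
    [x t], while [y] may lie off the path. *)
Lemma compact_path_unif (E F : pseudoMetricType R) (x : Rplus R -> E) (f : E -> F)
    T (e : R) : continuous x -> continuous f -> 0 < e ->
  exists2 de, 0 < de & forall t, Rplus_val t <= T -> forall y,
    ball (x t) de y -> ball (f (x t)) e (f y).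
Proof.
move=> cx cf e0.
pose P (de : R) t := forall y, ball (x t) de y -> ball (f (x t)) e (f y).
have e20 : 0 < e / 2 by rewrite divr_gt0.
(* Compactness in its near-covering form, for the filter of radii tending to 0 from the right, turns
   radii valid near each time into a single one. *)
have H := iffLR (compact_near_coveringP _) (@compact_Rplus T) R ((0 : R)^'+) P _.
have /H : forall t, [set t | Rplus_val t <= T] t ->
    \forall t' \near t & i \near 0^'+, P i t'.
  move=> t _; have /(_ (ball (f (x t)) (e / 2)) _) := cf (x t).
  move=> /(_ (nbhsx_ballx _ _ e20)); rewrite /= -nbhs_ballE => -[eta /= eta0 Heta].
  have eta20 : 0 < eta / 2 by rewrite divr_gt0.
  exists ([set t' | ball (x t) (eta / 2) (x t')], [set de | de < eta / 2]).
    split => /=; first exact: (cx t _ (nbhsx_ballx _ _ eta20)).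
    exact: nbhs_right_lt.
  move=> [t' de] [/= xt' deeta] y xy.
  rewrite (splitr e); apply: (@ball_triangle _ _ (f (x t))).
    apply: ball_sym; apply: Heta; apply: (le_ball _ xt').
    by rewrite ler_pdivrMr// ler_peMr ?(ltW eta0)// ler1n.
  apply: Heta; rewrite (splitr eta); apply: (@ball_triangle _ _ (x t')) => //.
  by apply: le_ball xy; exact: ltW.
move=> H2; have [de [de0 Hde]] : exists de, 0 < de /\ [set t | Rplus_val t <= T] `<=` P de.
  by near (0 : R)^'+ => de; exists de; split; near: de; [exact: nbhs_right_gt|].
by exists de.
Unshelve. all: end_near. Qed.

Lemma path_map_continuous (E F : pseudoMetricType R) (f : E -> F) (cf : continuous f) :
  continuous (path_map cf : cpath R E -> cpath R F).
Proof.
move=> x; apply: (@cvg_cpath F _ (nbhs x) (nbhs_filter x)) => T V /=;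
  rewrite -entourage_ballE => -[e /= e0 eV].
have [de de0 H] := compact_path_unif T (@cts_fun _ _ x) cf e0.
have := @cpath_nbhs E x T _ (entourage_ball E (PosNum de0)).
apply: filterS => y xy t tT; apply: eV => /=.
by apply: H => //; exact: xy.
Qed.

Lemma path_unif (x : cpath R R) T (e : R) : 0 < e ->
  exists2 de, 0 < de & forall t s, Rplus_val t <= T ->
    `|Rplus_val t - Rplus_val s| < de -> `|x t - x s| < e.
Proof.
move=> e0; have cid : continuous (id : Rplus R -> Rplus R) by move=> t; exact: cvg_id.
have [de de0 H] := compact_path_unif T cid (@cts_fun _ _ x) e0.
by exists de => // t s tT ts; exact: (H t tT s ts).
Qed.

Lemma path_bounded (x : cpath R R) T :
  exists M, forall t, Rplus_val t <= T -> `|x t| <= M.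
Proof.
have /compact_bounded [M [_ MK]] : compact (x @` [set t | Rplus_val t <= T]).
  apply: continuous_compact; last exact: compact_Rplus.
  exact/continuous_subspaceT/(@cts_fun _ _ x).
exists (M + 1) => t tT; apply: (MK (M + 1)); first by rewrite ltrDl.
by exists t.
Qed.

End path_topology.

(** * A distance for uniform convergence on compacts *)

Section pdist.
Context (R : realType).
Implicit Types (x y z u v : Rplus R -> R) (t s : Rplus R).

(* A distance metrizing uniform convergence on compacts, kept as a single
   supremum so that bounds between paths pass to it pointwise. *)
Definition pterm x y t : R := Num.min `|x t - y t| (1 + Rplus_val t)^-1.

Definition pdist x y : R := sup (range (pterm x y)).

Lemma weight_gt0 t : 0 < (1 + Rplus_val t)^-1.
Proof. by rewrite invr_gt0 ltr_pwDl// Rplus_ge0. Qed.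

Lemma weight_le1 t : (1 + Rplus_val t)^-1 <= 1.
Proof. by rewrite invf_le1 ?ltr_pwDl ?Rplus_ge0// lerDl Rplus_ge0. Qed.

Lemma weight_mono t s : Rplus_val s <= Rplus_val t ->
  (1 + Rplus_val t)^-1 <= (1 + Rplus_val s)^-1.
Proof. by move=> st; rewrite lef_pV2 ?posrE ?ltr_pwDl ?Rplus_ge0// lerD2l. Qed.

Lemma pterm_ge0 x y t : 0 <= pterm x y t.
Proof. by rewrite le_min normr_ge0 ltW ?weight_gt0. Qed.

Lemma pterm_le1 x y t : pterm x y t <= 1.
Proof. by rewrite ge_min weight_le1 orbT. Qed.

Lemma pterm_le_pdist x y t : pterm x y t <= pdist x y.
Proof.
apply: sup_upper_bound; last by exists t.
split; first by exists (pterm x y (Rplus0 R)), (Rplus0 R).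
by exists 1 => _ [s _ <-]; exact: pterm_le1.
Qed.

Lemma pdist_le x y C : (forall t, pterm x y t <= C) -> pdist x y <= C.
Proof.
move=> H; apply: ge_sup; first by exists (pterm x y (Rplus0 R)), (Rplus0 R).
by move=> _ [s _ <-].
Qed.

Lemma pdist_ge0 x y : 0 <= pdist x y.
Proof. exact: le_trans (pterm_ge0 x y (Rplus0 R)) (pterm_le_pdist _ _ _). Qed.

Lemma pdistxx x : pdist x x = 0.
Proof.
apply/eqP; rewrite eq_le pdist_ge0 andbT; apply: pdist_le => t.
by rewrite /pterm subrr normr0 ge_min lexx.
Qed.

Lemma pdistC x y : pdist x y = pdist y x.
Proof. by rewrite /pdist (_ : pterm x y = pterm y x)//; apply/funext => t;
  rewrite /pterm distrC. Qed.

Lemma pdist_triangle x y z : pdist x z <= pdist x y + pdist y z.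
Proof.
apply: pdist_le => t; apply: le_trans (lerD (pterm_le_pdist _ _ t) (pterm_le_pdist _ _ t)).
have := ler_distD (y t) (x t) (z t); have := weight_gt0 t.
rewrite /pterm; set a := `|x t - z t|; set b := `|x t - y t|; set c := `|y t - z t|.
have b0 : 0 <= b by exact: normr_ge0.
have c0 : 0 <= c by exact: normr_ge0.
set w := _^-1 => w0 abc.
rewrite /Num.min; case: ifP => h1; case: ifP => h2; case: ifP => h3;
  move: h1 h2 h3 => /=; try move=> /negbT; rewrite -?leNgt; lra.
Qed.

Lemma pdist_lt_weight x y t : pdist x y < (1 + Rplus_val t)^-1 ->
  `|x t - y t| <= pdist x y.
Proof.
move=> h; have := pterm_le_pdist x y t; rewrite /pterm ge_min => /orP[//|].
by rewrite leNgt h.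
Qed.

Lemma pdist_local x y T C : 0 <= T -> 0 <= C ->
  (forall t, Rplus_val t <= T -> `|x t - y t| <= C) -> pdist x y <= C + (1 + T)^-1.
Proof.
move=> T0 C0 H; have T1 : 0 < (1 + T)^-1 by rewrite invr_gt0 ltr_pwDl.
apply: pdist_le => t; rewrite /pterm ge_min; have [tT|tT] := leP (Rplus_val t) T.
  by rewrite (le_trans (H _ tT)) ?lerDl// ltW.
apply/orP; right; apply: (@le_trans _ _ (1 + T)^-1); last by rewrite lerDr.
by rewrite lef_pV2 ?posrE ?ltr_pwDl ?Rplus_ge0// lerD2l ltW.
Qed.

(** If [pdist x y] is below the weight at [t], it is below the weights at all earlier times and thus
    bounds |x - y| on [0, t]. Otherwise the term at [t] is at most its weight, hence at most
    [pdist x y]. A causal map that is Lipschitz for running suprema is therefore Lipschitz for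
    [pdist] with the same constant, which is what the minimum with a decreasing weight is designed
    for. *)
Lemma pdist_causal x y u v K : 1 <= K ->
  (forall t C, (forall s, Rplus_val s <= Rplus_val t -> `|x s - y s| <= C) ->
     `|u t - v t| <= K * C) ->
  pdist u v <= K * pdist x y.
Proof.
move=> K1 H; apply: pdist_le => t; rewrite /pterm ge_min.
have [h|h] := ltP (pdist x y) (1 + Rplus_val t)^-1.
  rewrite H// => s st; apply: pdist_lt_weight.
  exact: lt_le_trans h (weight_mono st).
by rewrite (le_trans h) ?orbT// ler_peMl// pdist_ge0.
Qed.

Definition clamp (K a : R) : R := Num.max (- K) (Num.min a K).

Lemma clamp_bounded K a : 0 <= K -> `|clamp K a| <= K.
Proof.
by move=> K0; rewrite ler_norml le_max lexx ge_max ge_min lexx orbT andbT; lra.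
Qed.

Lemma clamp_lip K a c : `|clamp K a - clamp K c| <= `|a - c|.
Proof.
rewrite /clamp /Num.max /Num.min.
have [ac|ac] := leP a c; [rewrite [leRHS]ler0_norm ?subr_le0//|rewrite [leRHS]ger0_norm
  ?subr_ge0 ?(ltW ac)//];
rewrite ler_norml; case: (ltP a K) => ?; case: (ltP c K) => ?; case: ltP => ?; case: ltP => ?; lra.
Qed.

Lemma clamp_id K a : 0 <= K -> `|a| <= K -> clamp K a = a.
Proof.
by move=> K0; rewrite ler_norml => /andP[h1 h2]; rewrite /clamp min_l// max_r.
Qed.

(** If the weight is the smaller term of the minimum, the clamped values still differ by at most 2K,
    that is 2K(1 + t) times the weight; otherwise [clamp_lip] suffices. *)
Lemma clamp_eval_lip K x y t : 0 <= K ->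
  `|clamp K (x t) - clamp K (y t)| <= (1 + 2 * K) * (1 + Rplus_val t) * pdist x y.
Proof.
move=> K0; have t0 := Rplus_ge0 t.
have c0 : 0 <= (1 + 2 * K) * (1 + Rplus_val t).
  by rewrite mulr_ge0// addr_ge0// mulr_ge0.
apply: le_trans (ler_wpM2l c0 (pterm_le_pdist x y t)).
rewrite /pterm /Num.min; case: ifP => h.
  apply: (le_trans (clamp_lip _ _ _)); rewrite ler_peMl//; nra.
rewrite -mulrA divff ?mulr1; last by rewrite gt_eqF// ltr_pwDl.
apply: (le_trans (ler_normB _ _)).
have := clamp_bounded (x t) K0; have := clamp_bounded (y t) K0; lra.
Qed.

End pdist.

(** * Bounded Lipschitz functionals *)

Section metrizes.
Context (R : realType) (E : ptopologicalType).
Implicit Types (D : E -> E -> R) (f g : E -> R).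

(** The last clause ties [D] to a topology given beforehand, so that continuity and Borel sets keep
    their original meaning. *)
Definition metrizes D := [/\ forall x, D x x = 0, forall x y, D x y = D y x,
  forall x y z, D x z <= D x y + D y z &
  forall x A, nbhs x A <-> exists2 de, 0 < de & forall y, D x y < de -> A y].

Definition dense_seq D (e : nat -> E) := forall x de, 0 < de -> exists n, D x (e n) < de.

Definition bl D f := (exists M, forall x, `|f x| <= M) /\
  (exists2 C, 0 <= C & forall x y, `|f x - f y| <= C * D x y).

Lemma metrizes_ge0 D x y : metrizes D -> 0 <= D x y.
Proof.
by move=> [Dxx DC Dt _]; have := Dt x y x; rewrite Dxx (DC y x); lra.
Qed.

Lemma bl_continuous D f : metrizes D -> bl D f -> continuous f.
Proof.
move=> mD [_ [C C0 H]] x; apply/cvgrPdist_lt => e e0.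
have [_ _ _ nD] := mD; apply/nD; exists (e / (C + 1)).
  by rewrite divr_gt0// ltr_wpDl.
move=> y xy; rewrite (le_lt_trans (H x y))//.
move: xy; rewrite ltr_pdivlMr ?ltr_wpDl// => xy; apply: le_lt_trans xy.
by rewrite mulrC ler_wpM2l ?metrizes_ge0// lerDl.
Qed.

Lemma bl_measurable D f : metrizes D -> bl D f ->
  bounded_rv (f : borel E -> R).
Proof.
move=> mD bf; split; first exact: (continuous_borelR (bl_continuous mD bf)).
by have [] := bf.
Qed.

Section closure.
Context (D : E -> E -> R) (mD : metrizes D).

Lemma bl_cst c : bl D (fun=> c).
Proof.
split; first by exists `|c|.
by exists 0 => // x y; rewrite subrr normr0 mul0r.
Qed.

Lemma blD f g : bl D f -> bl D g -> bl D (fun x => f x + g x).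
Proof.
move=> [[M fM] [C C0 fC]] [[N gN] [C' C'0 gC]]; split.
  by exists (M + N) => x; rewrite (le_trans (ler_normD _ _))// lerD.
exists (C + C'); first exact: addr_ge0.
move=> x y; rewrite opprD addrACA (le_trans (ler_normD _ _))// mulrDl.
exact: lerD.
Qed.

Lemma blM f g : bl D f -> bl D g -> bl D (fun x => f x * g x).
Proof.
move=> [[M fM] [C C0 fC]] [[N gN] [C' C'0 gC]].
have x0 := point : E.
have M0 : 0 <= M by apply: le_trans (fM x0).
have N0 : 0 <= N by apply: le_trans (gN x0).
split; first by exists (M * N) => x; rewrite normrM ler_pM.
exists (M * C' + C * N); first by rewrite addr_ge0// mulr_ge0.
move=> x y; have -> : f x * g x - f y * g y = f x * (g x - g y) + (f x - f y) * g y by ring.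
rewrite (le_trans (ler_normD _ _))// !normrM mulrDl lerD//.
  by rewrite -mulrA ler_pM.
by rewrite mulrAC ler_pM.
Qed.

Lemma blZ c f : bl D f -> bl D (fun x => c * f x).
Proof. exact/blM/bl_cst. Qed.

Lemma blB f g : bl D f -> bl D g -> bl D (fun x => f x - g x).
Proof.
move=> bf bg; apply: blD => //.
rewrite (_ : (fun _ => _) = (fun x => -1 * g x)); first exact: blZ.
by apply/funext => x; rewrite mulN1r.
Qed.

Lemma bl_sum I (s : seq I) (F : I -> E -> R) : (forall i, bl D (F i)) ->
  bl D (fun x => \sum_(i <- s) F i x).
Proof.
move=> bF; elim: s => [|i s IH]; first by under eq_fun do rewrite big_nil; exact: bl_cst.
by under eq_fun do rewrite big_cons; exact: blD.
Qed.

Lemma bl_prod I (s : seq I) (p : pred I) (F : I -> E -> R) : (forall i, bl D (F i)) ->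
  bl D (fun x => \prod_(i <- s | p i) F i x).
Proof.
move=> bF; elim: s => [|i s IH]; first by under eq_fun do rewrite big_nil; exact: bl_cst.
by under eq_fun do rewrite big_cons; case: (p i) => //; exact: blM.
Qed.

Context (e : nat -> E) (de : dense_seq D e).

(** Lipschitz regularization from below (the Pasch-Hausdorff envelope), with the infimum taken over
    the dense sequence only: being countable, it stays measurable as soon as the distances to the
    points [e n] are. *)
Definition infconv f (j : nat) x : R := inf (range (fun n => f (e n) + j%:R * D x (e n))).

Section infconv.
Context (f : E -> R) (cf : continuous f) (M : R) (fM : forall x, `|f x| <= M).

Let term_ge x j n : - M <= f (e n) + j%:R * D x (e n).
Proof.
rewrite -[leLHS]addr0 lerD//; last by rewrite mulr_ge0// metrizes_ge0.
by have := fM (e n); rewrite ler_norml => /andP[].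
Qed.

Let nonempty x j : range (fun n => f (e n) + j%:R * D x (e n)) !=set0.
Proof. by exists (f (e 0%N) + j%:R * D x (e 0%N)), 0%N. Qed.

Lemma infconv_le_term x j n : infconv f j x <= f (e n) + j%:R * D x (e n).
Proof.
apply: ge_inf; last by exists n.
by exists (- M) => _ [m _ <-]; exact: term_ge.
Qed.

Lemma infconv_ge x j C : (forall n, C <= f (e n) + j%:R * D x (e n)) ->
  C <= infconv f j x.
Proof. by move=> H; apply: lb_le_inf => // _ [n _ <-]. Qed.

Lemma infconv_le x j : infconv f j x <= f x.
Proof.
apply/ler_addgt0Pr => eps e0.
have [_ _ _ nD] := mD.
have e20 : 0 < eps / 2 by rewrite divr_gt0.
have /cvgrPdist_lt /(_ _ e20) /nD [d1 d10 H1] := @cf x.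
have j0 : (0 : R) < j%:R + 1 by rewrite ltr_wpDl.
have d20 : 0 < eps / 2 / (j%:R + 1) by rewrite divr_gt0.
have d0 : 0 < Num.min d1 (eps / 2 / (j%:R + 1)) by rewrite lt_min d10.
have [n] := @de x _ d0.
rewrite lt_min => /andP[xd1 xd2]; have := H1 _ xd1.
rewrite ltr_norml => /andP[h1 _].
apply: (le_trans (infconv_le_term x j n)).
move: xd2; rewrite ltr_pdivlMr// mulrDr mulr1 mulrC => h3.
have := metrizes_ge0 x (e n) mD; lra.
Qed.

Lemma infconv_bl j : bl D (infconv f j).
Proof.
have [_ DC Dt _] := mD; split.
  exists M => x; rewrite ler_norml; apply/andP; split; first exact: infconv_ge.
  apply: (le_trans (infconv_le x j)).
  by have := fM x; rewrite ler_norml => /andP[].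
exists j%:R => // x y.
have key x' y' : infconv f j x' - infconv f j y' <= j%:R * D x' y'.
  rewrite lerBlDr -lerBlDl; apply: infconv_ge => n.
  rewrite lerBlDl (le_trans (infconv_le_term x' j n))//.
  by rewrite addrCA lerD2l -mulrDr ler_wpM2l.
rewrite ler_norml key andbT.
by have := key y x; rewrite (DC y x); lra.
Qed.

Lemma infconv_cvg x : infconv f j x @[j --> \oo] --> f x.
Proof.
apply/cvgrPdist_le => eps e0.
have [_ _ _ nD] := mD.
have /cvgrPdist_lt /(_ _ e0) /nD [d1 d10 H1] := @cf x.
(* From this index on, a point at distance at least [d1] pays a penalty of at least 2M, which
   exceeds any possible drop of [f]; closer points are covered by the continuity of [f] at [x]. *)
exists (Num.truncn (2 * M / d1)).+1 => // j /= jM.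
have h : 2 * M / d1 <= j%:R.
  by rewrite (le_trans (ltW (truncnS_gt _)))// ler_nat.
rewrite ger0_norm ?subr_ge0 ?infconv_le// lerBlDr addrC -lerBlDr.
apply: infconv_ge => n; have [xn|xn] := ltP (D x (e n)) d1.
  have := H1 _ xn; rewrite ltr_norml => /andP[_ h1].
  have : 0 <= j%:R * D x (e n) by rewrite mulr_ge0// metrizes_ge0.
  by rewrite lerBlDr; lra.
have : 2 * M <= j%:R * D x (e n).
  by move: h; rewrite ler_pdivrMr// => /le_trans -> //; rewrite ler_wpM2l.
have := fM x; have := fM (e n); rewrite !ler_norml => /andP[? ?] /andP[? ?]; lra.
Qed.

Lemma measurable_infconv d (T : measurableType d) (Y : T -> E) j :
  (forall n, measurable_fun setT (fun w => D (Y w) (e n))) ->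
  measurable_fun setT (fun w => infconv f j (Y w)).
Proof.
move=> mY.
have -> : (fun w => infconv f j (Y w)) =
    (fun w => infs (fun n => f (e n) + j%:R * D (Y w) (e n)) 0).
  apply/funext => w; rewrite /infconv /infs /sdrop; congr inf.
  by apply/seteqP; split => [_ [n _ <-]|_ [n _ <-]]; exists n.
apply: (@measurable_fun_infs _ _ _ setT (fun n w => f (e n) + j%:R * D (Y w) (e n))).
  by move=> w _; exists (- M) => _ [n _ <-]; exact: term_ge.
by move=> n; apply: measurable_funD => //; exact: measurable_funM.
Qed.

End infconv.

End closure.
End metrizes.

(** * A Lipschitz partition of unity *)

Section partition_of_unity.
Context (R : realType) (E : ptopologicalType) (D : E -> E -> R) (mD : metrizes D).
Context (e : nat -> E) (de : dense_seq D e) (eta : R) (eta0 : 0 < eta).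

Definition bump (v : nat) x : R := Num.max 0 (Num.min 1 (2 - D x (e v) / eta)).

Lemma bump_ge0 v x : 0 <= bump v x.
Proof. by rewrite le_max lexx. Qed.

Lemma bump_le1 v x : bump v x <= 1.
Proof. by rewrite ge_max ler01 ge_min lexx. Qed.

Lemma bump_eq0 v x : 2 * eta <= D x (e v) -> bump v x = 0.
Proof.
rewrite -ler_pdivlMr// => h; rewrite /bump max_l// ge_min; apply/orP; right.
by rewrite subr_le0.
Qed.

Lemma bump_eq1 v x : D x (e v) <= eta -> bump v x = 1.
Proof.
move=> h; have h1 : D x (e v) / eta <= 1 by rewrite ler_pdivrMr// mul1r.
rewrite /bump min_l ?max_r//; lra.
Qed.

Lemma bump_bl v : bl D (bump v).
Proof.
have [_ DC Dt _] := mD; split.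
  by exists 1 => x; rewrite ger0_norm ?bump_ge0 ?bump_le1.
exists eta^-1; first by rewrite invr_ge0 ltW.
have key x y : bump v x - bump v y <= eta^-1 * D x y.
  have h : D y (e v) / eta - D x (e v) / eta <= D x y / eta.
    rewrite -mulrBl ler_wpM2r ?invr_ge0 ?(ltW eta0)// lerBlDr (DC x y).
    exact: Dt.
  have : 0 <= D x y / eta by rewrite divr_ge0 ?(ltW eta0)// metrizes_ge0.
  move=> w0; rewrite [leRHS]mulrC; move: h w0.
  rewrite /bump /Num.max /Num.min; set a := D x _ / _; set c := D y _ / _; set w := D x y / _.
  move=> h w0; case: (ltP 1 (2 - a)) => ?; case: (ltP 1 (2 - c)) => ?; case: ltP => ?;
    case: ltP => ?; lra.
move=> x y; rewrite ler_norml key andbT.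
by have := key y x; rewrite (DC y x); lra.
Qed.

(** The share of [bump v] in the mass left over by the earlier bumps. The mass remaining after [N]
    steps is then a product ([pou_sum]), which vanishes once some [e v] with v < N lies within [eta]
    of [x]. *)
Definition pou (v : nat) x : R := bump v x * \prod_(u < v) (1 - bump u x).

Lemma pou_bl v : bl D (pou v).
Proof.
apply: blM => //; first exact: bump_bl.
by apply: bl_prod => // u; apply: blB => //; [exact: bl_cst|exact: bump_bl].
Qed.

Lemma pou_ge0 v x : 0 <= pou v x.
Proof.
by rewrite mulr_ge0 ?bump_ge0// prodr_ge0// => u _; rewrite subr_ge0 bump_le1.
Qed.

Lemma pou_eq0 v x : 2 * eta <= D x (e v) -> pou v x = 0.
Proof. by move=> h; rewrite /pou bump_eq0 ?mul0r. Qed.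

Lemma pou_sum N x : 1 - \sum_(v < N) pou v x = \prod_(v < N) (1 - bump v x).
Proof.
elim: N => [|N IH]; first by rewrite !big_ord0 subr0.
rewrite !big_ord_recr /= -IH opprD addrA mulrBr mulr1; congr (_ - _).
by rewrite /pou -IH mulrC.
Qed.

Definition pou_rest N x : R := 1 - \sum_(v < N) pou v x.

Lemma pou_rest_bl N : bl D (pou_rest N).
Proof. by apply: blB => //; [exact: bl_cst|apply: bl_sum => // v; exact: pou_bl]. Qed.

Lemma pou_rest_ge0 N x : 0 <= pou_rest N x.
Proof. by rewrite /pou_rest pou_sum prodr_ge0// => u _; rewrite subr_ge0 bump_le1. Qed.

Lemma pou_rest_le1 N x : pou_rest N x <= 1.
Proof. by rewrite /pou_rest gerBl sumr_ge0// => v _; exact: pou_ge0. Qed.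

Lemma pou_rest_cvg x : pou_rest N x @[N --> \oo] --> (0 : R).
Proof.
have [n xn] := de x eta0.
apply: cvg_near_cst; exists n.+1 => // N /= nN.
rewrite /pou_rest pou_sum (bigD1 (Ordinal nN))//= bump_eq1 ?subrr ?mul0r//.
exact: ltW.
Qed.

End partition_of_unity.

HB.instance Definition _ (R : numDomainType) (E F : pseudoPMetricType R) :=
  Pointed.on (E * F)%type.
HB.instance Definition _ (R : numDomainType) m n (E : pseudoPMetricType R) :=
  Pointed.on 'M[E]_(m, n).

(** * Distances on paths, pairs of paths and rows of paths *)

Section path_metrics.
Context (R : realType).

(** Comparison at a fixed path, in both directions, with uniform closeness on bounded intervals. In
    this form it passes easily from one coordinate to pairs and rows. *)
Definition path_dist_compat (E : pseudoPMetricType R)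
  (D : cpath R E -> cpath R E -> R) :=
  (forall (x : cpath R E) T (e : R), 0 < e -> exists2 de, 0 < de &
    forall y : cpath R E, D x y < de -> forall t, Rplus_val t <= T -> ball (x t) e (y t)) /\
  (forall (x : cpath R E) (e : R), 0 < e -> exists T, exists2 de, 0 < de &
    forall y : cpath R E, (forall t, Rplus_val t <= T -> ball (x t) de (y t)) -> D x y < e).

Lemma metrizes_cpath (E : pseudoPMetricType R) (D : cpath R E -> cpath R E -> R) :
  (forall x, D x x = 0) -> (forall x y, D x y = D y x) ->
  (forall x y z, D x z <= D x y + D y z) -> path_dist_compat D -> metrizes D.
Proof.
move=> Dxx DC Dt [c1 c2]; split => // x A; split; last first.
  move=> [e e0 H]; have [T [de de0 H2]] := c2 x e e0.
  have := @cpath_nbhs R E x T _ (entourage_ball E (PosNum de0)).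
  by apply: filterS => y xy; apply: H; exact: H2.
move=> xA.
(* The [D]-balls around [x] generate a filter; its convergence to [x] says that every neighbourhood
   contains a ball. *)
pose F := filter_from [set de : R | 0 < de] (fun de => [set y | D x y < de]).
have FF : Filter F.
  apply: filter_from_filter; first by exists 1; rewrite /= ltr01.
  move=> a b /= a0 b0; exists (Num.min a b); first by rewrite lt_min a0.
  by move=> y /=; rewrite lt_min => /andP[].
have : id @ F --> x.
  apply: (@cvg_cpath R E _ F FF) => T V; rewrite -entourage_ballE => -[e /= e0 eV].
  have [de de0 H] := c1 x T e e0.
  by exists de => // y /= xy t tT; apply: eV; exact: H.
by move=> /(_ A xA) [de /= de0 H]; exists de.
Qed.

Lemma pdist_compat : path_dist_compat (fun x y : cpath R R => pdist x y).
Proof.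
split.
  move=> x T e e0; exists (Num.min e (1 + Num.max T 0)^-1).
    by rewrite lt_min e0 invr_gt0 ltr_pwDl// le_max lexx orbT.
  move=> y; rewrite lt_min => /andP[h1 h2] t tT.
  rewrite /ball /= (le_lt_trans _ h1)//; apply: pdist_lt_weight.
  apply: (lt_le_trans h2); rewrite lef_pV2 ?posrE ?ltr_pwDl ?Rplus_ge0//.
    by rewrite lerD2l le_max tT.
  by rewrite le_max lexx orbT.
move=> x e e0; have e30 : 0 < e / 3 by rewrite divr_gt0.
exists (e / 3)^-1, (e / 3) => // y xy.
have h : pdist x y <= e / 3 + (1 + (e / 3)^-1)^-1.
  apply: pdist_local; [by rewrite invr_ge0 ltW|exact: ltW|].
  by move=> t tT; exact/ltW/xy.
have h2 : (1 + (e / 3)^-1)^-1 <= e / 3.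
  rewrite invf_ple ?posrE//; last by rewrite ltr_pwDl// ltW// invr_gt0.
  by rewrite lerDr.
lra.
Qed.

Lemma metrizes_pdist : metrizes (fun x y : cpath R R => pdist x y).
Proof.
apply: metrizes_cpath; [exact: pdistxx|exact: pdistC| |exact: pdist_compat].
by move=> x y z; exact: pdist_triangle.
Qed.

Definition pdist2 (x y : Rplus R -> R * R) : R :=
  pdist (fst \o x) (fst \o y) + pdist (snd \o x) (snd \o y).

Lemma pdist2_ge0 x y : 0 <= pdist2 x y.
Proof. by rewrite addr_ge0 ?pdist_ge0. Qed.

Lemma pdist2_compat : path_dist_compat (fun x y : cpath R (R * R)%type => pdist2 x y).
Proof.
have [c1 c2] := pdist_compat.
pose X (x : cpath R (R * R)%type) : cpath R R := path_map (@fst_continuous R R) x.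
pose L (x : cpath R (R * R)%type) : cpath R R := path_map (@snd_continuous R R) x.
split.
  move=> x T e e0.
  have [d1 d10 H1] := c1 (X x) T e e0.
  have [d2 d20 H2] := c1 (L x) T e e0.
  exists (Num.min d1 d2); first by rewrite lt_min d10.
  move=> y; rewrite lt_min => /andP[h1 h2] t tT; split.
    by apply: (H1 (X y) _ t tT); apply: le_lt_trans h1; rewrite lerDl pdist_ge0.
  by apply: (H2 (L y) _ t tT); apply: le_lt_trans h2; rewrite lerDr pdist_ge0.
move=> x e e0; have e20 : 0 < e / 2 by rewrite divr_gt0.
have [T1 [d1 d10 H1]] := c2 (X x) _ e20.
have [T2 [d2 d20 H2]] := c2 (L x) _ e20.
exists (Num.max T1 T2), (Num.min d1 d2); first by rewrite lt_min d10.
move=> y H; rewrite /pdist2 [ltRHS]splitr ltrD//.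
  apply: (H1 (X y)) => t tT; have [] := H t _; first by rewrite le_max tT.
  by move=> h _; apply: le_ball h; rewrite ge_min lexx.
apply: (H2 (L y)) => t tT; have [] := H t _; first by rewrite le_max tT orbT.
by move=> _ h; apply: le_ball h; rewrite ge_min lexx orbT.
Qed.

Lemma metrizes_pdist2 : metrizes (fun x y : cpath R (R * R)%type => pdist2 x y).
Proof.
apply: metrizes_cpath; last exact: pdist2_compat.
- by move=> x; rewrite /pdist2 !pdistxx addr0.
- by move=> x y; rewrite /pdist2 pdistC [X in _ + X]pdistC.
- by move=> x y z; rewrite /pdist2 addrACA lerD// pdist_triangle.
Qed.

Definition pdist_row k (x y : Rplus R -> 'rV[R * R]_k) : R :=
  \sum_(i < k) pdist2 (fun t => x t ord0 i) (fun t => y t ord0 i).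

Lemma path_bigmin k (F : 'I_k -> R) : (forall i, 0 < F i) ->
  exists2 de, 0 < de & forall i, de <= F i.
Proof.
move=> F0; exists (\big[Num.min/1]_i F i); first exact: lt_bigmin.
by move=> i; exact: bigmin_le.
Qed.

Lemma metrizes_pdist_row k :
  metrizes (fun x y : cpath R 'rV[(R * R)%type]_k => pdist_row x y).
Proof.
have [Dxx DC Dt _] := metrizes_pdist2.
have [c1 c2] := pdist2_compat.
pose X i (x : cpath R 'rV[(R * R)%type]_k) : cpath R (R * R)%type :=
  path_map (@mx_entry_continuous (R * R)%type 1 k ord0 i) x.
apply: (@metrizes_cpath 'rV[(R * R)%type]_k (fun x y : cpath R 'rV[(R * R)%type]_k => pdist_row
  x y)).
- by move=> x; rewrite /pdist_row big1// => i _; exact: (Dxx (X i x)).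
- by move=> x y; apply: eq_bigr => i _; exact: (DC (X i x) (X i y)).
- move=> x y z; rewrite /pdist_row -big_split; apply: ler_sum => i _.
  exact: (Dt (X i x) (X i y) (X i z)).
split.
  move=> x T e e0.
  pose F i := s2val (cid2 (c1 (X i x) T e e0)).
  have F0 i : 0 < F i by rewrite /F; case: cid2.
  have HF i : forall y : cpath R (R * R)%type,
      pdist2 (X i x) y < F i -> forall t, Rplus_val t <= T -> ball (X i x t) e (y t).
    by rewrite /F; case: cid2.
  have [de de0 Hde] := path_bigmin F0.
  exists de => // y xy t tT; split => // i j; rewrite (ord1 i).
  apply: (HF j (X j y) _ t tT); apply: lt_le_trans (Hde j).
  apply: le_lt_trans xy; rewrite /pdist_row (bigD1 j)//= lerDl sumr_ge0// => l _.
  exact: pdist2_ge0.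
move=> x e e0.
have ek0 : 0 < e / k.+1%:R by rewrite divr_gt0.
have H i : {p : R * R | 0 < p.2 /\ forall y : cpath R (R * R)%type,
    (forall t, Rplus_val t <= p.1 -> ball (X i x t) p.2 (y t)) ->
    pdist2 (X i x) y < e / k.+1%:R}.
  by apply/cid; have [T [de de0 Hde]] := c2 (X i x) _ ek0; exists (T, de).
have [de de0 Hde] := path_bigmin (fun i => (svalP (H i)).1).
exists (\big[Num.max/0]_i (sval (H i)).1), de => // y Hy.
have : pdist_row x y <= \sum_(i < k) e / k.+1%:R.
  apply: ler_sum => i _; apply/ltW; apply: ((svalP (H i)).2 (X i y)) => t tT.
  apply: (@le_ball _ _ _ de); first exact: Hde.
  suff /Hy[] : Rplus_val t <= \big[Num.max/0]_i (sval (H i)).1 by move=> _; exact.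
  by rewrite (le_trans tT)//; exact: le_bigmax.
move=> /le_lt_trans; apply; rewrite sumr_const card_ord -mulrnAl -mulr_natr.
by rewrite ltr_pdivrMr// ltr_pM2l// ltr_nat.
Qed.

End path_metrics.

(** * Uniqueness of the law of Brownian motion *)

Section piecewise_linear.
Context (R : realType).

Definition ramp (u : R) : R := Num.max 0 (Num.min 1 u).

Lemma ramp_ge0 u : 0 <= ramp u. Proof. by rewrite le_max lexx. Qed.

Lemma ramp_le1 u : ramp u <= 1. Proof. by rewrite ge_max ler01 ge_min lexx. Qed.

Lemma ramp_eq0 u : u <= 0 -> ramp u = 0.
Proof. by move=> h; rewrite /ramp max_l// ge_min h orbT. Qed.

Lemma ramp_eq1 u : 1 <= u -> ramp u = 1.
Proof. by move=> h; rewrite /ramp min_l// max_r. Qed.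

Lemma ramp_id u : 0 <= u <= 1 -> ramp u = u.
Proof. by move=> /andP[h1 h2]; rewrite /ramp min_r// max_r. Qed.

Lemma ramp_continuous : continuous ramp.
Proof.
move=> u; apply: (@continuous_max R R (fun=> 0) (fun u => Num.min 1 u) u).
  exact: cvg_cst.
by apply: (@continuous_min R R (fun=> 1) id u); [exact: cvg_cst|exact: cvg_id].
Qed.

(** The slope [z k] is active on [k/m, (k+1)/m], so [z k] is the increment there. The factor 1 only
    gives the sum the shape of [average_continuous]. *)
Definition pl (m : R) N (y0 : R) (z : 'I_N -> R) (t : Rplus R) : R :=
  y0 + 1 * \sum_(k < N) z k * ramp (m * Rplus_val t - k%:R).

Lemma pl_continuous m N y0 z : continuous (@pl m N y0 z).
Proof.
have c0 c : continuous (fun _ : Rplus R => c : R).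
  by move=> s; apply: cvg_cst; exact: nbhs_filter.
have h : continuous (fun t : Rplus R => 1 * \sum_(k < N) z k * ramp (m * Rplus_val t - k%:R)).
  apply: average_continuous => k t.
  have h2 : continuous (fun t : Rplus R => m * Rplus_val t - k%:R).
    move=> s; apply: (@cvgB _ _ _ _ (nbhs_filter s)); last exact: c0.
    by apply: (@cvgMl_tmp _ _ _ (nbhs_filter s)); exact: Rplus_val_continuous.
  apply: (@cvgMl_tmp _ _ _ (nbhs_filter t)).
  exact: (continuous_comp (h2 t) (@ramp_continuous _)).
by move=> t; apply: (@cvgD _ _ _ _ (nbhs_filter t)); [exact: c0|exact: h].
Qed.

Definition pl_path m N y0 z : cpath R R := mkpath (@pl_continuous m N y0 z).

Lemma pl_pathE m N y0 z t :
  @pl_path m N y0 z t = y0 + \sum_(k < N) z k * ramp (m * Rplus_val t - k%:R).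
Proof. by rewrite -[LHS]/(pl m y0 z t) /pl mul1r. Qed.

Lemma pl_path_near m N y0 z y0' z' :
  pdist (@pl_path m N y0 z) (@pl_path m N y0' z') <=
  `|y0 - y0'| + \sum_k `|z k - z' k|.
Proof.
apply: pdist_le => t; rewrite /pterm ge_min; apply/orP; left.
rewrite !pl_pathE opprD addrACA (le_trans (ler_normD _ _))// lerD2l -sumrB.
rewrite (le_trans (ler_norm_sum _ _ _))// ler_sum// => k _.
by rewrite -mulrBl normrM ler_piMr// ger0_norm ?ramp_ge0 ?ramp_le1.
Qed.

(** On [N, N+1] the interpolation is a convex combination of [y N] and [y N.+1], the two values
    whose index is within 1 of [u]. The induction discards the ramps that have not started yet. *)
Lemma pl_convex (y : nat -> R) (y' w u : R) N : 0 <= u <= N%:R ->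
  (forall k : nat, `|k%:R - u| <= 1 -> `|y k - y'| <= w) ->
  `|y 0%N + \sum_(k < N) (y k.+1 - y k) * ramp (u - k%:R) - y'| <= w.
Proof.
move=> /andP[u0 uN] H; elim: N uN => [|N IH] uN.
  have -> : u = 0 by apply/eqP; rewrite eq_le u0 andbT.
  rewrite big_ord0 addr0; apply: H.
  have -> : u = 0 by apply/eqP; rewrite eq_le u0 andbT.
  by rewrite subrr normr0.
rewrite big_ord_recr /=; have [uN'|uN'] := leP u N%:R.
  by rewrite [ramp (u - N%:R)]ramp_eq0 ?subr_le0// mulr0 addr0; exact: IH.
(* All earlier ramps are saturated at 1 and the sum telescopes. *)
have -> : \sum_(k < N) (y k.+1 - y k) * ramp (u - k%:R) = y N - y 0%N.
  rewrite (eq_bigr (fun k : 'I_N => y k.+1 - y k)); last first.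
    move=> k _; rewrite ramp_eq1 ?mulr1// lerBrDr.
    by rewrite (le_trans _ (ltW uN'))// addrC natr1 ler_nat.
  by rewrite -(big_mkord xpredT (fun k => y k.+1 - y k)) telescope_sumr.
move: uN; rewrite -natr1 => uN.
rewrite ramp_id; last by apply/andP; split; lra.
have h1 : `|y N - y'| <= w by apply: H; rewrite ler_norml; apply/andP; split; lra.
have h2 : `|y N.+1 - y'| <= w.
  by apply: H; rewrite -natr1 ler_norml; apply/andP; split; lra.
set th := u - N%:R.
have -> : y 0%N + (y N - y 0%N + (y N.+1 - y N) * th) - y' =
  (1 - th) * (y N - y') + th * (y N.+1 - y') by ring.
have th0 : 0 <= th by rewrite /th; lra.
have th1 : 0 <= 1 - th by rewrite /th; lra.
rewrite (le_trans (ler_normD _ _))// !normrM (ger0_norm th0) (ger0_norm th1).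
have := ler_wpM2l th0 h2; have := ler_wpM2l th1 h1; lra.
Qed.

Definition grid (m : nat) (k : nat) : Rplus R := pos_part (k%:R / m.+1%:R).

Lemma grid_val m k : Rplus_val (grid m k) = k%:R / m.+1%:R.
Proof. by rewrite pos_partK. Qed.

Lemma grid0 m : grid m 0 = Rplus0 R.
Proof. by apply: Rplus_inj; rewrite grid_val mul0r. Qed.

(** (m+1)^2 steps of length 1/(m+1) cover [0, m+1], so mesh and horizon improve together. *)
Definition increments (m : nat) (x : Rplus R -> R) (k : 'I_(m.+1 * m.+1)) : R :=
  x (grid m k.+1) - x (grid m k).

Definition pl_interp (m : nat) (x : Rplus R -> R) : cpath R R :=
  pl_path m.+1%:R (x (Rplus0 R)) (@increments m x).

Lemma pl_interp_cvg (x : cpath R R) :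
  pdist x (pl_interp m x) @[m --> \oo] --> (0 : R).
Proof.
apply/cvgrPdist_le => e e0; have e20 : 0 < e / 2 by rewrite divr_gt0.
(* Beyond this time the weight (1 + T)^-1 is at most e/2. *)
pose T := (e / 2)^-1.
have [de de0 Hde] := path_unif x T e20.
exists (Num.truncn T + Num.truncn de^-1).+1 => // m /= hm.
have T0 : 0 <= T by rewrite invr_ge0 ltW.
have m0 : (0 : R) < m.+1%:R by [].
have Tm : T <= m.+1%:R.
  rewrite (le_trans (ltW (truncnS_gt _)))// ler_nat ltnS.
  by rewrite (leq_trans _ (ltnW hm))// leq_addr.
have dem : m.+1%:R^-1 < de.
  rewrite invf_plt ?posrE// (lt_le_trans (truncnS_gt _))// ler_nat ltnS.
  by rewrite (leq_trans _ (ltnW hm))// leq_addl.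
rewrite sub0r normrN ger0_norm ?pdist_ge0//.
have h : pdist x (pl_interp m x) <= e / 2 + (1 + T)^-1.
  apply: pdist_local => //; first exact: ltW.
  move=> t tT; rewrite distrC pl_pathE.
  rewrite -(grid0 m); apply: (@pl_convex (fun k => x (grid m k))).
    rewrite mulr_ge0 ?Rplus_ge0//= natrM ler_wpM2l//.
    exact: le_trans tT Tm.
  move=> k hk; rewrite distrC; apply/ltW/Hde => //.
  rewrite distrC grid_val (le_lt_trans _ dem)//.
  rewrite -[leRHS]mul1r ler_pdivlMr// -[X in _ * X]gtr0_norm// -normrM mulrBl divfK ?gt_eqF//.
  by rewrite [X in _ - X]mulrC.
have : (1 + T)^-1 <= e / 2.
  rewrite invf_ple ?posrE//; last by rewrite ltr_pwDl.
  by rewrite -/T lerDr.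
by lra.
Qed.

Definition dense_path (n : nat) : cpath R R :=
  if (unpickle n : option (nat * rat * seq rat)%type) is Some (m, q, s)
  then pl_path m%:R (ratr q) (fun k : 'I_(size s) => ratr (nth 0 s k))
  else const_path R 0.

Lemma ratr_approx (x e : R) : 0 < e -> exists q : rat, `|ratr q - x| <= e.
Proof.
move=> e0; have /rat_in_itvoo [q] : x - e < x + e by lra.
rewrite in_itv /= => /andP[h1 h2]; exists q.
by rewrite ler_norml; apply/andP; split; lra.
Qed.

Lemma dense_path_dense : dense_seq (fun x y : cpath R R => pdist x y) dense_path.
Proof.
move=> x de de0; have de20 : 0 < de / 2 by rewrite divr_gt0.
have := pl_interp_cvg x; move/cvgrPdist_lt => /(_ _ de20) [m _ /(_ m (leqnn m))].
rewrite /= sub0r normrN ger0_norm ?pdist_ge0// => hm.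
pose N := (m.+1 * m.+1)%N.
(* The starting value and the [N] increments each contribute an error of at most [eta]. *)
pose eta := de / 2 / N.+2%:R.
have eta0 : 0 < eta by rewrite divr_gt0.
have [q hq] := ratr_approx (x (Rplus0 R)) eta0.
have H (k : 'I_N) : {r : rat | `|ratr r - @increments m x k| <= eta}.
  by apply/cid/ratr_approx.
pose s := [seq sval (H k) | k <- enum 'I_N].
have ss : size s = N by rewrite size_map size_enum_ord.
exists (pickle (m.+1, q, s)); rewrite /dense_path pickleK.
apply: le_lt_trans (pdist_triangle _ (pl_interp m x) _) _.
rewrite [ltRHS]splitr; apply: ltr_leD => //.
have ns (k : 'I_N) : nth 0 s k = sval (H k).
  by rewrite (nth_map k) ?size_enum_ord// nth_ord_enum.
clearbody s; move: (size s) ss ns => _ -> ns.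
apply: (le_trans (pl_path_near _ _ _ _ _)).
apply: (@le_trans _ _ (eta + \sum_(k < N) eta)).
  apply: lerD; first by rewrite distrC.
  by apply: ler_sum => k _; rewrite ns distrC; exact: (svalP (H k)).
rewrite sumr_const card_ord -mulrS -(mulr_natr _ N.+1) /eta [leLHS]mulrAC ler_pdivrMr//.
by rewrite ler_wpM2l ?(ltW de20)// ler_nat.
Qed.

Definition dense_path2 (n : nat) : cpath R (R * R)%type :=
  if (unpickle n : option (nat * nat)%type) is Some (i, j)
  then path_pair (dense_path i) (dense_path j) else point.

Lemma dense_path2_dense :
  dense_seq (fun x y : cpath R (R * R)%type => pdist2 x y) dense_path2.
Proof.
move=> x de de0; have de20 : 0 < de / 2 by rewrite divr_gt0.
have [i hi] := dense_path_dense (path_map (@fst_continuous R R) x) de20.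
have [j hj] := dense_path_dense (path_map (@snd_continuous R R) x) de20.
exists (pickle (i, j)); rewrite /dense_path2 pickleK [ltRHS]splitr.
exact: ltrD.
Qed.

Definition dense_row k (n : nat) : cpath R 'rV[(R * R)%type]_k :=
  if (unpickle n : option (k.-tuple nat)) is Some v
  then path_row (fun i => dense_path2 (tnth v i)) else point.

Lemma dense_row_dense k :
  dense_seq (fun x y : cpath R 'rV[(R * R)%type]_k => pdist_row x y) (@dense_row k).
Proof.
move=> x de de0.
have ek0 : 0 < de / k.+1%:R by rewrite divr_gt0.
have H i := cid (dense_path2_dense (path_map (@mx_entry_continuous (R * R)%type 1 k ord0 i) x) ek0).
pose v : k.-tuple nat := [tuple sval (H i) | i < k].
exists (pickle v); rewrite /dense_row pickleK.
have : pdist_row x (path_row (fun i => dense_path2 (tnth v i))) <= \sum_(i < k) de / k.+1%:R.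
  apply: ler_sum => i _; apply/ltW; have := svalP (H i); rewrite /=.
  set a := pdist2 _ _; set c := pdist2 _ _; suff -> : a = c by [].
  rewrite /a /c; congr pdist2; apply/funext => t /=.
  by rewrite mxE tnth_mktuple.
move=> /le_lt_trans; apply; rewrite sumr_const card_ord -mulrnAl -mulr_natr.
by rewrite ltr_pdivrMr// ltr_pM2l// ltr_nat.
Qed.

End piecewise_linear.

Section brownian_law.
Context (R : realType).

Lemma cvg_seq_eq (u v : nat -> R) (a c : R) : u n @[n --> \oo] --> a ->
  v n @[n --> \oo] --> c -> (forall n, u n = v n) -> a = c.
Proof.
move=> ua vc uv; have vu : v = u by apply/funext => n; rewrite uv.
move: vc; rewrite vu => uc; exact: (cvg_unique _ ua uc).
Qed.

Definition quantize N (j : nat) (z : 'I_N -> R) : 'I_N -> R :=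
  fun k => qpt R (qidx j (z k)).

Definition coordinatewise_continuous N (F : ('I_N -> R) -> R) :=
  forall (z : nat -> 'I_N -> R) z', (forall k, z n k @[n --> \oo] --> z' k) ->
     F (z n) @[n --> \oo] --> F z'.

Lemma lip_coordinatewise N (F : ('I_N -> R) -> R) C :
  (forall z z', `|F z - F z'| <= C * \sum_k `|z k - z' k|) ->
  coordinatewise_continuous F.
Proof.
move=> FC z z' zz'; apply/cvgrPdist_le => e e0.
have : \sum_k C * `|z' k - z n k| @[n --> \oo] --> (0 : R).
  rewrite [X in _ --> X](_ : 0 = \sum_(k < N) C * 0 :> R); last first.
    by rewrite big1// => k _; rewrite mulr0.
  apply: (cvg_big add_continuous) => k _; apply: cvgMl_tmp.
  by apply/cvgrPdist_le => a a0; have /cvgrPdist_le/(_ a a0) := zz' k;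
    apply: filterS => n; rewrite sub0r normrN normr_id.
move=> /cvgrPdist_le/(_ _ e0); apply: filterS => n; rewrite sub0r normrN => h.
by rewrite (le_trans (FC _ _))// mulr_sumr (le_trans (ler_norm _)).
Qed.

(** After rounding, an arbitrary function of the coordinates is a finite sum of products of
    functions of single coordinates, which is the form to which independence applies. *)
Lemma quantizeE N (F : ('I_N -> R) -> R) j z :
  F (quantize j z) = \sum_(v : {ffun 'I_N -> 'I_(2 * j.+1 * j.+1).+1})
    F (fun k => @qpt R j (v k)) * \prod_k \1_[set u | qidx j u = v k] (z k).
Proof.
rewrite (bigD1 [ffun k => qidx j (z k)])//= big1 ?mulr1; last first.
  by move=> k _; rewrite indicE mem_set// ffunE.
rewrite big1 ?addr0; last first.
  move=> v vq; have [k hk] : exists k, qidx j (z k) != v k.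
    apply/existsP; rewrite -negb_forall; apply: contra vq => /forallP h.
    by apply/eqP/ffunP => k; rewrite ffunE; apply/esym/eqP/h.
  by rewrite (bigD1 k)//= indicE memNset ?mul0r ?mulr0//=; exact/eqP.
by congr F; apply/funext => k; rewrite ffunE.
Qed.

Section family.
Context N d (T : measurableType d) (P : probability T R) (Z : 'I_N -> T -> R).
Context (mZ : forall k, measurable_fun setT (Z k)).
Context (F : ('I_N -> R) -> R) (M : R) (FM : forall z, `|F z| <= M).
Context (cF : coordinatewise_continuous F).

Let bounded_rv_cell j (v : {ffun 'I_N -> 'I_(2 * j.+1 * j.+1).+1}) k :
  bounded_rv (fun w => \1_[set u | qidx j u = v k] (Z k w) : R).
Proof. by apply: bounded_rv_indic_comp => //; exact: measurable_qidx. Qed.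

Lemma bounded_rv_quantize j : bounded_rv (fun w => F (quantize j (Z ^~ w))).
Proof.
under eq_fun do rewrite quantizeE; apply: bounded_rv_sum => v; apply: bounded_rvZ.
exact: bounded_rv_prod.
Qed.

Lemma quantize_cvg w : F (quantize j (Z ^~ w)) @[j --> \oo] --> F (Z ^~ w).
Proof. by apply: cF => k; exact: qpt_cvg. Qed.

Lemma bounded_rv_family : bounded_rv (fun w => F (Z ^~ w)).
Proof.
apply: (@bounded_rv_cvg _ _ _ (fun j w => F (quantize j (Z ^~ w))) _ M) => //.
- by move=> j; have [] := bounded_rv_quantize j.
- exact: quantize_cvg.
Qed.

Lemma Ex_quantize_cvg :
  Ex P (fun w => F (quantize j (Z ^~ w))) @[j --> \oo] --> Ex P (fun w => F (Z ^~ w)).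
Proof.
apply: (@Ex_cvg _ _ _ _ _ _ M) => //.
- by move=> j; have [] := bounded_rv_quantize j.
- exact: quantize_cvg.
Qed.

Lemma Ex_quantize j : independent_family P predT Z ->
  Ex P (fun w => F (quantize j (Z ^~ w))) =
   \sum_(v : {ffun 'I_N -> 'I_(2 * j.+1 * j.+1).+1}) F (fun k => @qpt R j (v k)) *
     \prod_k fine (P (Z k @^-1` [set u | qidx j u = v k])).
Proof.
move=> iZ; under eq_fun do rewrite quantizeE.
rewrite Ex_sum; last by move=> v; apply: bounded_rvZ; exact: bounded_rv_prod.
apply: eq_bigr => v _; rewrite ExZ; last exact: bounded_rv_prod.
congr (_ * _).
have /= -> := @Ex_indep_family _ _ _ _ _ _ _ _ Z
  (fun k => \1_[set u | qidx j u = v k]) (index_enum 'I_N) iZ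
  (index_enum_uniq _).
- apply: eq_bigr => k _; rewrite -Ex_indicE -?indic_preimage//.
  by rewrite -[X in measurable X]setTI; apply: mZ => //; exact: measurable_qidx.
- by [].
- by move=> k _.
- by move=> k; apply: bounded_rv_indic; exact: measurable_qidx.
Qed.

End family.

Lemma Ex_family_law N d (T : measurableType d) (P : probability T R)
    d' (T' : measurableType d') (P' : probability T' R)
    (Z : 'I_N -> T -> R) (Z' : 'I_N -> T' -> R) (F : ('I_N -> R) -> R) (M : R) :
  (forall k, measurable_fun setT (Z k)) -> (forall k, measurable_fun setT (Z' k)) ->
  independent_family P predT Z -> independent_family P' predT Z' ->
  (forall k B, measurable B -> P (Z k @^-1` B) = P' (Z' k @^-1` B)) ->
  (forall z, `|F z| <= M) -> coordinatewise_continuous F ->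
  Ex P (fun w => F (Z ^~ w)) = Ex P' (fun w => F (Z' ^~ w)).
Proof.
move=> mZ mZ' iZ iZ' ZZ' FM cF.
have h1 := Ex_quantize_cvg (P := P) mZ FM cF.
have h2 := Ex_quantize_cvg (P := P') mZ' FM cF.
apply: (cvg_seq_eq h1 h2) => j.
rewrite !Ex_quantize//; apply: eq_bigr => v _; congr (_ * _); apply: eq_bigr => k _.
by rewrite ZZ'//; exact: measurable_qidx.
Qed.

Lemma measurable_path_eval d (T : measurableType d) (W : T -> cpath R R) t :
  measurable_fun setT (W : T -> borel (cpath R R)) ->
  measurable_fun setT (fun w => W w t).
Proof.
move=> mW; have := continuous_borelR (@path_eval_continuous R R t).
by move/measurableT_comp; apply.
Qed.

(** The interpolated functional depends on finitely many independent Gaussian increments, whose laws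
    agree for [W] and [W']; the mesh then tends to 0 under the expectation. *)
Lemma brownian_law d (T : measurableType d) (P : probability T R)
    d' (T' : measurableType d') (P' : probability T' R) (b sigma : R)
    (W : T -> cpath R R) (W' : T' -> cpath R R) (f : cpath R R -> R) :
  brownian_motion P b sigma W -> brownian_motion P' b sigma W' ->
  bl (fun x y : cpath R R => pdist x y) f ->
  Ex P (f \o W) = Ex P' (f \o W').
Proof.
move=> BW BW' blf; have [[M fM] [C C0 fC]] := blf.
have bf := bl_measurable (metrizes_pdist R) blf.
pose F m (z : 'I_(m.+1 * m.+1) -> R) := f (pl_path m.+1%:R 0 z).
have cF m : coordinatewise_continuous (F m).
  apply: (@lip_coordinatewise _ _ C) => z z'; apply: (le_trans (fC _ _)); rewrite ler_wpM2l//.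
  by rewrite (le_trans (pl_path_near _ _ _ _ _))// subrr normr0 add0r.
have mincr d0 (T0 : measurableType d0) (P0 : probability T0 R) (W0 : T0 -> cpath R R) :
    brownian_motion P0 b sigma W0 ->
    forall m k, measurable_fun setT (fun w => @increments R m (W0 w) k).
  by move=> [mW _ _ _] m k; apply: measurable_funB; exact: measurable_path_eval.
have key d0 (T0 : measurableType d0) (P0 : probability T0 R) (W0 : T0 -> cpath R R) :
    brownian_motion P0 b sigma W0 ->
    Ex P0 (fun w => F m (@increments R m (W0 w))) @[m --> \oo] --> Ex P0 (f \o W0).
  move=> BW0; have [mW W00 _ _] := BW0.
  (* Measurability comes from viewing the functional as a continuous function of finitely many real
     variables: the starting value, at index [ord0], and the increments. *)
  have mG m : bounded_rv (fun w => f (pl_interp m (W0 w))).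
    pose G (z : 'I_(m.+1 * m.+1).+1 -> R) :=
      f (pl_path m.+1%:R (z ord0) (fun k => z (lift ord0 k))).
    pose Z (k : 'I_(m.+1 * m.+1).+1) w :=
      if unlift ord0 k is Some i then @increments R m (W0 w) i else W0 w (Rplus0 R).
    have -> : (fun w => f (pl_interp m (W0 w))) = (fun w => G (Z ^~ w)).
      apply/funext => w; rewrite /G /pl_interp /Z unlift_none.
      by congr (f (pl_path _ _ _)); apply/funext => k; rewrite liftK.
    apply: (@bounded_rv_family _ _ _ Z _ G M) => //.
      move=> k; rewrite /Z; case: unliftP => [i _|_]; first exact: mincr BW0 m i.
      exact: measurable_path_eval.
      by move=> z; exact: fM.
    apply: (@lip_coordinatewise _ _ C) => z z'; apply: (le_trans (fC _ _)); rewrite ler_wpM2l//.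
    by rewrite big_ord_recl; exact: pl_path_near.
  have h : Ex P0 (fun w => f (pl_interp m (W0 w))) @[m --> \oo] --> Ex P0 (f \o W0).
    apply: (@Ex_cvg _ _ _ _ _ _ M) => //; first by move=> m; have [] := mG m.
    move=> w; apply/cvgrPdist_le => e e0.
    have /cvgrPdist_le := pl_interp_cvg (W0 w).
    have eC0 : 0 < e / (C + 1) by rewrite divr_gt0// ltr_wpDl.
    move=> /(_ _ eC0); apply: filterS => m; rewrite sub0r normrN ger0_norm ?pdist_ge0// => h.
    apply: (le_trans (fC _ _)); move: h; rewrite ler_pdivlMr ?ltr_wpDl// => h.
    by apply: le_trans h; rewrite mulrC ler_wpM2l ?pdist_ge0// lerDl.
  apply: cvg_trans h; apply: near_eq_cvg; apply: nearW => m.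
  (* [F m] starts its path at 0, whereas [W0] starts there only almost surely. *)
  apply: eq_ae_Ex => //.
    apply: (@bounded_rv_family _ _ _ (fun k w => @increments R m (W0 w) k) (mincr _ _ _ _ BW0 m)
      (F m) M) => //.
    by move=> z; exact: fM.
  by apply: filterS W00 => w w0; rewrite /pl_interp w0.
apply: (cvg_seq_eq (key _ _ _ _ BW) (key _ _ _ _ BW')) => m.
apply: (@Ex_family_law _ _ _ _ _ _ _ (fun k w => @increments R m (W w) k)
  (fun k w => @increments R m (W' w) k) (F m) M) => //.
- exact: (mincr _ _ _ _ BW).
- exact: (mincr _ _ _ _ BW').
- by have [_ _ _ H] := BW; apply: (H _ (grid R m)) => i j ij; rewrite !grid_val ler_wpM2r// ler_nat.
- by have [_ _ _ H] := BW'; apply: (H _ (grid R m)) => i j ij;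
  rewrite !grid_val ler_wpM2r// ler_nat.
- move=> k B mB; have kk : Rplus_val (grid R m k) < Rplus_val (grid R m k.+1).
    by rewrite !grid_val ltr_pM2r// ltr_nat.
  by have [_ _ H _] := BW; have [_ _ H' _] := BW'; rewrite H// H'.
- by move=> z; exact: fM.
Qed.

End brownian_law.

(** * The one-dimensional Skorokhod map *)

Section reflection.
Context (R : realType).
Implicit Types (z : cpath R R) (t s : Rplus R).

(* Skorokhod's formula: the only candidate for the local time [l] of a reflected
   path [z + l], see [complementary_regulator]. *)
Definition regulator z t : R :=
  sup [set Num.max 0 (- z s) | s in [set s | Rplus_val s <= Rplus_val t]].

Let has_sup_regulator z t :
  has_sup [set Num.max 0 (- z s) | s in [set s | Rplus_val s <= Rplus_val t]].
Proof.
split; first by exists (Num.max 0 (- z t)), t => //=.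
have [M hM] := path_bounded z (Rplus_val t).
exists (Num.max 0 M) => _ [s /= st <-].
rewrite ge_max le_max lexx /= le_max; apply/orP; right.
by have := hM s st; rewrite ler_norml; lra.
Qed.

Lemma regulator_ge z t s : Rplus_val s <= Rplus_val t -> - z s <= regulator z t.
Proof.
move=> st; apply: (@le_trans _ _ (Num.max 0 (- z s))); first by rewrite le_max lexx orbT.
by apply: sup_upper_bound => //; exists s.
Qed.

Lemma regulator_ge0 z t : 0 <= regulator z t.
Proof.
apply: (@le_trans _ _ (Num.max 0 (- z t))); first by rewrite le_max lexx.
by apply: sup_upper_bound => //; exists t => /=.
Qed.

Lemma regulator_le z t C : 0 <= C ->
  (forall s, Rplus_val s <= Rplus_val t -> - z s <= C) -> regulator z t <= C.
Proof.
move=> C0 H; apply: ge_sup; first by case: (has_sup_regulator z t).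
by move=> _ [s /= st <-]; rewrite ge_max C0 H.
Qed.

Lemma regulator_mono z s t : Rplus_val s <= Rplus_val t ->
  regulator z s <= regulator z t.
Proof.
move=> st; apply: regulator_le; first exact: regulator_ge0.
by move=> u us; apply: regulator_ge; exact: le_trans us st.
Qed.

Lemma regulator_lip z z' t C :
  (forall s, Rplus_val s <= Rplus_val t -> `|z s - z' s| <= C) ->
  `|regulator z t - regulator z' t| <= C.
Proof.
move=> H; have C0 : 0 <= C by apply: le_trans (H t _).
have key z1 z2 : (forall s, Rplus_val s <= Rplus_val t -> `|z1 s - z2 s| <= C) ->
    regulator z1 t <= regulator z2 t + C.
  move=> H12; apply: regulator_le; first by rewrite addr_ge0// regulator_ge0.
  move=> s st; have := H12 s st; have := regulator_ge z2 st.
  by rewrite ler_norml; lra.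
have h1 := key _ _ H.
have h2 : regulator z' t <= regulator z t + C.
  by apply: key => s st; rewrite distrC; exact: H.
by rewrite ler_norml; apply/andP; split; lra.
Qed.

Lemma regulator_incr z u v e : 0 <= e -> Rplus_val u <= Rplus_val v ->
  (forall s, Rplus_val u <= Rplus_val s -> Rplus_val s <= Rplus_val v ->
     `|z s - z u| <= e) ->
  regulator z v <= regulator z u + e.
Proof.
move=> e0 uv H; apply: regulator_le; first by rewrite addr_ge0// regulator_ge0.
move=> s sv; have [su|us] := leP (Rplus_val s) (Rplus_val u).
  by rewrite (le_trans (regulator_ge z su))// lerDl.
have := H s (ltW us) sv; have := regulator_ge z (lexx (Rplus_val u)).
by rewrite ler_norml; lra.
Qed.

Lemma regulator_continuous z : continuous (regulator z).
Proof.
move=> t; apply/(@cvgrPdist_le _ _ _ _ (nbhs_filter t)) => e e0.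
have [de de0 H] := path_unif z (Rplus_val t + 1) (divr_gt0 e0 (ltr0n _ 2)).
have m0 : 0 < Num.min (de / 2) 1 by rewrite lt_min divr_gt0 ?ltr01.
have /(@cvgrPdist_lt _ _ _ _ (nbhs_filter t))/(_ _ m0) := @Rplus_val_continuous R t.
apply: filterS => s; rewrite lt_min => /andP[st1 st2].
have key u v : Rplus_val u <= Rplus_val v -> Rplus_val v <= Rplus_val t + 1 ->
    `|Rplus_val u - Rplus_val v| < de / 2 -> `|regulator z u - regulator z v| <= e.
  move=> uv vt uvd; have h1 := regulator_mono z uv.
  have h2 : regulator z v <= regulator z u + e.
    apply: regulator_incr => //; first exact: ltW.
    move=> r ur rv; apply/ltW; apply: (@lt_trans _ _ (e / 2)); last by lra.
    apply: H; first exact: le_trans rv vt.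
    by move: uvd; rewrite !ltr_norml; lra.
  by rewrite ler_norml; apply/andP; split; lra.
move: st1 st2; rewrite !ltr_norml => /andP[? ?] /andP[? ?].
have [ts|ts] := leP (Rplus_val t) (Rplus_val s).
  by apply: key => //; [lra|rewrite ltr_norml; apply/andP; split; lra].
rewrite distrC; apply: key => //; [lra|lra|].
by rewrite ltr_norml; apply/andP; split; lra.
Qed.

Definition regulator_path z : cpath R R := mkpath (@regulator_continuous z).

(** Since x is nonnegative and [l] is nondecreasing, [l] dominates the regulator. If it exceeded the
    value C of the regulator at [t], then after an intermediate time [s1] with C < l(s1) < l(t) the
    path x = z + l would stay positive up to [t], so that [l] could not charge the interval after
    [s1], although it increases there. *)
Lemma complementary_regulator (x l z : cpath R R) :
  complementary x l -> (forall t, x t = z t + l t) -> forall t, l t = regulator z t.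
Proof.
move=> [x0 l0 lm [F [FE intF]]] xE t.
have l_ge0 s : 0 <= l s by rewrite -l0; apply: lm; exact: Rplus_ge0.
apply/eqP; rewrite eq_le; apply/andP; split; last first.
  apply: regulator_le => // s st; apply: le_trans (lm _ _ st).
  by have := x0 s; rewrite xE; lra.
rewrite leNgt; apply/negP => ltl.
set C := regulator z t in ltl *.
have C0 : 0 <= C := regulator_ge0 z t.
pose T := Rplus_val t.
have T0 : 0 <= T := Rplus_ge0 t.
have cont (y : cpath R R) : continuous (fun s : R => y (pos_part s)).
  move=> s; apply: (@continuous_comp _ _ _ (@pos_part R) y).
    exact: pos_part_continuous.
  exact: cts_fun.
have p0 : pos_part (0 : R) = Rplus0 R by apply: Rplus_inj; rewrite pos_partK.
have pT : pos_part T = t by exact: Rplus_valK.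
(* The midpoint between [C] and [l t] leaves room on both sides: [x] is positive after [s1], and [l]
   still has to grow. *)
have [s1 s1T ls1] : exists2 s1, s1 \in `[0, T] & l (pos_part s1) = (C + l t) / 2.
  apply: IVT => //.
    by apply: continuous_subspaceT => s; exact: cont.
  rewrite p0 l0 pT min_l ?l_ge0// max_r ?l_ge0//; apply/andP; split; lra.
move: s1T; rewrite in_itv/= => /andP[s10 s1T].
have xpos (s : R) : s1 < s <= T -> 0 < x (pos_part s).
  move=> /andP[s1s sT]; rewrite xE.
  have s0 : 0 <= s by rewrite (le_trans s10)// ltW.
  have h1 : l (pos_part s1) <= l (pos_part s) by apply: lm; rewrite !pos_partK// ltW.
  have : - z (pos_part s) <= C by apply: regulator_ge; rewrite pos_partK.
  by lra.
have mx : measurable_fun setT (fun s : R => (x (pos_part s))%:E).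
  by apply/measurable_EFinP; apply: continuous_measurable_fun; exact: cont.
(* A nonnegative function with zero integral vanishes almost everywhere for the Stieltjes measure;
   hence the interval on which [x] is positive is null. *)
have := @ae_eq_integral_abs _ _ _ (lebesgue_stieltjes_measure F) `[0%R, +oo[%classic
  (measurable_itv _) (fun s : R => (x (pos_part s))%:E) (measurable_funTS mx).
move=> [+ _]; rewrite (_ : integral _ _ _ = 0%E); last first.
  rewrite -[RHS]intF; apply: eq_integral => s _.
  by rewrite gee0_abs// lee_fin.
move=> /(_ erefl) [N [mN N0 subN]].
have sub1 : `]s1, T]%classic `<=` N.
  move=> s; rewrite /= in_itv/= => s1sT; apply: subN => /= h.
  have /h : `[0%R, +oo[%classic s.
    by rewrite /= in_itv/= andbT; move: s1sT => /andP[? _]; rewrite (le_trans s10)// ltW.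
  by case => hx; have := xpos s s1sT; rewrite hx ltxx.
have : lebesgue_stieltjes_measure F `]s1, T]%classic = 0%E.
  by apply: (subset_measure0 _ mN sub1) => //; exact: measurable_itv.
rewrite /lebesgue_stieltjes_measure/= /measure_extension/= measurable_mu_extE//;
  last exact: is_ocitv.
have ltT : s1 < T.
  rewrite lt_neqAle s1T andbT; apply/eqP => s1T'.
  by move: ls1; rewrite s1T' pT; lra.
move=> F0; have := wlength_itv F `]s1, T]; rewrite [LHS]F0 /= lte_fin ltT !FE pT ls1 -EFinB.
by move=> -[]; lra.
Qed.

Context (lam : cpath R R) (a : R).

Lemma free_continuous (x : Rplus R) (w : cpath R R) :
  continuous (fun t => Rplus_val x + w t + a * lam t).
Proof.
have cc (u v : Rplus R -> R) : continuous u -> continuous v ->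
    continuous (fun t => u t + v t).
  by move=> cu cv t; apply: (@cvgD _ _ _ _ (nbhs_filter t)); [exact: cu|exact: cv].
apply: (cc); first apply: (cc).
- by move=> t; apply: cvg_cst; exact: nbhs_filter.
- exact: (@cts_fun _ _ w).
- by move=> t; apply: (@cvgMl_tmp _ _ _ (nbhs_filter t)); exact: (@cts_fun _ _ lam).
Qed.

Definition free_path x w : cpath R R := mkpath (@free_continuous x w).

Lemma constrained_continuous z : continuous (fun t => z t + regulator_path z t).
Proof.
move=> t; apply: (@cvgD _ _ _ _ (nbhs_filter t)); exact: cts_fun.
Qed.

Definition constrained_path z : cpath R R := mkpath (@constrained_continuous z).

(* For [lam] the mean local time of the limit, this solves the limiting equation
   pathwise, also when driven by the noises of the particles. *)
Definition limit_map (x : Rplus R) (w : cpath R R) : cpath R (R * R)%type :=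
  path_pair (constrained_path (free_path x w)) (regulator_path (free_path x w)).

(** For running suprema the regulator is 1-Lipschitz and the constrained path, its sum with [z], is
    2-Lipschitz; whence 3. *)
Lemma pdist2_reflection z z' :
  pdist2 (path_pair (constrained_path z) (regulator_path z))
    (path_pair (constrained_path z') (regulator_path z')) <= 3 * pdist z z'.
Proof.
rewrite /pdist2; have -> : (3 : R) = 2 + 1 by lra.
rewrite mulrDl lerD//.
  apply: pdist_causal; first by lra.
  move=> t C H /=; have := H t (lexx _); have := regulator_lip H.
  move=> h1 h2; rewrite opprD addrACA (le_trans (ler_normD _ _))//; lra.
apply: pdist_causal; first by lra.
by move=> t C H /=; rewrite mul1r; exact: regulator_lip.
Qed.

Lemma limit_map_lip_noise x w w' :
  pdist2 (limit_map x w) (limit_map x w') <= 3 * pdist w w'.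
Proof.
apply: (le_trans (pdist2_reflection _ _)); rewrite ler_wpM2l//.
rewrite -[leRHS]mul1r; apply: pdist_causal => // t C /(_ t (lexx _)) h /=.
by rewrite mul1r opprD addrACA subrr addr0 opprD addrACA subrr add0r.
Qed.

Lemma limit_map_lip_init x y w :
  pdist2 (limit_map x w) (limit_map y w) <= 3 * `|Rplus_val x - Rplus_val y|.
Proof.
apply: (le_trans (pdist2_reflection _ _)); rewrite ler_wpM2l//.
apply: pdist_le => t; rewrite /pterm ge_min; apply/orP; left => /=.
by rewrite opprD addrACA subrr addr0 opprD addrACA subrr addr0.
Qed.

End reflection.

(** * Chaoticity of the copies of the limit *)

Section law_transfer.
Context (R : realType).

Lemma Ex_law d (T : measurableType d) (P : probability T R)
    d' (E : measurableType d') (mu : probability E R) (Y : T -> E) (f : E -> R) :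
  measurable_fun setT Y -> (forall A, measurable A -> P (Y @^-1` A) = mu A) ->
  bounded_rv f -> Ex P (f \o Y) = Ex mu f.
Proof.
move=> mY PY bf; apply/eqP; rewrite -subr_eq0; apply/eqP.
have [mf [M fM]] := bf.
apply: (@norm_le_small_eq0 _ _ 2) => e e0.
have [n [c [B [mB approx]]]] := @simple_approx R M e e0.
pose s x := \sum_v c v * \1_(B v) (f x).
have b1 v : bounded_rv (fun x => \1_(B v) (f x) : R) by exact: bounded_rv_indic_comp.
have bs : bounded_rv s by apply: bounded_rv_sum => v; exact: bounded_rvZ.
have bfY : bounded_rv (f \o Y) by exact: bounded_rv_comp.
have bsY : bounded_rv (s \o Y) by exact: bounded_rv_comp.
have near_s x : `|f x - s x| <= e by exact: approx.
have E1 : Ex P (s \o Y) = Ex mu s.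
  rewrite [RHS](_ : _ = Ex mu (fun x => \sum_v c v * \1_(B v) (f x)))//.
  rewrite [LHS](_ : _ = Ex P (fun x => \sum_v c v * \1_(B v) (f (Y x))))//.
  rewrite Ex_sum; last by move=> v; apply: bounded_rvZ; exact: (bounded_rv_comp mY (b1 v)).
  rewrite Ex_sum; last by move=> v; exact: bounded_rvZ.
  apply: eq_bigr => v _; rewrite !ExZ//; last exact: (bounded_rv_comp mY (b1 v)).
  congr (_ * _); rewrite (indic_preimage _ (B v) f).
  have mfB : measurable (f @^-1` B v) by rewrite -[X in measurable X]setTI; exact: mf.
  have mYB : measurable (Y @^-1` (f @^-1` B v)).
    by rewrite -[X in measurable X]setTI; exact: mY.
  rewrite [LHS](_ : _ = Ex P (\1_(Y @^-1` (f @^-1` B v)))).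
    by rewrite !Ex_indicE// PY.
  by congr Ex; apply/funext => x; rewrite !indicE; congr (_%:R); apply/idP/idP; rewrite !inE.
have -> : Ex P (f \o Y) - Ex mu f = (Ex P (f \o Y) - Ex P (s \o Y)) + (Ex mu s - Ex mu f).
  by rewrite E1; ring.
rewrite (le_trans (ler_normD _ _))// mulrDl mul1r lerD//.
  by apply: Ex_near => // x; exact: near_s.
by apply: Ex_near => // x; rewrite distrC; exact: near_s.
Qed.

Lemma independent_family_inj d (T : measurableType d) (P : probability T R)
    (I K : eqType) d' (E : measurableType d') (X : I -> T -> E) (iota : K -> I) :
  injective iota -> independent_family P predT X ->
  independent_family P predT (fun k => X (iota k)).
Proof.
move=> inj iX s B us _ mB.
pose B' j := if pselect (exists k, iota k = j) is left h then B (sval (cid h)) else setT.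
have B'E k : B' (iota k) = B k.
  rewrite /B'; case: pselect => [h|]; last by case; exists k.
  by case: cid => k' /= /inj ->.
have us' : uniq [seq iota k | k <- s] by rewrite map_inj_uniq.
have mB' j : measurable (B' j) by rewrite /B'; case: pselect.
have H := iX _ B' us' (fun _ _ => isT) mB'; rewrite big_map in H.
rewrite [RHS](eq_bigr (fun k => P (X (iota k) @^-1` B' (iota k)))) -?H; last first.
  by move=> k _; rewrite B'E.
congr (P _); apply/seteqP; split => w {}H j /=.
  by move=> /mapP[k ks ->]; rewrite B'E; exact: H.
by move=> js; rewrite -B'E; apply: H; exact: map_f.
Qed.

Lemma prod_norm_le I (s : seq I) (F : I -> R) (M : R) : 0 <= M ->
  (forall i, `|F i| <= M) -> `|\prod_(i <- s) F i| <= M ^+ size s.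
Proof.
move=> M0 FM; elim: s => [|i s IH]; first by rewrite big_nil normr1.
by rewrite big_cons normrM exprS ler_pM.
Qed.

End law_transfer.

(** * Integrating out the noises *)

Section initial_noise.
Context (R : realType) d (T : measurableType d) (P : probability T R).
Context d0 (T0 : measurableType d0) (P0 : probability T0 R) (W0 : T0 -> cpath R R).
Context k (X : 'I_k -> T -> Rplus R) (W : 'I_k -> T -> cpath R R).
Context (mX : forall i, measurable_fun setT (X i : T -> borel (Rplus R))).
Context (mW : forall i, measurable_fun setT (W i : T -> borel (cpath R R))).
Context (mW0 : measurable_fun setT (W0 : T0 -> borel (cpath R R))).

Local Notation blp := (bl (fun x y : cpath R R => pdist x y)).

(** The only joint information used: the initial positions as a block are independent of the noises,
    and the noises are independent copies of [W0]. The initial positions may depend on each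
    other. *)
Context (XW : forall (u : 'I_k -> Rplus R -> R) (g : 'I_k -> cpath R R -> R),
  (forall i, bounded_rv (u i : borel (Rplus R) -> R)) -> (forall i, blp (g i)) ->
  Ex P (fun w => (\prod_i u i (X i w)) * \prod_i g i (W i w)) =
  Ex P (fun w => \prod_i u i (X i w)) * \prod_i Ex P0 (g i \o W0)).

Context (G : 'I_k -> Rplus R -> cpath R R -> R) (M C : R) (C0 : 0 <= C).
Context (GM : forall i x w, `|G i x w| <= M).
Context (GC : forall i x y w, `|G i x w - G i y w| <= C * `|Rplus_val x - Rplus_val y|).
Context (Gbl : forall i x, blp (G i x)).

(** The conditional mean given the initial position, defined by freezing [x] so that no conditional
    expectation is involved. *)
Definition annealed_noise i (x : Rplus R) : R := Ex P0 (fun w => G i x (W0 w)).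

Let bGW0 i x : bounded_rv (fun w => G i x (W0 w)).
Proof. exact: (bounded_rv_comp mW0 (bl_measurable (metrizes_pdist R) (Gbl i x))). Qed.

Lemma annealed_noise_bounded i x : `|annealed_noise i x| <= M.
Proof. exact: norm_Ex_le. Qed.

Lemma annealed_noise_lip i x y :
  `|annealed_noise i x - annealed_noise i y| <= C * `|Rplus_val x - Rplus_val y|.
Proof. exact: Ex_near. Qed.

Let M0 : 'I_k -> 0 <= M.
Proof. by move=> i; apply: le_trans (GM i (Rplus0 R) (const_path R 0)). Qed.

(** The rounded position may be negative near 0; [pos_part] brings it back without increasing the
    distance to [x]. *)
Let q m (x : Rplus R) : Rplus R := pos_part (qpt R (qidx m (Rplus_val x))).

Let q_cvg x : `|Rplus_val (q m x) - Rplus_val x| @[m --> \oo] --> (0 : R).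
Proof.
apply/cvgrPdist_le => e e0.
have /cvgrPdist_le/(_ e e0) := @qpt_cvg R (Rplus_val x); apply: filterS => m.
rewrite sub0r normrN normr_id distrC; apply: le_trans.
have -> : Rplus_val (q m x) = Num.max 0 (qpt R (qidx m (Rplus_val x))) by [].
set z := qpt _ _; have v0 := Rplus_ge0 x; set v := Rplus_val x in v0 *.
rewrite /Num.max; case: ltP => // z0.
by rewrite sub0r normrN (ger0_norm v0) [leRHS]distrC; apply: le_trans (ler_norm _); lra.
Qed.

Let lip_cvg (h : Rplus R -> R) x : (forall y, `|h y - h x| <= C * `|Rplus_val y - Rplus_val x|) ->
  h (q m x) @[m --> \oo] --> h x.
Proof.
move=> hC; apply/cvgrPdist_le => e e0.
have e1 : 0 < e / (C + 1) by rewrite divr_gt0// ltr_wpDl.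
have /cvgrPdist_le/(_ _ e1) := q_cvg x; apply: filterS => m.
rewrite sub0r normrN normr_id ler_pdivlMr ?ltr_wpDl// => h1.
rewrite distrC; apply: (le_trans (hC _)); apply: le_trans h1.
by rewrite mulrC ler_wpM2l// lerDl.
Qed.

Let ind m (v : 'I_(2 * m.+1 * m.+1).+1) (x : Rplus R) : R :=
  \1_[set u | qidx m u = v] (Rplus_val x).

Let bind m v : bounded_rv (@ind m v : borel (Rplus R) -> R).
Proof.
apply: (@bounded_rv_comp _ (borel (Rplus R)) R _ _ \1_[set u | qidx m u = v] (@Rplus_val R)).
  exact: (continuous_borelR (@Rplus_val_continuous R)).
by apply: bounded_rv_indic; exact: measurable_qidx.
Qed.

Let qE m (h : Rplus R -> R) x : h (q m x) =
  \sum_v ind v x * h (pos_part (@qpt R m v)).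
Proof.
rewrite (bigD1 (qidx m (Rplus_val x)))//= big1 ?addr0.
  by rewrite /ind indicE mem_set//= mul1r.
move=> v vx; rewrite /ind indicE memNset ?mul0r//= => h0.
by move: vx; rewrite h0 eqxx.
Qed.

Let bindX i m v : bounded_rv (fun w => @ind m v (X i w)).
Proof. exact: (bounded_rv_comp (mX i) (bind v)). Qed.

Let bGW i x : bounded_rv (fun w => G i x (W i w)).
Proof. exact: (bounded_rv_comp (mW i) (bl_measurable (metrizes_pdist R) (Gbl i x))). Qed.

Let bGq i m : bounded_rv (fun w => G i (q m (X i w)) (W i w)).
Proof.
under eq_fun => w do rewrite (qE _ (fun x => G i x (W i w))).
by apply: bounded_rv_sum => v; exact: bounded_rvM.
Qed.

Lemma bounded_rv_initial_noise i : bounded_rv (fun w => G i (X i w) (W i w)).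
Proof.
apply: (@bounded_rv_cvg _ _ _ (fun m w => G i (q m (X i w)) (W i w)) _ M) => //.
- by move=> m; have [] := bGq i m.
- by move=> w; apply: (@lip_cvg (fun x => G i x (W i w))) => y; exact: GC.
Qed.

Let bh i : bounded_rv (annealed_noise i : borel (Rplus R) -> R).
Proof.
apply: (@bounded_rv_cvg _ (borel (Rplus R)) _ (fun m x => annealed_noise i (q m x)) _ M) => //.
- move=> m; under eq_fun => x do rewrite (qE _ (annealed_noise i)).
  suff [] : bounded_rv (fun x : borel (Rplus R) =>
      \sum_v @ind m v x * annealed_noise i (pos_part (qpt R v))) by [].
  by apply: bounded_rv_sum => v; apply: bounded_rvM => //; exact: bounded_rv_cst.
- by move=> m x; exact: annealed_noise_bounded.
- by move=> x; apply: lip_cvg => y; exact: annealed_noise_lip.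
Qed.

(** A Fubini formula. For initial positions rounded to a grid, the integrand is a finite sum of a
    function of the positions times a product of functions of the noises, and [XW] applies to each
    term. The Lipschitz dependence on the position lets the mesh tend to 0 on both sides. *)
Lemma Ex_initial_noise :
  Ex P (fun w => \prod_i G i (X i w) (W i w)) =
  Ex P (fun w => \prod_i annealed_noise i (X i w)).
Proof.
have bhX i m : bounded_rv (fun w => annealed_noise i (q m (X i w))).
  under eq_fun => w do rewrite (qE _ (annealed_noise i)).
  by apply: bounded_rv_sum => v; apply: bounded_rvM => //; exact: bounded_rv_cst.
have pc (F : nat -> 'I_k -> R) (F' : 'I_k -> R) : (forall i, F n i @[n --> \oo] --> F' i) ->
    \prod_i F n i @[n --> \oo] --> \prod_i F' i.
  by move=> FF'; apply: (cvg_big mul_continuous) => i _; exact: FF'.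
have pM (F : 'I_k -> R) : (forall i, `|F i| <= M) -> `|\prod_i F i| <= Num.max 1 M ^+ size
  (index_enum 'I_k).
  move=> FM; apply: prod_norm_le; first by rewrite le_max ler01.
  by move=> i; rewrite le_max FM orbT.
have h1 : Ex P (fun w => \prod_i G i (q m (X i w)) (W i w)) @[m --> \oo] -->
    Ex P (fun w => \prod_i G i (X i w) (W i w)).
  apply: (@Ex_cvg _ _ _ _ _ _ (Num.max 1 M ^+ size (index_enum 'I_k))).
  - by move=> m; have [] := bounded_rv_prod (index_enum 'I_k) xpredT (fun i => bGq i m).
  - by move=> m w; apply: pM => i.
  - by move=> w; apply: pc => i; apply: (@lip_cvg (fun x => G i x (W i w))) => y; exact: GC.
have h2 : Ex P (fun w => \prod_i annealed_noise i (q m (X i w))) @[m --> \oo] -->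
    Ex P (fun w => \prod_i annealed_noise i (X i w)).
  apply: (@Ex_cvg _ _ _ _ _ _ (Num.max 1 M ^+ size (index_enum 'I_k))).
  - by move=> m; have [] := bounded_rv_prod (index_enum 'I_k) xpredT (fun i => bhX i m).
  - by move=> m w; apply: pM => i; exact: annealed_noise_bounded.
  - by move=> w; apply: pc => i; apply: lip_cvg => y; exact: annealed_noise_lip.
apply: (@cvg_seq_eq R (fun m => Ex P (fun w => \prod_i G i (q m (X i w)) (W i w)))
  (fun m => Ex P (fun w => \prod_i annealed_noise i (q m (X i w)))) _ _ h1 h2) => m.
(* Expanding the product over particles of sums over grid points gives a sum over all assignments of
   a grid point to each particle. *)
have distr (F : 'I_k -> Rplus R -> T -> R) : (fun w => \prod_i F i (q m (X i w)) w) =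
   fun w => \sum_(f : {ffun 'I_k -> 'I_(2 * m.+1 * m.+1).+1})
     (\prod_i @ind m (f i) (X i w)) * \prod_i F i (pos_part (@qpt R m (f i))) w.
  apply/funext => w.
  under eq_bigr => i _ do rewrite (qE _ (fun x => F i x w)).
  rewrite bigA_distr_bigA; apply: eq_bigr => f _.
  by rewrite big_split.
rewrite (distr (fun i x w => G i x (W i w))) (distr (fun i x _ => annealed_noise i x)).
have b1 (f : {ffun 'I_k -> 'I_(2 * m.+1 * m.+1).+1}) :
    bounded_rv (fun w => \prod_i @ind m (f i) (X i w)) by exact: bounded_rv_prod.
rewrite Ex_sum; last by move=> f; apply: bounded_rvM => //; exact: bounded_rv_prod.
rewrite Ex_sum; last by move=> f; apply: bounded_rvM => //; exact: bounded_rv_cst.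
apply: eq_bigr => f _.
rewrite (@XW (fun i => ind (f i)) (fun i => G i (pos_part (@qpt R m (f i)))))//.
under [in RHS]eq_fun do rewrite mulrC.
by rewrite ExZ// mulrC.
Qed.

End initial_noise.

(** * Chaoticity of the initial positions *)

Section exchangeable_chaos.
Context (R : realType).

Lemma lip_Rplus_continuous (h : Rplus R -> R) (C : R) : 0 <= C ->
  (forall x y, `|h x - h y| <= C * `|Rplus_val x - Rplus_val y|) -> continuous h.
Proof.
move=> C0 hC x; apply/(@cvgrPdist_le _ _ _ _ (nbhs_filter x)) => e e0.
have e1 : 0 < e / (C + 1) by rewrite divr_gt0// ltr_wpDl.
have /(@cvgrPdist_le _ _ _ _ (nbhs_filter x))/(_ _ e1) := @Rplus_val_continuous R x.
apply: filterS => y; rewrite ler_pdivlMr ?ltr_wpDl// => h1.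
apply: (le_trans (hC _ _)); apply: le_trans h1.
by rewrite mulrC ler_wpM2l// lerDl.
Qed.

Lemma Prob_integral_continuous (E : ptopologicalType) (f : bounded_continuous R E) :
  continuous (fun mu : Prob R E => (\int[mu]_x sval f x)%R).
Proof.
have c1 : continuous (@Prob_integrals R E : Prob R E -> _).
  exact: (@initial_continuous _ _ (@Prob_integrals R E)).
move=> mu; have /cvg_sup/(_ f) h := c1 mu.
have h2 := @initial_continuous _ _
  (@proj _ (fun _ : bounded_continuous R E => R) f) (Prob_integrals mu).
have FF : Filter (@Prob_integrals R E x @[x --> mu]).
  by apply: fmap_filter; exact: nbhs_filter.
exact: (cvg_comp _ _ (h FF) h2).
Qed.

Context (mu0 : Prob R (Rplus R)) (nu : forall m : nat, Prob R 'cV[Rplus R]_m.+2).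
Hypothesis nu_exchangeable : forall m, exchangeable (nu m).
Hypothesis nu_marginals : forall m, has_marginals (nu m) mu0.
Hypothesis nu_chaotic : cvg_in_probability (fun m => nu m)
  (fun m x => empirical_measure R (fun i => x i ord0)) mu0.

Lemma measurable_entry m (i : 'I_m.+2) :
  measurable_fun setT ((fun x => x i ord0) : borel 'cV[Rplus R]_m.+2 -> borel (Rplus R)).
Proof. by apply: continuous_borel; exact: mx_entry_continuous. Qed.

Lemma measurable_row_perm m (s : 'S_m.+2) :
  measurable_fun setT (row_perm s : borel 'cV[Rplus R]_m.+2 -> borel 'cV[Rplus R]_m.+2).
Proof.
apply: continuous_borel; apply: mx_continuous => i j.
under eq_fun do rewrite mxE; exact: mx_entry_continuous.
Qed.

Lemma Ex_nu_perm m (s : 'S_m.+2) (F : 'cV[Rplus R]_m.+2 -> R) :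
  bounded_rv (F : borel 'cV[Rplus R]_m.+2 -> R) ->
  Ex (nu m) (fun x => F (row_perm s x)) = Ex (nu m) F.
Proof.
by move=> bF; apply: (Ex_law (measurable_row_perm s) _ bF) => A mA; exact: nu_exchangeable.
Qed.

Lemma Ex_nu_marginal m i (h : Rplus R -> R) : bounded_rv (h : borel (Rplus R) -> R) ->
  Ex (nu m) (fun x => h (x i ord0)) = Ex mu0 h.
Proof.
by move=> bh; apply: (Ex_law (measurable_entry i) _ bh) => A mA; exact: nu_marginals.
Qed.

Section lipschitz.
Context (M C : R) (M1 : 1 <= M) (C0 : 0 <= C).

Definition lip_test (h : Rplus R -> R) := (forall x, `|h x| <= M) /\
  (forall x y, `|h x - h y| <= C * `|Rplus_val x - Rplus_val y|).

Let M0 : 0 <= M. Proof. exact: le_trans ler01 M1. Qed.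

Lemma lip_test_rv h : lip_test h -> bounded_rv (h : borel (Rplus R) -> R).
Proof.
move=> [hM hC]; split; last by exists M.
exact: (continuous_borelR (lip_Rplus_continuous C0 hC)).
Qed.

Let bentry m i h : lip_test h ->
  bounded_rv (fun x : borel 'cV[Rplus R]_m.+2 => h (x i ord0)).
Proof. by move=> lh; exact: (bounded_rv_comp (measurable_entry i) (lip_test_rv lh)). Qed.

Definition emp_dev m h (x : 'cV[Rplus R]_m.+2) : R :=
  m.+2%:R^-1 * \sum_i h (x i ord0) - Ex mu0 h.

Lemma bounded_rv_emp_dev m h : lip_test h ->
  bounded_rv (@emp_dev m h : borel 'cV[Rplus R]_m.+2 -> R).
Proof.
move=> lh; apply: bounded_rvB; last exact: bounded_rv_cst.
by apply: bounded_rvZ; apply: bounded_rv_sum => i; exact: bentry.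
Qed.

Lemma emp_dev_le m h x : lip_test h -> `|@emp_dev m h x| <= 2 * M.
Proof.
move=> lh; rewrite mulrDl mul1r (le_trans (ler_normB _ _))// lerD//.
  rewrite normrM ger0_norm// ler_pdivrMl// (le_trans (ler_norm_sum _ _ _))//.
  rewrite (le_trans (ler_sum _ (fun i _ => lh.1 _)))//.
  by rewrite sumr_const card_ord mulr_natl.
by apply: norm_Ex_le; [exact: lip_test_rv|exact: lh.1].
Qed.

(** The measures that integrate [h] to within e/2 of its mean under [mu0] form a weakly open set, so
    leaving it has vanishing probability; on that event the deviation is still bounded by 2M. *)
Lemma emp_dev_cvg h : lip_test h ->
  Ex (nu m) (fun x => `|@emp_dev m h x|) @[m --> \oo] --> (0 : R).
Proof.
move=> lh; apply/cvgrPdist_le => e e0; have e20 : 0 < e / 2 by rewrite divr_gt0.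
pose f : bounded_continuous R (Rplus R) :=
  exist _ h (conj (lip_Rplus_continuous C0 lh.2) (ex_intro _ M lh.1)).
pose U := [set mu : Prob R (Rplus R) | `|(\int[mu]_x sval f x)%R - Ex mu0 h| < e / 2].
have oU : open U.
  have -> : U = (fun mu : Prob R (Rplus R) => (\int[mu]_x sval f x)%R) @^-1` ball (Ex mu0 h) (e
    / 2).
    by apply/seteqP; split => mu; rewrite /U /= /ball /= distrC.
  by have /continuousP := @Prob_integral_continuous _ f; apply; exact: ball_open.
have Umu : U mu0 by rewrite /U /= subrr normr0.
have := nu_chaotic oU Umu.
(* A bad event of this probability contributes at most e/2 to the mean. *)
have d0 : 0 < e / 2 / (2 * M) by rewrite divr_gt0// mulr_gt0// (lt_le_trans _ M1).
move=> /fine_cvgP[_] /cvgrPdist_le/(_ _ d0); apply: filterS => m.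
rewrite /= sub0r normrN => hm.
set A := _ @^-1` _ in hm.
have AE x : A x <-> e / 2 <= `|@emp_dev m h x|.
  rewrite /A /U /=.
  have /= -> := @Rintegral_empirical R (Rplus R) m.+1 (fun i => x i ord0) f.
  by rewrite -/(emp_dev h x); split => [/negP|] ; rewrite -?leNgt// => h1; apply/negP;
    rewrite -leNgt.
have mA : measurable (A : set (borel 'cV[Rplus R]_m.+2)).
  have [mE _] := bounded_rv_norm (bounded_rv_emp_dev m lh).
  have -> : A = (fun x => `|@emp_dev m h x|) @^-1` `[e / 2, +oo[.
    by apply/seteqP; split => x; rewrite AE /= in_itv/= andbT.
  by rewrite -[X in measurable X]setTI; exact: mE.
rewrite sub0r normrN ger0_norm; last exact: Ex_ge0.
have bE := bounded_rv_norm (bounded_rv_emp_dev m lh).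
have bI : bounded_rv (fun x : borel 'cV[Rplus R]_m.+2 => e / 2 + 2 * M * \1_A x).
  by apply: bounded_rvD; [exact: bounded_rv_cst|apply: bounded_rvZ; exact: bounded_rv_indic].
apply: (@le_trans _ _ (Ex (nu m) (fun x => e / 2 + 2 * M * \1_A x))).
  apply: Ex_le => // x; have [xA|xA] := pselect (A x).
    rewrite indicE mem_set// mulr1 (le_trans (emp_dev_le x lh))// lerDr ltW//.
  rewrite indicE memNset// mulr0 addr0; apply/ltW; rewrite ltNge; apply/negP => h1.
  by apply: xA; apply/AE.
rewrite ExD; [|exact: bounded_rv_cst|by apply: bounded_rvZ; exact: bounded_rv_indic].
rewrite Ex_cst ExZ; last exact: bounded_rv_indic.
rewrite Ex_indicE// [leRHS]splitr lerD2l.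
move: (le_trans (ler_norm _) hm); rewrite ler_pdivlMr;
  last by rewrite mulr_gt0// (lt_le_trans _ M1).
by rewrite mulrC.
Qed.

Lemma cvg_of_bound (u v : nat -> R) (l : R) (K : nat -> R) :
  v m @[m --> \oo] --> l -> K m @[m --> \oo] --> (0 : R) ->
  (\forall m \near \oo, `|u m - v m| <= K m) -> u m @[m --> \oo] --> l.
Proof.
move=> vl K0 uvK.
have -> : u = (fun m => v m + (u m - v m)) by apply/funext => m; rewrite addrC subrK.
rewrite -[X in _ --> X]addr0; apply: cvgD => //.
apply/cvgrPdist_le => e e0; move/cvgrPdist_le : K0 => /(_ _ e0).
apply: filterS2 uvK => m h1; rewrite !sub0r !normrN => h2.
by rewrite (le_trans h1)// (le_trans (ler_norm _)).
Qed.

Lemma inv_cvg0 (c : R) : c / m.+2%:R @[m --> \oo] --> (0 : R).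
Proof.
apply/cvgrPdist_le => e e0; exists (Num.truncn (`|c| / e)) => // m /= hm.
rewrite sub0r normrN normrM [X in _ * X]ger0_norm// ler_pdivrMr// mulrC -ler_pdivrMr//.
rewrite (le_trans (ltW (truncnS_gt _)))// ler_nat; exact: leqW.
Qed.

(** Induction on [k]. By exchangeability the last coordinate may be replaced by any coordinate not
    among the first [k], hence by the average over all coordinates up to an error of order k/n; that
    average is close to a constant in mean, which splits off the last factor. *)
Lemma nu_prod_cvg (h : nat -> Rplus R -> R) k : (forall i, lip_test (h i)) ->
  Ex (nu m) (fun x => \prod_(i < k) h i (x (inord i) ord0)) @[m --> \oo] -->
  \prod_(i < k) Ex mu0 (h i).
Proof.
move=> lh; elim: k => [|k IH].
  under eq_fun => m do under eq_fun do rewrite big_ord0.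
  rewrite big_ord0; under eq_fun do rewrite Ex_cst; exact: cvg_cst.
pose A m (x : 'cV[Rplus R]_m.+2) := \prod_(i < k) h i (x (inord i) ord0).
have bA m : bounded_rv (@A m : borel 'cV[Rplus R]_m.+2 -> R).
  by apply: bounded_rv_prod => i; exact: bentry.
pose Mk := M ^+ size (index_enum 'I_k).
have Mk00 : 0 <= Mk by exact: exprn_ge0.
have AM m x : `|@A m x| <= Mk.
  exact: (@prod_norm_le R 'I_k (index_enum 'I_k) (fun i => h i (x (inord i) ord0)) M M0 (fun i
    => (lh _).1 _)).
pose c := Ex mu0 (h k).
pose B m := Ex (nu m) (fun x => A m x * h k (x (inord k) ord0)).
have BE m : Ex (nu m) (fun x => \prod_(i < k.+1) h i (x (inord i) ord0)) = B m.
  by under eq_fun do rewrite big_ord_recr.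
under eq_fun do rewrite BE.
rewrite big_ord_recr /=.
pose Ej m (j : 'I_m.+2) := Ex (nu m) (fun x => A m x * h k (x j ord0)).
have bj m (j : 'I_m.+2) : bounded_rv (fun x : borel 'cV[Rplus R]_m.+2 => A m x * h k (x j ord0)).
  by apply: bounded_rvM => //; exact: bentry.
(* The transposition of [k] and [j] fixes the first [k] coordinates because j is at least k. *)
have EjB m (j : 'I_m.+2) : (k <= j)%N -> Ej m j = B m.
  move=> kj; have kn : (k < m.+2)%N by exact: leq_ltn_trans (ltn_ord j).
  rewrite /B -(@Ex_nu_perm m (tperm (inord k) j) (fun x => A m x * h k (x (inord k) ord0)))//.
  congr Ex; apply/funext => x; rewrite mxE tpermL; congr (_ * _).
  apply: eq_bigr => i _; rewrite mxE tpermD//.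
    by apply/eqP => /(congr1 val) /=; rewrite !inordK// ?(ltn_trans _ kn)// => /esym ik;
      move: (ltn_ord i); rewrite ik ltnn.
  apply/eqP => /(congr1 val) /=; rewrite inordK ?(ltn_trans _ kn)// => ji.
  by move: kj; rewrite ji leqNgt ltn_ord.
have EjM m (j : 'I_m.+2) : `|Ej m j| <= Mk * M.
  by apply: norm_Ex_le => // x; rewrite normrM ler_pM//; exact: (lh k).1.
have Mk0 : 0 <= Mk * M by rewrite mulr_ge0.
(* The first error is the empirical deviation tested against a factor bounded by [Mk]; the second
   comes from the [k] coordinates already present in the product. *)
have key m : (k < m.+2)%N -> `|B m - Ex (nu m) (@A m) * c| <=
    Mk * Ex (nu m) (fun x => `|@emp_dev m (h k) x|) + (k%:R * (2 * (Mk * M))) / m.+2%:R.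
  move=> km.
  have e1 : Ex (nu m) (fun x => A m x * @emp_dev m (h k) x) =
      m.+2%:R^-1 * \sum_j Ej m j - Ex (nu m) (@A m) * c.
    rewrite -Ex_sum// -ExZ; last exact: bounded_rv_sum.
    rewrite mulrC -ExZ// -ExB; last 2 first.
      by apply: bounded_rvZ; exact: bounded_rv_sum.
      exact: bounded_rvZ.
    congr Ex; apply/funext => x; rewrite /emp_dev mulrBr [X in _ - X]mulrC; congr (_ - _).
    by rewrite mulrCA mulr_sumr.
  have e2 : B m - Ex (nu m) (@A m) * c =
      Ex (nu m) (fun x => A m x * @emp_dev m (h k) x) + m.+2%:R^-1 * \sum_(j < m.+2) (B m - Ej m j).
    rewrite e1 sumrB sumr_const card_ord mulrBr -[B m *+ _]mulr_natl mulrA mulVf// mul1r; ring.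
  rewrite e2 (le_trans (ler_normD _ _))// lerD//.
    rewrite (le_trans (le_norm_Ex _ _))//.
      by apply: bounded_rvM => //; exact: bounded_rv_emp_dev.
    rewrite -ExZ; last by apply: bounded_rv_norm; exact: bounded_rv_emp_dev.
    apply: Ex_le.
    - by apply: bounded_rv_norm; apply: bounded_rvM => //; exact: bounded_rv_emp_dev.
    - by apply: bounded_rvZ; apply: bounded_rv_norm; exact: bounded_rv_emp_dev.
    - by move=> x; rewrite normrM ler_wpM2r.
  rewrite normrM ger0_norm// mulrC ler_wpM2r//.
  rewrite (le_trans (ler_norm_sum _ _ _))//.
  apply: (@le_trans _ _ (\sum_(j < m.+2 | (j < k)%N) 2 * (Mk * M))).
    rewrite [leRHS]big_mkcond/=; apply: ler_sum => j _; case: ltnP => jk.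
      by rewrite (le_trans (ler_normB _ _))// mulrDl mul1r lerD// -(@EjB m (inord k)) ?inordK.
    by rewrite EjB// subrr normr0.
  rewrite -(big_ord_widen m.+2 (fun=> 2 * (Mk * M)) (ltnW km)).
  by rewrite sumr_const card_ord -[leLHS]mulr_natl.
apply: (@cvg_of_bound _ (fun m => Ex (nu m) (@A m) * c) _
  (fun m => Mk * Ex (nu m) (fun x => `|@emp_dev m (h k) x|) + (k%:R * (2 * (Mk * M))) / m.+2%:R)).
- by apply: cvgMr_tmp; exact: IH.
- rewrite -[X in _ --> X]addr0; apply: cvgD; last exact: inv_cvg0.
  by rewrite -[X in _ --> X](mulr0 (Mk)); apply: cvgMl_tmp; exact: emp_dev_cvg.
- by exists k => // m /= km; apply: key; exact: leq_ltn_trans (leqW (leqnn _)).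
Qed.

Lemma exists_perm2 n (i0 j0 i j : 'I_n) : i0 != j0 -> i != j ->
  exists s : 'S_n, s i0 = i /\ s j0 = j.
Proof.
move=> ij0 ij; pose s1 := tperm i0 i; exists (s1 * tperm (s1 j0) j)%g.
have s1i : s1 i0 = i by rewrite /s1 tpermL.
rewrite !permM s1i; split; last by rewrite tpermL.
rewrite tpermD//; last by rewrite eq_sym.
by apply/eqP; rewrite -s1i => /perm_inj/eqP; rewrite eq_sym (negbTE ij0).
Qed.

Lemma nu_pair m (i j : 'I_m.+2) g : lip_test g -> i != j ->
  Ex (nu m) (fun x => g (x i ord0) * g (x j ord0)) =
  Ex (nu m) (fun x => \prod_(l < 2) g (x (inord l) ord0)).
Proof.
move=> lg ij; have ij0 : inord 0 != inord 1 :> 'I_m.+2.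
  by apply/eqP => /(congr1 val); rewrite /= !inordK.
have [s [s0 s1]] := exists_perm2 ij0 ij.
rewrite -(@Ex_nu_perm m s (fun x => \prod_(l < 2) g (x (inord l) ord0))).
  by congr Ex; apply/funext => x; rewrite !big_ord_recl big_ord0 mulr1 !mxE s0 s1.
by apply: bounded_rv_prod => l; exact: bentry.
Qed.

Lemma nu_pair_cvg g : lip_test g -> Ex mu0 g = 0 ->
  Ex (nu m) (fun x => \prod_(l < 2) g (x (inord l) ord0)) @[m --> \oo] --> (0 : R).
Proof.
move=> lg g0; have := @nu_prod_cvg (fun=> g) 2 (fun=> lg).
by rewrite !big_ord_recl g0 mul0r.
Qed.

End lipschitz.

End exchangeable_chaos.

(** * Moments of the copies of the limit *)

Section coupled_copies.
Context (R : realType) (b sigma a : R) (lam : cpath R R).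
Context (mu0 : Prob R (Rplus R)) (nu : forall m : nat, Prob R 'cV[Rplus R]_m.+2).
Hypothesis nu_exchangeable : forall m, exchangeable (nu m).
Hypothesis nu_marginals : forall m, has_marginals (nu m) mu0.
Hypothesis nu_chaotic : cvg_in_probability (fun m => nu m)
  (fun m x => empirical_measure R (fun i => x i ord0)) mu0.
Context (d0 : measure_display) (T0 : measurableType d0) (P0 : probability T0 R).
Context (X0 : T0 -> Rplus R) (W0 : T0 -> cpath R R) (XL : T0 -> cpath R (R * R)%type).
Hypothesis mX0 : measurable_fun setT (X0 : T0 -> borel (Rplus R)).
Hypothesis X0_law : forall A : set (borel (Rplus R)), measurable A -> P0 (X0 @^-1` A) = mu0 A.
Hypothesis BW0 : brownian_motion P0 b sigma W0.
Hypothesis X0W0 : independent_pair P0 (X0 : T0 -> borel (Rplus R)) (W0 : T0 -> borel (cpath R R)).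
Hypothesis mXL : measurable_fun setT (XL : T0 -> borel (cpath R (R * R)%type)).
Hypothesis XLE : {ae P0, forall w t, XL w t = limit_map lam a (X0 w) (W0 w) t}.

Local Notation D2 := (fun x y : cpath R (R * R)%type => pdist2 x y).

Definition lipf (M C : R) (f : cpath R (R * R)%type -> R) :=
  (forall x, `|f x| <= M) /\ (forall x y, `|f x - f y| <= C * pdist2 x y).

Lemma bl_lipf_uniform k (f : 'I_k -> cpath R (R * R)%type -> R) :
  (forall i, bl D2 (f i)) ->
  exists M C, [/\ 1 <= M, 0 <= C & forall i, lipf M C (f i)].
Proof.
move=> bf.
pose Mi i := sval (cid (bf i).1); pose Ci i := s2val (cid2 (bf i).2).
have HM i x : `|f i x| <= Mi i := svalP (cid (bf i).1) x.
have HC0 i : 0 <= Ci i := s2valP (cid2 (bf i).2).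
have HC i x y : `|f i x - f i y| <= Ci i * pdist2 x y := s2valP' (cid2 (bf i).2) x y.
have Mi0 i : 0 <= Mi i by apply: le_trans (HM i point).
exists (1 + \sum_i Mi i), (\sum_i Ci i); split.
- by rewrite lerDl sumr_ge0.
- by rewrite sumr_ge0.
- move=> i; split.
    move=> x; rewrite (le_trans (HM i x))// (bigD1 i)//= addrCA lerDl addr_ge0// sumr_ge0//.
  move=> x y; rewrite (le_trans (HC i x y))// ler_wpM2r ?pdist2_ge0//.
  by rewrite (bigD1 i)//= lerDl sumr_ge0.
Qed.

Definition limit_functional (f : cpath R (R * R)%type -> R) (x : Rplus R) (w : cpath R R) : R :=
  f (limit_map lam a x w).

Lemma limit_functional_bound M C f x w : lipf M C f -> `|limit_functional f x w| <= M.
Proof. by move=> [h _]; exact: h. Qed.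

Lemma limit_functional_init M C f x y w : 0 <= C -> lipf M C f ->
  `|limit_functional f x w - limit_functional f y w| <= C * 3 * `|Rplus_val x - Rplus_val y|.
Proof.
move=> C0 [_ h]; apply: (le_trans (h _ _)); rewrite -mulrA ler_wpM2l//.
exact: limit_map_lip_init.
Qed.

Lemma limit_functional_noise M C f x : 0 <= C -> lipf M C f ->
  bl (fun x y : cpath R R => pdist x y) (limit_functional f x).
Proof.
move=> C0 [h1 h2]; split; first by exists M => w; exact: h1.
exists (C * 3); first by rewrite mulr_ge0.
move=> w w'; apply: (le_trans (h2 _ _)); rewrite -mulrA ler_wpM2l//.
exact: limit_map_lip_noise.
Qed.

Definition mean_functional f (x : Rplus R) : R := Ex P0 (fun w => limit_functional f x (W0 w)).

Let mW0 : measurable_fun setT (W0 : T0 -> borel (cpath R R)). Proof. by case: BW0. Qed.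

Section products.
Context d (T : measurableType d) (P : probability T R) (k : nat).
Context (X : 'I_k -> T -> Rplus R) (W : 'I_k -> T -> cpath R R).
Hypothesis mX : forall i, measurable_fun setT (X i : T -> borel (Rplus R)).
Hypothesis mW : forall i, measurable_fun setT (W i : T -> borel (cpath R R)).
Hypothesis XW : forall (u : 'I_k -> Rplus R -> R) (g : 'I_k -> cpath R R -> R),
  (forall i, bounded_rv (u i : borel (Rplus R) -> R)) ->
  (forall i, bl (fun x y : cpath R R => pdist x y) (g i)) ->
  Ex P (fun w => (\prod_i u i (X i w)) * \prod_i g i (W i w)) =
  Ex P (fun w => \prod_i u i (X i w)) * \prod_i Ex P0 (g i \o W0).
Context (f : 'I_k -> cpath R (R * R)%type -> R) (bf : forall i, bl D2 (f i)).

Lemma bounded_rv_limit_functional i :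
  bounded_rv (fun w => limit_functional (f i) (X i w) (W i w)).
Proof.
have [M [C [M1 C0 lf]]] := bl_lipf_uniform bf.
apply: (@bounded_rv_initial_noise R d T k X W mX mW (fun i => limit_functional (f i)) M (C * 3)).
- by rewrite mulr_ge0.
- by move=> j x w; exact: (limit_functional_bound _ _ (lf j)).
- by move=> j x y w; exact: (limit_functional_init _ _ _ C0 (lf j)).
- by move=> j x; exact: (limit_functional_noise _ C0 (lf j)).
Qed.

Lemma Ex_limit_functional :
  Ex P (fun w => \prod_i limit_functional (f i) (X i w) (W i w)) =
  Ex P (fun w => \prod_i mean_functional (f i) (X i w)).
Proof.
have [M [C [M1 C0 lf]]] := bl_lipf_uniform bf.
apply: (@Ex_initial_noise R d T P d0 T0 P0 W0 k X W mX mW mW0 XW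
  (fun i => limit_functional (f i)) M (C * 3)).
- by rewrite mulr_ge0.
- by move=> j x w; exact: (limit_functional_bound _ _ (lf j)).
- by move=> j x y w; exact: (limit_functional_init _ _ _ C0 (lf j)).
- by move=> j x; exact: (limit_functional_noise _ C0 (lf j)).
Qed.

End products.

Lemma mean_functional_lip M C f : 0 <= C -> lipf M C f ->
  lip_test M (C * 3) (mean_functional f).
Proof.
move=> C0 lf.
have bG x : bounded_rv (fun w => limit_functional f x (W0 w)).
  apply: (bounded_rv_comp mW0); apply: (bl_measurable (metrizes_pdist R)).
  exact: limit_functional_noise lf.
split => [x|x y].
  by apply: norm_Ex_le => // w; exact: limit_functional_bound lf.
by apply: Ex_near => // w; exact: limit_functional_init lf.
Qed.

(** The limit is almost surely [limit_map] of its own data, so this is the product formula for a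
    single particle with [P0] itself as the underlying measure. *)
Lemma Ex_XL f : bl D2 f -> Ex P0 (f \o XL) = Ex mu0 (mean_functional f).
Proof.
move=> bf; pose ff (i : 'I_1) := f.
have bff i : bl D2 (ff i) by [].
have [M [C [M1 C0 lf]]] := bl_lipf_uniform bff.
have bh := lip_test_rv (mulr_ge0 C0 (ler0n _ 3)) (mean_functional_lip C0 (lf ord0)).
pose X (i : 'I_1) := X0; pose W (i : 'I_1) := W0.
have bl1 := @bounded_rv_limit_functional _ _ _ X W (fun _ => mX0) (fun _ => mW0) ff bff ord0.
have -> : Ex P0 (f \o XL) = Ex P0 (fun w => limit_functional f (X0 w) (W0 w)).
  apply: eq_ae_Ex => //.
    exact: (bounded_rv_comp mXL (bl_measurable (metrizes_pdist2 R) bf)).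
  apply: filterS XLE => w XLw; apply/eqP; rewrite -subr_eq0; apply/eqP.
  apply/eqP; rewrite -normr_le0; apply: (le_trans ((lf ord0).2 _ _)).
  rewrite (_ : pdist2 _ _ = 0) ?mulr0//.
  have -> : (XL w : Rplus R -> _) = limit_map lam a (X0 w) (W0 w) by apply/funext.
  by rewrite /pdist2 !pdistxx addr0.
have XW (u : 'I_1 -> Rplus R -> R) (g : 'I_1 -> cpath R R -> R) :
    (forall i, bounded_rv (u i : borel (Rplus R) -> R)) ->
    (forall i, bl (fun x y : cpath R R => pdist x y) (g i)) ->
    Ex P0 (fun w => (\prod_i u i (X i w)) * \prod_i g i (W i w)) =
    Ex P0 (fun w => \prod_i u i (X i w)) * \prod_i Ex P0 (g i \o W0).
  move=> bu bg; under eq_fun do rewrite !big_ord1.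
  under [in RHS]eq_fun do rewrite !big_ord1.
  rewrite big_ord1.
  exact: (Ex_indep_pair mX0 mW0 (bu ord0) (bl_measurable (metrizes_pdist R) (bg ord0)) X0W0).
have := @Ex_limit_functional _ _ P0 _ X W (fun _ => mX0) (fun _ => mW0) XW ff bff.
under eq_fun do rewrite big_ord1.
under [in X in _ = X -> _]eq_fun do rewrite big_ord1.
move=> ->.
exact: (Ex_law mX0 X0_law bh).
Qed.

Lemma measurable_hat_coord m :
  measurable_fun setT ((fun w => w m) : hat_space R -> hat_component R m.+2).
Proof.
move=> _ B mB; rewrite setTI; apply: sub_sigma_algebra.
by exists m, B.
Qed.

Lemma measurable_hat_X0 m : measurable_fun setT (@hat_X0 R m).
Proof. exact: (measurableT_comp measurable_fst (@measurable_hat_coord m)). Qed.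

Lemma measurable_path_map (E F : pseudoPMetricType R) (f : E -> F) (cf : continuous f) :
  measurable_fun setT (path_map cf : borel (cpath R E) -> borel (cpath R F)).
Proof. by apply: continuous_borel; exact: path_map_continuous. Qed.

Definition limit_copy m (i : 'I_m.+2) (w : hat_space R) : cpath R (R * R)%type :=
  limit_map lam a (hat_X0 m w i ord0) (path_entry i (hat_W m w)).

Context (P : probability (hat_space R) R).
Hypothesis hat_X0_law : forall m (A : set (borel 'cV[Rplus R]_m.+2)), measurable A ->
  P (@hat_X0 R m @^-1` A) = nu m A.
Hypothesis hat_W_bm : forall m, brownian_motion_n P b sigma (@hat_W R m).
Hypothesis hat_X0W : forall m, independent_pair P (@hat_X0 R m)
  (@hat_W R m : hat_space R -> borel (cpath R 'cV[R]_m.+2)).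

Section fixed_size.
Context (m k : nat) (iota : 'I_k -> 'I_m.+2) (iota_inj : injective iota).

Let X i (w : hat_space R) : Rplus R := hat_X0 m w (iota i) ord0.
Let W i (w : hat_space R) : cpath R R := path_entry (iota i) (hat_W m w).

Let mX i : measurable_fun setT (X i : _ -> borel (Rplus R)).
Proof. exact: (measurableT_comp (measurable_entry (iota i)) (@measurable_hat_X0 m)). Qed.

Let mhW : measurable_fun setT (@hat_W R m : _ -> borel (cpath R 'cV[R]_m.+2)).
Proof. by case: (hat_W_bm m). Qed.

Let mentry i : measurable_fun setT
  ((fun w => path_entry (iota i) w) : borel (cpath R 'cV[R]_m.+2) -> borel (cpath R R)).
Proof. exact: measurable_path_map. Qed.

Let mW i : measurable_fun setT (W i : _ -> borel (cpath R R)).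
Proof. exact: (measurableT_comp (mentry i) mhW). Qed.

Let XW (u : 'I_k -> Rplus R -> R) (g : 'I_k -> cpath R R -> R) :
  (forall i, bounded_rv (u i : borel (Rplus R) -> R)) ->
  (forall i, bl (fun x y : cpath R R => pdist x y) (g i)) ->
  Ex P (fun w => (\prod_i u i (X i w)) * \prod_i g i (W i w)) =
  Ex P (fun w => \prod_i u i (X i w)) * \prod_i Ex P0 (g i \o W0).
Proof.
move=> bu bg.
have bg' i : bounded_rv (g i : borel (cpath R R) -> R).
  exact: (bl_measurable (metrizes_pdist R) (bg i)).
have bF : bounded_rv (fun x : borel 'cV[Rplus R]_m.+2 => \prod_i u i (x (iota i) ord0)).
  by apply: bounded_rv_prod => i; exact: (bounded_rv_comp (measurable_entry _) (bu i)).
have bGG : bounded_rv (fun x : borel (cpath R 'cV[R]_m.+2) => \prod_i g i (path_entry (iota i) x)).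
  by apply: bounded_rv_prod => i; exact: (bounded_rv_comp (mentry i) (bg' i)).
rewrite (Ex_indep_pair (@measurable_hat_X0 m) mhW bF bGG (@hat_X0W m)); congr (_ * _).
have [_ BWi iW] := hat_W_bm m.
have /= -> := @Ex_indep_family _ _ _ _ _ _ _ _ (fun i w => W i w : borel (cpath R R)) g
  (index_enum 'I_k) (independent_family_inj iota_inj iW) (index_enum_uniq _) (fun _ _ => isT)
  (fun i _ => mW i) bg'.
by apply: eq_bigr => i _; exact: brownian_law (BWi (iota i)) BW0 (bg i).
Qed.

Context (f : 'I_k -> cpath R (R * R)%type -> R) (bf : forall i, bl D2 (f i)).

Lemma bounded_rv_limit_copy i : bounded_rv (fun w => f i (limit_copy (iota i) w)).
Proof. exact: (@bounded_rv_limit_functional _ _ _ X W mX mW f bf i). Qed.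

Lemma Ex_limit_copy :
  Ex P (fun w => \prod_i f i (limit_copy (iota i) w)) =
  Ex (nu m) (fun x => \prod_i mean_functional (f i) (x (iota i) ord0)).
Proof.
rewrite (@Ex_limit_functional _ _ P _ X W mX mW XW f bf).
have [M [C [M1 C0 lf]]] := bl_lipf_uniform bf.
have bF : bounded_rv (fun x : borel 'cV[Rplus R]_m.+2 =>
    \prod_i mean_functional (f i) (x (iota i) ord0)).
  apply: bounded_rv_prod => i; apply: (bounded_rv_comp (measurable_entry _)).
  exact: (lip_test_rv (mulr_ge0 C0 (ler0n _ 3)) (mean_functional_lip C0 (lf i))).
exact: (Ex_law (@measurable_hat_X0 m) (@hat_X0_law m) bF).
Qed.

End fixed_size.

Lemma bounded_rv_copy m (i : 'I_m.+2) f : bl D2 f ->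
  bounded_rv (fun w => f (limit_copy i w)).
Proof.
move=> bf; have inj : injective (fun _ : 'I_1 => i) by move=> x y _; rewrite (ord1 x) (ord1 y).
exact: (@bounded_rv_limit_copy m 1 (fun=> i) (fun=> f) (fun=> bf) ord0).
Qed.

Lemma Ex_copy m (i : 'I_m.+2) f : bl D2 f ->
  Ex P (fun w => f (limit_copy i w)) = Ex P0 (f \o XL).
Proof.
move=> bf; have inj : injective (fun _ : 'I_1 => i) by move=> x y _; rewrite (ord1 x) (ord1 y).
have := @Ex_limit_copy m 1 (fun=> i) inj (fun=> f) (fun=> bf).
under eq_fun do rewrite big_ord1.
under [in X in _ = X -> _]eq_fun do rewrite big_ord1.
move=> ->; rewrite Ex_XL//.
have [M [C [M1 C0 lf]]] := @bl_lipf_uniform 1 (fun=> f) (fun=> bf).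
apply: Ex_nu_marginal => //.
exact: (lip_test_rv (mulr_ge0 C0 (ler0n _ 3)) (mean_functional_lip C0 (lf ord0))).
Qed.

Lemma tagged_copies_cvg k (f : 'I_k -> cpath R (R * R)%type -> R) :
  (forall i, bl D2 (f i)) ->
  Ex P (fun w => \prod_i f i (limit_copy (inord i : 'I_m.+2) w)) @[m --> \oo] -->
  \prod_i Ex P0 (f i \o XL).
Proof.
move=> bf; have [M [C [M1 C0 lf]]] := bl_lipf_uniform bf.
(* The functions are extended by 0 beyond [k], since the factorization for initial positions takes
   functions indexed by all integers. *)
pose h (i : nat) : Rplus R -> R :=
  if insub i is Some j then mean_functional (f j) else fun=> 0.
have C30 : 0 <= C * 3 by rewrite mulr_ge0.
have lh i : lip_test M (C * 3) (h i).
  rewrite /h; case: insubP => [j _ _|_]; first exact: mean_functional_lip.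
  split => [x|x y]; first by rewrite normr0 (le_trans ler01 M1).
  by rewrite subrr normr0 mulr_ge0.
have hE (i : 'I_k) : h i = mean_functional (f i).
  by rewrite /h valK.
have := @nu_prod_cvg R mu0 nu nu_exchangeable nu_chaotic M (C * 3) M1 C30 h k lh.
rewrite [X in _ --> X](eq_bigr (fun i => Ex P0 (f i \o XL))); last first.
  by move=> i _; rewrite hE -Ex_XL.
move=> H; apply: cvg_trans H; apply: near_eq_cvg.
exists k => // m /= km.
have inj : injective (fun i : 'I_k => inord i : 'I_m.+2).
  move=> i j /(congr1 val) /=; rewrite !inordK ?(leq_trans (ltn_ord _)) ?(leq_trans km)//;
    try by rewrite (leq_trans _ (leqnSn _)).
  by move=> /val_inj.
rewrite (@Ex_limit_copy m k _ inj f bf).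
by congr Ex; apply/funext => x; apply: eq_bigr => i _; rewrite hE.
Qed.

(** By exchangeability this is the mixed moment of every pair of distinct copies, whence the absence
    of indices ([Ex_pair]). *)
Definition pair_moment f m : R :=
  Ex (nu m) (fun x => \prod_(l < 2) (mean_functional f (x (inord l) ord0))).

Lemma Ex_pair m (i j : 'I_m.+2) f : bl D2 f -> i != j ->
  Ex P (fun w => f (limit_copy i w) * f (limit_copy j w)) = pair_moment f m.
Proof.
move=> bf ij; pose iota (l : 'I_2) := if l == ord0 then i else j.
have inj : injective iota.
  by move=> x y; rewrite /iota; case: (unliftP ord0 x) => [x' ->|->];
    case: (unliftP ord0 y) => [y' ->|->] //=;
  rewrite ?(ord1 x') ?(ord1 y') //= => e; move: ij; rewrite e eqxx.
have := @Ex_limit_copy m 2 iota inj (fun=> f) (fun=> bf).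
under eq_fun do rewrite !big_ord_recl big_ord0 mulr1 /iota /=.
under [in X in _ = X -> _]eq_fun do rewrite !big_ord_recl big_ord0 mulr1 /iota /=.
move=> ->.
have [M [C [M1 C0 lf]]] := @bl_lipf_uniform 1 (fun=> f) (fun=> bf).
have C30 : 0 <= C * 3 by rewrite mulr_ge0.
exact: (nu_pair nu_exchangeable C30 (mean_functional_lip C0 (lf ord0)) ij).
Qed.

Lemma pair_moment_cvg f : bl D2 f -> Ex P0 (f \o XL) = 0 ->
  pair_moment f m @[m --> \oo] --> (0 : R).
Proof.
move=> bf f0; have [M [C [M1 C0 lf]]] := @bl_lipf_uniform 1 (fun=> f) (fun=> bf).
have C30 : 0 <= C * 3 by rewrite mulr_ge0.
apply: (nu_pair_cvg nu_exchangeable nu_chaotic M1 C30 (mean_functional_lip C0 (lf ord0))).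
by rewrite -Ex_XL.
Qed.

(* Second moments: the weights only enter through [|r j| <= 1]. *)
Lemma weighted_lln f (eta : R) : bl D2 f -> 0 < eta ->
  \forall m \near \oo, forall r : 'I_m.+2 -> R, (forall j, `|r j| <= 1) ->
    Ex P (fun w => `|m.+2%:R^-1 * \sum_j r j * (f (limit_copy j w) - Ex P0 (f \o XL))|) <= eta.
Proof.
move=> bf0 eta0; pose c := Ex P0 (f \o XL); pose f0 x := f x - c.
have bf : bl D2 f0 by apply: blB => //; exact: bl_cst.
have bfXL : bounded_rv (f \o XL).
  exact: (bounded_rv_comp mXL (bl_measurable (metrizes_pdist2 R) bf0)).
have f00 : Ex P0 (f0 \o XL) = 0.
  rewrite -[LHS]/(Ex P0 (fun w => f (XL w) - c)) ExB//; last exact: bounded_rv_cst.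
  by rewrite Ex_cst subrr.
have [[M fM] _] := bf.
have M0 : 0 <= M by apply: le_trans (fM point).
have e1 : 0 < eta ^+ 2 / 2 by rewrite divr_gt0 ?exprn_gt0.
have /cvgrPdist_le/(_ _ e1) H1 := pair_moment_cvg bf f00.
have /cvgrPdist_le/(_ _ e1) H2 := inv_cvg0 (M ^+ 2).
near=> m.
have h1 : `|pair_moment f0 m| <= eta ^+ 2 / 2.
  by near: m; apply: filterS H1 => m; rewrite sub0r normrN.
have h2 : M ^+ 2 / m.+2%:R <= eta ^+ 2 / 2.
  near: m; apply: filterS H2 => m; rewrite sub0r normrN.
  exact: le_trans (ler_norm _).
move=> r r1.
pose n : R := m.+2%:R; have n0 : 0 < n by [].
pose S w := n^-1 * \sum_j r j * f0 (limit_copy j w).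
rewrite -[X in Ex P X <= _]/(fun w => `|S w|).
have bcop (j : 'I_m.+2) : bounded_rv (fun w => f0 (limit_copy j w)) by exact: bounded_rv_copy.
have bS : bounded_rv S.
  by apply: bounded_rvZ; apply: bounded_rv_sum => j; exact: bounded_rvZ.
have S2 : Ex P (fun w => S w * S w) <= eta ^+ 2.
  have -> : (fun w => S w * S w) = (fun w => n^-1 * n^-1 * \sum_i \sum_j
      (r i * r j) * (f0 (limit_copy i w) * f0 (limit_copy j w))).
    apply/funext => w; rewrite /S mulrACA; congr (_ * _).
    rewrite mulr_suml; apply: eq_bigr => i _; rewrite mulr_sumr; apply: eq_bigr => j _.
    by rewrite mulrACA.
  rewrite ExZ; last first.
    by apply: bounded_rv_sum => i; apply: bounded_rv_sum => j; apply: bounded_rvZ;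
      exact: bounded_rvM.
  rewrite Ex_sum; last first.
    by move=> i; apply: bounded_rv_sum => j; apply: bounded_rvZ; exact: bounded_rvM.
  (* Each row of the double sum has one diagonal term, at most M^2, and otherwise terms equal to the
     common pair moment up to a weight in [-1, 1]. After division by n^2 the diagonal contributes
     M^2/n. *)
  have hij i : Ex P (fun w => \sum_j (r i * r j) * (f0 (limit_copy i w) * f0 (limit_copy j w))) <=
      M ^+ 2 + n * `|pair_moment f0 m|.
    rewrite Ex_sum; last by move=> j; apply: bounded_rvZ; exact: bounded_rvM.
    have rr j : `|r i * r j| <= 1 by rewrite normrM -[1]mulr1 ler_pM.
    rewrite (bigD1 i)//= lerD//.
      rewrite ExZ; last exact: bounded_rvM.
      rewrite (le_trans (ler_norm _))// normrM -[leRHS]mul1r ler_pM//.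
      apply: norm_Ex_le; first exact: bounded_rvM.
      by move=> w; rewrite normrM expr2 ler_pM.
    apply: (@le_trans _ _ (\sum_(j < m.+2) `|pair_moment f0 m|)); last first.
      by rewrite sumr_const card_ord -[leLHS]mulr_natl.
    rewrite [leLHS]big_mkcond/=; apply: ler_sum => j _; case: eqP => //= ji.
    rewrite ExZ; last exact: bounded_rvM.
    rewrite Ex_pair//; last by apply/eqP => h; apply: ji.
    by rewrite (le_trans (ler_norm _))// normrM ler_piMl.
  have := ler_sum (index_enum 'I_m.+2) (P := xpredT) (fun i _ => hij i).
  rewrite sumr_const card_ord => h.
  apply: (@le_trans _ _ (M ^+ 2 / n + `|pair_moment f0 m|)).
    apply: (@le_trans _ _ (n^-1 * n^-1 * (n * (M ^+ 2 + n * `|pair_moment f0 m|)))).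
      by rewrite ler_wpM2l ?mulr_ge0 ?invr_ge0 ?(ltW n0)// [leRHS]mulr_natl.
    by rewrite le_eqVlt; apply/orP; left; apply/eqP; field; rewrite gt_eqF.
  by rewrite [leRHS]splitr lerD.
(* AM-GM: [|S| <= (S^2 / eta + eta) / 2] *)
apply: (@le_trans _ _ (Ex P (fun w => (2 * eta)^-1 * (S w * S w) + eta / 2))).
  apply: Ex_le; first exact: bounded_rv_norm.
    by apply: bounded_rvD; [apply: bounded_rvZ; exact: bounded_rvM|exact: bounded_rv_cst].
  move=> w; have -> : S w * S w = `|S w| ^+ 2 by rewrite -expr2 real_normK// num_real.
  set y := `|S w|; rewrite -subr_ge0 (_ : _ - _ = (2 * eta)^-1 * (y - eta) ^+ 2).
    by rewrite mulr_ge0 ?sqr_ge0// invr_ge0 mulr_ge0// ltW.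
  by field; rewrite gt_eqF.
rewrite ExD; [|by apply: bounded_rvZ; exact: bounded_rvM|exact: bounded_rv_cst].
rewrite Ex_cst ExZ; last exact: bounded_rvM.
have : (2 * eta)^-1 * Ex P (fun w => S w * S w) <= (2 * eta)^-1 * eta ^+ 2.
  by rewrite ler_wpM2l// invr_ge0 mulr_ge0// ltW.
have -> : (2 * eta)^-1 * eta ^+ 2 = eta / 2 by field; rewrite gt_eqF.
lra.
Unshelve. all: end_near. Qed.

End coupled_copies.

(** * Row averages of the interaction matrix *)

Section concentration.
Context (R : realType).

(** From 1 + v at most exp v, with v = -(u - 2u^2), and from (1 + u)(1 - u + 2u^2) = 1 + u^2 (1 +
    2u), which is at least 1 as soon as u is at least -1/2. *)
Lemma expR_quadratic (u : R) : `|u| <= 1 / 2 -> expR (u - 2 * u ^+ 2) <= 1 + u.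
Proof.
rewrite ler_norml => /andP[u1 u2].
have h : 1 - u + 2 * u ^+ 2 <= expR (- (u - 2 * u ^+ 2)).
  by have := expR_ge1Dx (- (u - 2 * u ^+ 2)); lra.
have p : 0 < 1 - u + 2 * u ^+ 2 by have := sqr_ge0 u; nra.
rewrite -[u - _]opprK expRN (le_trans (_ : _ <= (1 - u + 2 * u ^+ 2)^-1))//.
  by rewrite lef_pV2 ?posrE ?expR_gt0.
rewrite invf_ple ?posrE//; last by lra.
rewrite -[(1 + u)^-1]mul1r ler_pdivrMr; last by lra.
have := sqr_ge0 u; nra.
Qed.

Section tail.
Context d (T : measurableType d) (Q : probability T R) (I : eqType) (s : seq I).
Context (J : pred I) (X : I -> T -> R) (a : R).
Hypothesis us : uniq s.
Hypothesis sJ : {in s, forall i, J i}.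
Hypothesis iX : independent_family Q J X.
Hypothesis mX : {in s, forall i, measurable_fun setT (X i)}.
Hypothesis X1 : {in s, forall i, forall x, `|X i x| <= 1}.
Hypothesis EX : {in s, forall i, Ex Q (X i) = a}.
Hypothesis a1 : `|a| <= 1.

Lemma clamp_continuous (K : R) : continuous (clamp K).
Proof.
move=> z; apply/cvgrPdist_le => e e0; near=> y.
apply: (le_trans (clamp_lip _ _ _)); near: y.
by have /cvgrPdist_le := @cvg_id _ (nbhs z); exact.
Unshelve. all: end_near. Qed.

(** This product plays the role of an exponential martingale: independence and centring give it mean
    exactly 1, and [expR_quadratic] bounds it below by an exponential. *)
Lemma Ex_martingale (tau : R) :
  Ex Q (fun x => \prod_(i <- s) (1 + tau * (X i x - a))) = 1.
Proof.
(* [clamp 1] is the identity on the values of [X i] and makes [g i] bounded on the whole line. *)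
pose g (i : I) (z : R) := 1 + tau * (clamp 1 z - a).
have bg i : bounded_rv (g i).
  apply: bounded_rvD; first exact: bounded_rv_cst.
  apply: bounded_rvZ; apply: bounded_rvB; last exact: bounded_rv_cst.
  split; first by apply: continuous_measurable_fun; exact: clamp_continuous.
  by exists 1 => z; exact: clamp_bounded.
have gX : {in s, forall i x, g i (X i x) = 1 + tau * (X i x - a)}.
  by move=> i si x; rewrite /g clamp_id ?X1.
have bX : {in s, forall i, bounded_rv (X i)}.
  by move=> i si; split; [exact: mX|exists 1 => x; exact: X1].
rewrite (_ : (fun x => _) = (fun x => \prod_(i <- s) g i (X i x))); last first.
  by apply/funext => x; rewrite big_seq [RHS]big_seq; apply: eq_bigr => i si; rewrite gX.
rewrite (Ex_indep_family iX us sJ mX bg) big_seq big1// => i si.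
rewrite (_ : g i \o X i = fun x => 1 + tau * (X i x - a)); last first.
  by apply/funext => x /=; rewrite gX.
have bXa : bounded_rv (fun x => X i x - a).
  by apply: bounded_rvB; [exact: bX|exact: bounded_rv_cst].
rewrite ExD; [|exact: bounded_rv_cst|exact: bounded_rvZ].
rewrite Ex_cst ExZ// ExB; [|exact: bX|exact: bounded_rv_cst].
by rewrite Ex_cst EX// subrr mulr0 addr0.
Qed.

(** With |tau| = t each increment is at most 2t in absolute value, so the quadratic correction costs
    at most 8 t^2 per summand; the ninth t^2 is what remains in the exponent. The sign of [tau]
    selects the upper or the lower tail. *)
Definition upper_tail (tau t : R) : set T :=
  [set x | 9 * t ^+ 2 * (size s)%:R < \sum_(i <- s) tau * (X i x - a)].

Lemma measurable_upper_tail tau t : measurable (upper_tail tau t).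
Proof.
have mS : measurable_fun setT (fun x => \sum_(i <- s) tau * (X i x - a)).
  rewrite (_ : (fun x => _) = fun x => \sum_(i <- s) (if i \in s then tau * (X i x - a) else 0)).
    apply: measurable_sum => i; case: (boolP (i \in s)) => // si.
    apply: measurable_funM => //; apply: measurable_funB => //; exact: mX.
  by apply/funext => x; rewrite big_seq [RHS]big_seq; apply: eq_bigr => i ->.
rewrite (_ : upper_tail tau t = (fun x => \sum_(i <- s) tau * (X i x - a)) @^-1`
    `]9 * t ^+ 2 * (size s)%:R, +oo[).
  by rewrite -[X in measurable X]setTI; exact: mS.
by apply/seteqP; split => x; rewrite /upper_tail /= in_itv/= andbT.
Qed.

(** Markov's inequality for the mean-one product, which on the tail event is at least exp(t^2 N),
    with N the number of summands. The bound t at most 1/4 keeps the increments within [-1/2, 1/2],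
    the range of [expR_quadratic]. *)
Lemma upper_tail_bound (tau t : R) : `|tau| = t -> t <= 1 / 4 ->
  Ex Q \1_(upper_tail tau t) <= expR (- (t ^+ 2 * (size s)%:R)).
Proof.
move=> tt t4; have t0 : 0 <= t by rewrite -tt.
pose u i x := tau * (X i x - a).
have uM : {in s, forall i x, `|u i x| <= 2 * t}.
  move=> i si x; rewrite /u normrM tt mulrC ler_wpM2r//.
  rewrite (le_trans (ler_normB _ _))//; have := X1 si x; move: a1; lra.
have bprod : bounded_rv (fun x => \prod_(i <- s) (1 + u i x)).
  apply: bounded_rv_prod_seq => i si; apply: bounded_rvD; first exact: bounded_rv_cst.
  split; last by exists (2 * t) => x; exact: uM.
  by apply: measurable_funM => //; apply: measurable_funB => //; exact: mX.
rewrite -[leRHS]mulr1 -[X in _ <= _ * X](Ex_martingale tau) -ExZ//.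
apply: Ex_le; [by apply: bounded_rv_indic;
  exact: measurable_upper_tail|exact: bounded_rvZ|move=> x].
have pos : 0 <= \prod_(i <- s) (1 + u i x).
  by rewrite big_seq prodr_ge0// => i si; have := uM i si x; rewrite ler_norml; lra.
have [xA|xA] := pselect (upper_tail tau t x); last first.
  by rewrite indicE memNset//= mulr_ge0// expR_ge0.
rewrite indicE mem_set//= expRN mulrC -ler_pdivrMr ?invr_gt0 ?expR_gt0// div1r invrK.
apply: (@le_trans _ _ (\prod_(i <- s) expR (u i x - 2 * u i x ^+ 2))).
  rewrite -expR_sum ler_expR sumrB.
  have : \sum_(i <- s) 2 * u i x ^+ 2 <= 8 * t ^+ 2 * (size s)%:R.
    rewrite big_seq (@le_trans _ _ (\sum_(i <- s | i \in s) 8 * t ^+ 2))//.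
      apply: ler_sum => i si.
      have h2 : u i x ^+ 2 <= (2 * t) ^+ 2.
        by rewrite -[u i x ^+ 2]real_normK ?num_real// ler_pXn2r ?nnegrE ?mulr_ge0// uM.
      by have -> : 8 * t ^+ 2 = 2 * (2 * t) ^+ 2 by [ring]; rewrite ler_wpM2l.
    by rewrite -big_seq big_const_seq count_predT iter_addr_0 mulr_natr.
  have : 9 * t ^+ 2 * (size s)%:R < \sum_(i <- s) u i x := xA.
  have -> : 9 * t ^+ 2 * (size s)%:R = 9 * (t ^+ 2 * (size s)%:R) by ring.
  have -> : 8 * t ^+ 2 * (size s)%:R = 8 * (t ^+ 2 * (size s)%:R) by ring.
  move: (t ^+ 2 * (size s)%:R) (\sum_(i <- s) u i x) (\sum_(i <- s) 2 * u i x ^+ 2).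
  by move=> w S1 S2; lra.
rewrite big_seq [leRHS]big_seq; apply: ler_prod => i si.
rewrite expR_ge0/=; apply: expR_quadratic.
by apply: (le_trans (uM i si x)); lra.
Qed.

End tail.

Lemma linear_geometric_summable (c : R) : 0 < c ->
  (\sum_(0 <= m <oo) (2 * m.+2%:R * expR (- (c * m.+1%:R)))%:E < +oo)%E.
Proof.
(* Half of the exponential absorbs the linear factor, by 1 + x at most exp x with x = (c/2)(m+1);
   the other half is geometric with ratio [z]. *)
move=> c0; pose K := 2 * (1 + 2 / c); pose z := expR (- (c / 2)).
have z1 : `|z| < 1 by rewrite ger0_norm ?expR_ge0// expR_lt1 oppr_lt0 divr_gt0.
have K0 : 0 <= K by rewrite mulr_ge0// addr_ge0// divr_ge0// ltW.
have bound m : 2 * m.+2%:R * expR (- (c * m.+1%:R)) <= geometric (K * z) z m.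
  have -> : expR (- (c * m.+1%:R)) = expR (- (c / 2 * m.+1%:R)) * z ^+ m.+1.
    by rewrite /z -expRM_natr -expRD; congr expR; field.
  rewrite /geometric /= -[leRHS]mulrA -exprS mulrA ler_wpM2r ?exprn_ge0 ?expR_ge0//.
  rewrite expRN ler_pdivrMr ?expR_gt0//.
  apply: (@le_trans _ _ (K * (1 + c / 2 * m.+1%:R))); last first.
    by rewrite ler_wpM2l// expR_ge1Dx.
  rewrite /K -mulrA ler_wpM2l//.
  have -> : (1 + 2 / c) * (1 + c / 2 * m.+1%:R) = 1 + c / 2 * m.+1%:R + 2 / c + m.+1%:R.
    by field; rewrite gt_eqF.
  have : 0 <= c / 2 * m.+1%:R by rewrite mulr_ge0// divr_ge0// ltW.
  have : 0 <= 2 / c by rewrite divr_ge0// ltW.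
  by rewrite -(natr1 m.+1); lra.
apply: (@le_lt_trans _ _ (\sum_(0 <= m <oo) (geometric (K * z) z m)%:E)%E).
  apply: lee_nneseries => [m _ _|m _]; rewrite lee_fin; last exact: bound.
  by rewrite mulr_ge0 ?expR_ge0.
have -> : (\sum_(0 <= m <oo) (geometric (K * z) z m)%:E)%E = (K * z * (1 - z)^-1)%:E.
  apply: cvg_lim => //.
  under eq_fun do rewrite sumEFin.
  by apply: cvg_EFin; [exact: nearW|exact: cvg_geometric_series].
exact: ltry.
Qed.

Section rows.
Context d (Xi : measurableType d) (Q : probability Xi R).
Context (rho : forall m : nat, 'I_m.+2 -> 'I_m.+2 -> Xi -> R).
Hypothesis rho_measurable : forall m (i j : 'I_m.+2), i != j ->
  measurable_fun setT (@rho m i j).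
Hypothesis rho1 : forall xi m (i j : 'I_m.+2), i != j -> `|@rho m i j xi| <= 1.
Context (a : R).
Hypothesis rho_mean : forall m (i j : 'I_m.+2), i != j ->
  (\int[Q]_xi (@rho m i j xi)%:E = a%:E)%E.
Hypothesis rho_independent : forall m (i : 'I_m.+2),
  independent_family Q [pred j | j != i] (@rho m i).

(** Each row of m+1 independent entries deviates with probability exponentially small in m, so the
    union bound over the m+2 rows is still summable. The Borel-Cantelli lemma is applied along
    countably many levels. *)
Lemma row_average_concentrates : {ae Q, forall xi, forall e : R, 0 < e ->
  \forall m \near \oo, forall i : 'I_m.+2,
    `|m.+1%:R^-1 * \sum_(j | j != i) @rho m i j xi - a| <= e}.
Proof.
have Erho m (i j : 'I_m.+2) : i != j -> Ex Q (@rho m i j) = a.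
  by move=> ij; rewrite /Ex /Rintegral rho_mean.
have a1 : `|a| <= 1.
  have ij : ord0 != ord_max :> 'I_2 by [].
  rewrite -(Erho 0%N _ _ ij); apply: norm_Ex_le; last by move=> x; exact: rho1.
  by split; [exact: rho_measurable|exists 1 => x; exact: rho1].
pose s m (i : 'I_m.+2) := [seq j <- index_enum 'I_m.+2 | j != i].
have us m i : uniq (@s m i) by rewrite filter_uniq// index_enum_uniq.
have ss m (i : 'I_m.+2) : size (s m i) = m.+1.
  rewrite size_filter -sum1_count sum1_card.
  by rewrite (@eq_card _ _ (predC1 i))// cardC1 card_ord.
have sP m (i j : 'I_m.+2) : j \in s m i -> i != j.
  by rewrite mem_filter => /andP[]; rewrite eq_sym.
pose A m (i : 'I_m.+2) tau t : set Xi := upper_tail (s m i) (@rho m i) a tau t.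
have mA m i tau t : measurable (@A m i tau t).
  by apply: measurable_upper_tail => j /sP ij; exact: rho_measurable.
have QA m i tau t : `|tau| = t -> t <= 1 / 4 ->
    Ex Q \1_(@A m i tau t) <= expR (- (t ^+ 2 * m.+1%:R)).
  move=> h1 h2; rewrite -(ss m i).
  apply: (upper_tail_bound (us m i) _ (rho_independent (i := i))) => //.
  - by move=> j /sP; rewrite eq_sym.
  - by move=> j /sP ij; exact: rho_measurable.
  - by move=> j /sP ij x; exact: rho1.
  - by move=> j /sP; exact: Erho.
(* Failure of at least one row, in either direction: m+2 rows and two signs give the factor 2(m+2)
   in [QB]. *)
pose B t m : set Xi := \bigcup_(i in [set: 'I_m.+2]) (A m i t t `|` A m i (- t) t).
have mB t m : measurable (B t m).
  by apply: fin_bigcup_measurable => // i _; exact: measurableU.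
have QB t m : 0 <= t -> t <= 1 / 4 ->
    (Q (B t m) <= (2 * m.+2%:R * expR (- (t ^+ 2 * m.+1%:R)))%:E)%E.
  move=> t0 t4; rewrite -Ex_indic// lee_fin.
  have bA i tau : bounded_rv (\1_(A m i tau t) : Xi -> R) by exact: bounded_rv_indic.
  apply: (@le_trans _ _ (Ex Q (fun x => \sum_i (\1_(A m i t t) x + \1_(A m i (- t) t) x)))).
    apply: Ex_le; first exact: bounded_rv_indic.
      by apply: bounded_rv_sum => i; exact: bounded_rvD.
    have pos x (i : 'I_m.+2) : 0 <= \1_(A m i t t) x + \1_(A m i (- t) t) x :> R.
      by rewrite addr_ge0// indicE.
    move=> x; have [xB|xB] := pselect (B t m x); last first.
      by rewrite indicE memNset//= sumr_ge0.
    rewrite indicE mem_set//=; have [i _ xi] := xB.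
    rewrite (bigD1 i)//= (@le_trans _ _ (\1_(A m i t t) x + \1_(A m i (- t) t) x))//.
      by rewrite !indicE; case: xi => h; rewrite (mem_set h)//= ?lerDl ?lerDr.
    by rewrite lerDl sumr_ge0.
  rewrite Ex_sum; last by move=> i; exact: bounded_rvD.
  apply: (@le_trans _ _ (\sum_(i < m.+2) 2 * expR (- (t ^+ 2 * m.+1%:R)))).
    apply: ler_sum => i _; rewrite ExD// mulrDl mul1r lerD// QA ?normrN ?ger0_norm//.
  by rewrite sumr_const card_ord -[leLHS]mulr_natr mulrAC.
have key t : 0 < t -> t <= 1 / 4 -> {ae Q, forall xi, ~ lim_sup_set (B t) xi}.
  move=> t0 t4; exists (lim_sup_set (B t)); split.
  - by apply: bigcap_measurable => // n _; apply: bigcup_measurable.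
  - apply: lim_sup_set_cvg0 => //.
    apply: le_lt_trans (linear_geometric_summable (exprn_gt0 2 t0)).
    apply: lee_nneseries => // m _.
    by apply: QB => //; exact: ltW.
  - by move=> xi /= /contrapT.
(* Countably many levels, all at most 1/4 as the tail bound requires, and tending to 0. *)
pose tl (l : nat) : R := l.+4%:R^-1.
have tl0 l : 0 < tl l by rewrite invr_gt0.
have tl4 l : tl l <= 1 / 4 by rewrite div1r lef_pV2 ?posrE// ler_nat.
have : {ae Q, forall xi, forall l, ~ lim_sup_set (B (tl l)) xi}.
  by apply/ae_foralln => l; exact: key.
apply: filterS => xi H e e0.
(* Outside [B t m] the sum satisfies t|S| at most 9 t^2 (m+1), so the row average is within 9t of
   [a]; this [l] makes 9t at most [e]. *)
pose l := Num.truncn (9 / e).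
have tle : 9 * tl l <= e.
  rewrite /tl ler_pdivrMr// mulrC -ler_pdivrMr// (le_trans (ltW (truncnS_gt _)))//.
  by rewrite ler_nat /l !ltnS leqW// leqW// leqW.
move/existsNP : (H l) => [n /not_implyP[_ nB]].
exists n => // m /= nm i.
have nBm : ~ B (tl l) m xi by move=> h; apply: nB; exists m.
have N0 : (0 : R) < m.+1%:R by [].
have t0 := tl0 l.
have bnd tau : (A m i tau (tl l) xi -> False) ->
    tau * (\sum_(j | j != i) @rho m i j xi - m.+1%:R * a) <= 9 * tl l ^+ 2 * m.+1%:R.
  move=> h; rewrite leNgt; apply/negP => h2; apply: h.
  rewrite /A /upper_tail /= ss.
  rewrite -mulr_sumr sumrB big_filter big_const_seq count_predT ss iter_addr_0.
  by rewrite -(mulr_natl a).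
have := bnd (tl l) (fun h => nBm (ex_intro2 _ _ i I (or_introl h))).
have := bnd (- tl l) (fun h => nBm (ex_intro2 _ _ i I (or_intror h))).
set S := \sum_(j | _) _ - _.
have -> : 9 * tl l ^+ 2 * m.+1%:R = tl l * (9 * tl l * m.+1%:R) by ring.
rewrite mulNr -mulrN !ler_pM2l// => h1 h2.
have -> : m.+1%:R^-1 * \sum_(j | j != i) @rho m i j xi - a = S / m.+1%:R.
  by rewrite /S mulrBl [in RHS]mulrC [in X in _ = _ - X]mulrAC divff ?mul1r// gt_eqF.
apply: le_trans tle; rewrite ler_norml ler_pdivlMr// ler_pdivrMr//.
by rewrite mulNr h2 andbT; lra.
Qed.

End rows.
End concentration.

(** * Uniform law of large numbers for local times *)

Section mean_bounds.
Context d (T : measurableType d) (R : realType) (P : probability T R).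

(** Used for a variable [V] that dominates the quantity of interest. [V] may be unbounded, hence the
    integral with extended values instead of [Ex]. *)
Definition mean_le (V : T -> R) (eta : R) := [/\ measurable_fun setT V,
  forall w, 0 <= V w & (\int[P]_w (V w)%:E <= eta%:E)%E].

Lemma mean_leD V V' eta eta' : mean_le V eta -> mean_le V' eta' ->
  mean_le (fun w => V w + V' w) (eta + eta').
Proof.
move=> [mV V0 hV] [mV' V'0 hV']; split; first exact: measurable_funD.
  by move=> w; exact: addr_ge0.
under eq_integral do rewrite EFinD.
rewrite ge0_integralD//; last 4 first.
- by move=> w _; rewrite lee_fin.
- exact/measurable_EFinP.
- by move=> w _; rewrite lee_fin.
- exact/measurable_EFinP.
by rewrite EFinD leeD.
Qed.

Lemma mean_leZ V eta c : 0 <= c -> mean_le V eta -> mean_le (fun w => c * V w) (c * eta).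
Proof.
move=> c0 [mV V0 hV]; split; first exact: measurable_funM.
  by move=> w; exact: mulr_ge0.
under eq_integral do rewrite EFinM.
rewrite ge0_integralZl_EFin//; last 2 first.
- by move=> w _; rewrite lee_fin.
- exact/measurable_EFinP.
by rewrite EFinM lee_wpmul2l// lee_fin.
Qed.

Lemma mean_le_rv V eta : bounded_rv V -> (forall w, 0 <= V w) -> Ex P V <= eta ->
  mean_le V eta.
Proof. by move=> bV V0 h; split => //; [case: bV|rewrite -EFin_Ex// lee_fin]. Qed.

Lemma mean_le_cst c : 0 <= c -> mean_le (fun=> c) c.
Proof.
by move=> c0; apply: mean_le_rv => //; [exact: bounded_rv_cst|rewrite Ex_cst].
Qed.

Lemma mean_le_weaken V eta eta' : eta <= eta' -> mean_le V eta -> mean_le V eta'.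
Proof. by move=> h [mV V0 hV]; split => //; rewrite (le_trans hV)// lee_fin. Qed.

Lemma mean_le_sum I (s : seq I) (V : I -> T -> R) (eta : I -> R) :
  (forall i, mean_le (V i) (eta i)) ->
  mean_le (fun w => \sum_(i <- s) V i w) (\sum_(i <- s) eta i).
Proof.
move=> hV; elim: s => [|i s IH].
  by under eq_fun do rewrite big_nil; rewrite big_nil; exact: mean_le_cst.
by under eq_fun do rewrite big_cons; rewrite big_cons; exact: mean_leD.
Qed.

Section truncation.
Context (Z : T -> R) (Z0 : forall w, 0 <= Z w).
Hypothesis bZ : forall K : nat, bounded_rv (fun w => clamp K%:R (Z w)).

Lemma clamp_min (K : nat) z : 0 <= z -> clamp K%:R z = Num.min z (K%:R : R).
Proof.
move=> z0; rewrite /clamp max_r// le_min; apply/andP; split.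
  by rewrite (le_trans _ z0)// oppr_le0.
by rewrite (@le_trans _ _ 0)// oppr_le0.
Qed.

Lemma clamp_cvg z : 0 <= z -> clamp K%:R z @[K --> \oo] --> (z : R).
Proof.
move=> z0; apply: cvg_near_cst; exists (Num.truncn z).+1 => // K /= hK.
by rewrite clamp_min// min_l// (le_trans (ltW (truncnS_gt _)))// ler_nat.
Qed.

Lemma measurable_truncation : measurable_fun setT Z.
Proof.
apply: (measurable_fun_cvg (h := fun (K : nat) w => clamp K%:R (Z w))).
  by move=> K; case: (bZ K).
by move=> w _; exact: clamp_cvg.
Qed.

Lemma integral_truncation :
  ((Ex P (fun w => clamp K%:R (Z w)))%:E @[K --> \oo] --> \int[P]_w (Z w)%:E)%E.
Proof.
under eq_fun => K do rewrite EFin_Ex//.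
have := @cvg_monotone_convergence _ _ _ P setT measurableT
  (fun (K : nat) w => (clamp K%:R (Z w))%:E).
rewrite (_ : (fun x => limn _) = (fun w => (Z w)%:E)); last first.
  apply/funext => w; apply: cvg_lim => //.
  by apply: cvg_EFin; [exact: nearW|exact: clamp_cvg].
apply.
- by move=> K; apply/measurable_EFinP; case: (bZ K).
- by move=> K w _; rewrite lee_fin clamp_min// le_min Z0/=.
- move=> w _ K K' KK'; rewrite lee_fin !clamp_min// le_min ge_min lexx/=.
  by rewrite ge_min ler_nat KK' orbT.
Qed.

(** The truncated integral is finite, so it can be subtracted. By [integral_truncation] the bound
    tends to 0 with growing [K]: knowing the mean exactly takes the place of a moment bound beyond
    the first. *)
Lemma mean_le_excess lam (K : nat) : (\int[P]_w (Z w)%:E = lam%:E)%E ->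
  mean_le (fun w => Z w - clamp K%:R (Z w)) (lam - Ex P (fun w => clamp K%:R (Z w))).
Proof.
move=> hlam; have [mc _] := bZ K.
have c0 w : 0 <= clamp K%:R (Z w) by rewrite clamp_min// le_min Z0/=.
have e0 w : 0 <= Z w - clamp K%:R (Z w) by rewrite subr_ge0 clamp_min// ge_min lexx.
have me : measurable_fun setT (fun w => Z w - clamp K%:R (Z w)).
  by apply: measurable_funB => //; exact: measurable_truncation.
split => //; rewrite EFinB -hlam EFin_Ex//.
rewrite [X in (_ <= X - _)%E](_ : _ =
   (\int[P]_w (Z w - clamp K%:R (Z w))%:E + \int[P]_w (clamp K%:R (Z w))%:E)%E).
  by rewrite -(EFin_Ex P (bZ K)) addeK.
rewrite -ge0_integralD//; last 4 first.
- by move=> w _; rewrite lee_fin.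
- exact/measurable_EFinP.
- by move=> w _; rewrite lee_fin.
- exact/measurable_EFinP.
by apply: eq_integral => w _; rewrite -EFinD subrK.
Qed.

End truncation.

End mean_bounds.

Section uniform_lln.
Context (R : realType) d (T : measurableType d) (P : probability T R).
Context d0 (T0 : measurableType d0) (P0 : probability T0 R) (XL : T0 -> cpath R (R * R)%type).
Context (Y : forall m, 'I_m.+2 -> T -> cpath R (R * R)%type) (lam : cpath R R).
Local Notation D2 := (fun x y : cpath R (R * R)%type => pdist2 x y).
Hypothesis bY : forall m (i : 'I_m.+2) f, bl D2 f -> bounded_rv (fun w => f (Y i w)).
Hypothesis EY : forall m (i : 'I_m.+2) f, bl D2 f -> Ex P (fun w => f (Y i w)) = Ex P0 (f \o XL).
Hypothesis lln : forall f (eta : R), bl D2 f -> 0 < eta ->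
  \forall m \near \oo, forall r : 'I_m.+2 -> R, (forall j, `|r j| <= 1) ->
    Ex P (fun w => `|m.+2%:R^-1 * \sum_j r j * (f (Y j w) - Ex P0 (f \o XL))|) <= eta.
Hypothesis Y0 : forall m (i : 'I_m.+2) w t, 0 <= (Y i w t).2.
Hypothesis Ymono : forall m (i : 'I_m.+2) w s t, Rplus_val s <= Rplus_val t ->
  (Y i w s).2 <= (Y i w t).2.
Hypothesis lam_mono : forall s t : Rplus R, Rplus_val s <= Rplus_val t -> lam s <= lam t.

Definition local_time (t : Rplus R) (K : nat) (x : cpath R (R * R)%type) : R :=
  clamp K%:R (x t).2.

Hypothesis lamE : forall t, Ex P0 (local_time t K \o XL) @[K --> \oo] --> lam t.

Lemma local_time_bl t K : bl D2 (local_time t K).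
Proof.
split; first by exists K%:R => x; exact: clamp_bounded.
exists ((1 + 2 * K%:R) * (1 + Rplus_val t)).
  by rewrite mulr_ge0// addr_ge0// ?mulr_ge0// Rplus_ge0.
move=> x y; rewrite (le_trans (clamp_eval_lip (snd \o x) (snd \o y) t (ler0n _ K)))//.
rewrite ler_wpM2l ?lerDr ?pdist_ge0// mulr_ge0 ?addr_ge0 ?mulr_ge0 ?Rplus_ge0//.
Qed.

Lemma integral_local_time m (i : 'I_m.+2) t : (\int[P]_w ((Y i w t).2)%:E = (lam t)%:E)%E.
Proof.
have h1 := @integral_truncation _ _ _ P (fun w => (Y i w t).2) (fun w => Y0 i w t)
  (fun K => bY i (local_time_bl t K)).
have h2 : ((Ex P (fun w => clamp K%:R (Y i w t).2))%:E @[K --> \oo] --> (lam t)%:E)%E.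
  apply: cvg_EFin; first exact: nearW.
  apply: cvg_trans (@lamE t); apply: near_eq_cvg; apply: nearW => K.
  by rewrite -(@EY m i _ (local_time_bl t K)).
exact: (cvg_unique _ h1 h2).
Qed.

Definition weighted_dev m (r : 'I_m.+2 -> R) (w : T) (t : Rplus R) : R :=
  m.+2%:R^-1 * \sum_j r j * ((Y j w t).2 - lam t).

(** Each of three errors takes a third of [eta]: the fluctuation of truncated local times, the
    average excess above the truncation, and the mean of that excess. The level [K] depends on [t]
    and [eta] but not on the weights. *)
Lemma weighted_dev_mean t (eta : R) : 0 < eta ->
  \forall m \near \oo, forall r : 'I_m.+2 -> R, (forall j, `|r j| <= 1) ->
    exists2 V, mean_le P V eta & forall w, `|weighted_dev r w t| <= V w.
Proof.
move=> eta0; have e3 : 0 < eta / 3 by rewrite divr_gt0.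
have /cvgrPdist_le/(_ _ e3) [K _ /(_ K (leqnn K)) hK] := @lamE t.
pose c := Ex P0 (local_time t K \o XL).
have := lln (local_time_bl t K) e3; apply: filterS => m H r r1.
have exc (j : 'I_m.+2) := mean_le_excess (fun w => Y0 j w t) (fun K => bY j (local_time_bl t K))
  K (integral_local_time j t).
have cE (j : 'I_m.+2) : Ex P (fun w => clamp K%:R (Y j w t).2) = c.
  exact: (EY j (local_time_bl t K)).
have lc : lam t - c <= eta / 3 by apply: le_trans hK; exact: ler_norm.
have lc0 : 0 <= lam t - c.
  have [_ e0 e1] := exc ord0; move: e1; rewrite cE => e1.
  by rewrite -lee_fin; apply: le_trans e1; apply: integral_ge0 => w _; rewrite lee_fin.
pose V1 w := `|m.+2%:R^-1 * \sum_j r j * (local_time t K (Y j w) - c)|.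
pose V2 w := m.+2%:R^-1 * \sum_(j < m.+2) ((Y j w t).2 - clamp K%:R (Y j w t).2).
exists (fun w => V1 w + (V2 w + (lam t - c))).
  apply: (@mean_le_weaken _ _ _ _ _ (eta / 3 + (eta / 3 + eta / 3))); first by lra.
  apply: mean_leD.
    apply: mean_le_rv; [|by move=> w; exact: normr_ge0|exact: H].
    apply: bounded_rv_norm; apply: bounded_rvZ; apply: bounded_rv_sum => j.
    by apply: bounded_rvZ; apply: bounded_rvB;
      [exact: bY (local_time_bl t K)|exact: bounded_rv_cst].
  apply: mean_leD; last exact: mean_le_weaken lc (mean_le_cst _ lc0).
  apply: (@mean_le_weaken _ _ _ _ _ (m.+2%:R^-1 * \sum_(j < m.+2) (lam t - c))).
    by rewrite sumr_const card_ord -[X in _ * X]mulr_natl mulKf.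
  apply: mean_leZ; first by rewrite invr_ge0.
  by apply: mean_le_sum => j; rewrite -(cE j).
move=> w; rewrite /weighted_dev.
have -> : \sum_j r j * ((Y j w t).2 - lam t) = \sum_j r j * (local_time t K (Y j w) - c) +
   \sum_j r j * (((Y j w t).2 - clamp K%:R (Y j w t).2) - (lam t - c)).
  by rewrite -big_split; apply: eq_bigr => j _; rewrite /local_time /=; ring.
rewrite mulrDr (le_trans (ler_normD _ _))// lerD2l normrM ger0_norm ?invr_ge0//.
have -> : V2 w + (lam t - c) = m.+2%:R^-1 * \sum_(j < m.+2) (((Y j w t).2 - clamp K%:R (Y j w
  t).2) + (lam t - c)).
  by rewrite big_split/= mulrDr sumr_const card_ord -[in RHS](mulr_natl (lam t - c)) mulKf.
rewrite ler_wpM2l ?invr_ge0// (le_trans (ler_norm_sum _ _ _))// ler_sum// => j _.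
rewrite normrM -[leRHS]mul1r ler_pM//.
have e0 : 0 <= (Y j w t).2 - clamp K%:R (Y j w t).2.
  by have [_ e0 _] := exc j; exact: e0.
by rewrite (le_trans (ler_normB _ _))// !ger0_norm.
Qed.

Lemma lam_grid (Tm de : R) : 0 < de -> exists N (t : nat -> Rplus R),
  (forall k, lam (t k.+1) - lam (t k) <= de) /\
  (forall s, Rplus_val s <= Tm -> exists2 k, (k < N)%N &
    Rplus_val (t k) <= Rplus_val s <= Rplus_val (t k.+1)).
Proof.
move=> de0; pose T1 := Num.max Tm 0 + 1.
have [h h0 Hh] := path_unif lam T1 de0.
pose q := Num.truncn h^-1.
have q0 : q.+1%:R^-1 < h.
  by rewrite invf_plt ?posrE//; exact: truncnS_gt.
pose N := (Num.truncn (T1 * q.+1%:R)).+1.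
(* The grid is capped at [T1], so that every step stays in the range where the modulus of continuity
   of [lam] was chosen, whatever the index. *)
pose t k := pos_part (Num.min (k%:R / q.+1%:R) T1).
have T10 : 0 <= T1 by rewrite addr_ge0// le_max lexx orbT.
have tE k : Rplus_val (t k) = Num.min (k%:R / q.+1%:R) T1.
  by rewrite pos_partK// le_min divr_ge0.
exists N, t; split.
  move=> k; apply: (le_trans (ler_norm _)); apply/ltW; apply: Hh.
    by rewrite tE ge_min lexx orbT.
  apply: le_lt_trans q0; rewrite !tE.
  have e : k.+1%:R / q.+1%:R = k%:R / q.+1%:R + q.+1%:R^-1 :> R.
    by rewrite -natr1 mulrDl mul1r.
  have p : (0 : R) < q.+1%:R^-1 by rewrite invr_gt0.
  rewrite e; move: (k%:R / _) => u; move: (_^-1) p => v v0; rewrite ler_norml.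
  by rewrite /Num.min; case: ltP => ?; case: ltP => ?; lra.
move=> s sT; pose k := Num.truncn (Rplus_val s * q.+1%:R).
have s0 := Rplus_ge0 s.
have sT1 : Rplus_val s <= T1 by rewrite /T1; have : Tm <= Num.max Tm 0 by [rewrite le_max lexx];
  lra.
have /andP[k1 k2] := truncn_itv (mulr_ge0 s0 (ler0n R q.+1)).
exists k.
  by rewrite ltnS; apply: le_truncn; rewrite ler_wpM2r.
by rewrite !tE ge_min ler_pdivrMr// k1/= le_min sT1 andbT ler_pdivlMr// ltW.
Qed.

(** Signed weights destroy monotonicity in time, but within a grid step each local time varies by at
    most its increment over the step. The average of these increments is an unweighted deviation
    plus an increment of [lam], so controlling the grid times for the weights [r] and for the
    constant weight 1 suffices. *)
Lemma weighted_dev_uniform (Tm eta : R) : 0 < eta ->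
  \forall m \near \oo, forall r : 'I_m.+2 -> R, (forall j, `|r j| <= 1) ->
    exists2 V, mean_le P V eta &
      forall w s, Rplus_val s <= Tm -> `|weighted_dev r w s| <= V w.
Proof.
move=> eta0; have e4 : 0 < eta / 4 by rewrite divr_gt0.
have aux1 (a1 b1 c1 d1 S : R) : 0 <= b1 -> 0 <= d1 -> 0 <= c1 -> 0 <= S ->
    a1 + b1 + d1 <= a1 + 2 * b1 + (c1 + 2 * d1 + S) by lra.
have aux2 (x y0 y1 D v u0 u1 : R) : x <= v -> `|y0| <= u0 -> `|y1| <= u1 -> D <= eta / 4 ->
    x + (y1 - y0 + D) + D <= v + u0 + u1 + eta / 2.
  by rewrite !ler_norml => ? /andP[? ?] /andP[? ?] ?; lra.
have aux3 (y1 y2 y3 l1 l2 l3 : R) : y1 <= y2 -> y2 <= y3 -> l1 <= l2 -> l2 <= l3 ->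
    `|y2 - y1 - (l2 - l1)| <= y3 - y1 + (l3 - l1).
  by move=> ? ? ? ?; rewrite ler_norml; apply/andP; split; lra.
have [N [t [t1 t2]]] := lam_grid Tm e4.
(* Three such means at each of the N+1 grid times add up to eta/4. *)
have e6 : 0 < eta / 4 / (3 * N.+1%:R) by rewrite divr_gt0// mulr_gt0.
have H : \forall m \near \oo, forall k : 'I_N.+1, forall r : 'I_m.+2 -> R, (forall j, `|r j| <=
  1) ->
    exists2 V, mean_le P V (eta / 4 / (3 * N.+1%:R)) & forall w, `|weighted_dev r w (t k)| <= V w.
  by apply: filter_forall => k; exact: weighted_dev_mean.
apply: filterS H => m H r r1.
have one1 (j : 'I_m.+2) : `|1 : R| <= 1 by rewrite normr1.
(* [V] controls the weighted deviation at grid times, [U] the unweighted one that governs the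
   increments between them. *)
pose V k := s2val (cid2 (H k r r1)); pose U k := s2val (cid2 (H k (fun=> 1) one1)).
have mV k : mean_le P (V k) (eta / 4 / (3 * N.+1%:R)) := s2valP (cid2 (H k r r1)).
have mU k : mean_le P (U k) (eta / 4 / (3 * N.+1%:R)) := s2valP (cid2 (H k (fun=> 1) one1)).
have hV (k : 'I_N.+1) w : `|weighted_dev r w (t k)| <= V k w := s2valP' (cid2 (H k r r1)) w.
have hU (k : 'I_N.+1) w : `|weighted_dev (fun _ : 'I_m.+2 => 1) w (t k)| <= U k w := s2valP'
  (cid2 (H k (fun=> 1) one1)) w.
have V0 k w : 0 <= V k w by case: (mV k).
have U0 k w : 0 <= U k w by case: (mU k).
exists (fun w => \sum_(k < N.+1) (V k w + 2 * U k w) + eta / 2).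
  apply: (@mean_le_weaken _ _ _ _ _ (\sum_(k < N.+1) (eta / 4 / (3 * N.+1%:R) + 2 * (eta / 4 /
    (3 * N.+1%:R))) + eta / 2)).
    rewrite sumr_const card_ord -[X in X + _ <= _]mulr_natl.
    have -> : N.+1%:R * (eta / 4 / (3 * N.+1%:R) + 2 * (eta / 4 / (3 * N.+1%:R))) = eta / 4.
      have n0 : N.+1%:R != 0 :> R by rewrite pnatr_eq0.
      by move: (N.+1%:R) n0 => n n0; field.
    have -> : eta / 4 + eta / 2 = eta * (3 / 4) by field.
    by rewrite ler_piMr ?(ltW eta0)// ler_pdivrMr// mul1r ler_nat.
  apply: mean_leD; last by apply: mean_le_cst; rewrite divr_ge0 ?(ltW eta0).
  by apply: mean_le_sum => k; apply: mean_leD => //; apply: mean_leZ.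
move=> w s sT; have [k kN /andP[ks sk]] := t2 s sT.
pose k0 : 'I_N.+1 := Ordinal (ltnW kN : (k < N.+1)%N).
pose k1 : 'I_N.+1 := Ordinal (kN : (k.+1 < N.+1)%N).
have k01 : k1 != k0 by apply/eqP => /(congr1 val) /= /eqP;
  rewrite -[X in _ == X]addn0 -addn1 eqn_add2l.
apply: (@le_trans _ _ (V k0 w + U k0 w + U k1 w + eta / 2)); last first.
  rewrite (bigD1 k0)//= (bigD1 k1)//= lerD2r.
  have : 0 <= \sum_(i < N.+1 | (i != k0) && (i != k1)) (V i w + 2 * U i w).
    by rewrite sumr_ge0// => i _; rewrite addr_ge0// mulr_ge0.
  exact: aux1.
have n0 : (0 : R) < m.+2%:R by [].
pose incr := m.+2%:R^-1 * \sum_(j < m.+2) ((Y j w (t k.+1)).2 - (Y j w (t k)).2).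
have incrE : incr = weighted_dev (fun _ : 'I_m.+2 => 1) w (t k.+1) -
    weighted_dev (fun _ : 'I_m.+2 => 1) w (t k) + (lam (t k.+1) - lam (t k)).
  rewrite /incr /weighted_dev -mulrBr -sumrB.
  rewrite [X in _ = _ + X](_ : _ = m.+2%:R^-1 * \sum_(j < m.+2) (lam (t k.+1) - lam (t k))).
    by rewrite -mulrDr -big_split; congr (_ * _); apply: eq_bigr => j _ /=; ring.
  by rewrite sumr_const card_ord -[X in _ * X]mulr_natl mulKf.
have step : `|weighted_dev r w s| <= `|weighted_dev r w (t k)| + incr + (lam (t k.+1) - lam (t k)).
  have -> : weighted_dev r w s = weighted_dev r w (t k) +
     m.+2%:R^-1 * \sum_j r j * (((Y j w s).2 - (Y j w (t k)).2) - (lam s - lam (t k))).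
    rewrite /weighted_dev -mulrDr -big_split; congr (_ * _).
    by apply: eq_bigr => j _ /=; ring.
  rewrite (le_trans (ler_normD _ _))// -addrA lerD2l normrM ger0_norm ?invr_ge0//.
  have -> : incr + (lam (t k.+1) - lam (t k)) = m.+2%:R^-1 *
      \sum_(j < m.+2) (((Y j w (t k.+1)).2 - (Y j w (t k)).2) + (lam (t k.+1) - lam (t k))).
    by rewrite /incr [in RHS]big_split/= mulrDr sumr_const card_ord -[in RHS](mulr_natl (lam _ -
      lam _)) mulKf.
  rewrite ler_wpM2l ?invr_ge0// (le_trans (ler_norm_sum _ _ _))// ler_sum// => j _.
  rewrite normrM -[leRHS]mul1r ler_pM//.
  exact: (aux3 _ _ _ _ _ _ (Ymono j w ks) (Ymono j w sk) (lam_mono ks) (lam_mono sk)).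
apply: (le_trans step); rewrite incrE.
exact: (aux2 _ _ _ _ _ _ _ (hV k0 w) (hU k0 w) (hU k1 w) (t1 k)).
Qed.

End uniform_lln.

(** * Coupling *)

Section coupling.
Context (R : realType) (lam : cpath R R) (a : R).

Lemma path_sub_continuous (x y : cpath R R) : continuous (fun t => x t - y t).
Proof. by move=> t; apply: (@cvgB _ _ _ _ (nbhs_filter t)); exact: cts_fun. Qed.

Definition path_sub (x y : cpath R R) : cpath R R := mkpath (@path_sub_continuous x y).

Lemma path_sup (x y : cpath R R) T : 0 <= T -> exists D : R,
  (forall s, Rplus_val s <= T -> `|x s - y s| <= D) /\
  (forall C, (forall s, Rplus_val s <= T -> `|x s - y s| <= C) -> D <= C).
Proof.
move=> T0; pose A := [set `|x s - y s| | s in [set s | Rplus_val s <= T]].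
have nA : A !=set0.
  by exists `|x (Rplus0 R) - y (Rplus0 R)|, (Rplus0 R).
exists (sup A); split.
  move=> s sT; apply: sup_upper_bound; last by exists s.
  split=> //; have [M hM] := path_bounded (path_sub x y) T.
  by exists M => _ [u /= uT <-]; exact: hM.
by move=> C H; apply: ge_sup => // _ [s /= sT <-]; exact: H.
Qed.

Lemma reflection_entry m (w : Rplus R -> 'cV[R]_m.+2) (rho : 'I_m.+2 -> 'I_m.+2 -> R)
    (x l : cpath R 'cV[R]_m.+2) i t :
  reflection_map w (reflection_matrix rho) x l ->
  x t i ord0 = w t i ord0 + l t i ord0 + m.+1%:R^-1 * \sum_(j | j != i) rho i j * l t j ord0.
Proof.
move=> [H _]; rewrite H !mxE (bigD1 i)//= !mxE eqxx mul1r addrA; congr (_ + _).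
rewrite mulr_sumr; apply: eq_bigr => j ji; rewrite !mxE eq_sym (negbTE ji).
by rewrite /= mulrAC mulrC.
Qed.

Lemma sum_others n (D : 'I_n.+2 -> R) :
  \sum_i \sum_(j | j != i) D j = n.+1%:R * \sum_j D j.
Proof.
have e i : \sum_(j | j != i) D j = \sum_j D j - D i.
  by rewrite [X in _ = X - _](bigD1 i)//= addrAC subrr add0r.
under eq_bigr do rewrite e.
by rewrite sumrB sumr_const card_ord -[X in X - _]mulr_natl -(natr1 n.+1) mulrDl mul1r addrK.
Qed.

(** A deterministic estimate, path by path. Summing D_i at most B_i over i gives eps times the sum
    of the D_i at most the sum of the e_i, because each D_j occurs in the n-1 other rows. Fed back
    into B_i, with 1/(n-1) at most 2/n, this yields the constant 2/eps. The position is a free part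
    plus a local time, both within B_i of their counterparts, hence the additional factor 2. *)
Lemma coupling_bound m (z0 : 'cV[Rplus R]_m.+2) (ww x l : cpath R 'cV[R]_m.+2)
    (rho : 'I_m.+2 -> 'I_m.+2 -> R) (eps T : R) (e : 'I_m.+2 -> R) :
  0 < eps -> (forall i j, i != j -> `|rho i j| <= 1 - eps) -> 0 <= T ->
  reflection_map (fun t => map_mx (@Rplus_val R) z0 + ww t) (reflection_matrix rho) x l ->
  (forall i s, Rplus_val s <= T ->
    `|m.+1%:R^-1 * \sum_(j | j != i) rho i j * (limit_map lam a (z0 j ord0) (path_entry j ww) s).2
      - a * lam s| <= e i) ->
  forall i s, Rplus_val s <= T ->
    `|x s i ord0 - (limit_map lam a (z0 i ord0) (path_entry i ww) s).1| <=
      2 * (e i + 2 / eps * (m.+2%:R^-1 * \sum_j e j)) /\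
    `|l s i ord0 - (limit_map lam a (z0 i ord0) (path_entry i ww) s).2| <=
      e i + 2 / eps * (m.+2%:R^-1 * \sum_j e j).
Proof.
have aux (B E u v : R) : B <= E -> `|u| <= B -> `|v| <= B -> `|u + v| <= 2 * E.
  by rewrite !ler_norml => ? /andP[? ?] /andP[? ?]; apply/andP; split; lra.
move=> eps0 rho_le T0 refl err.
pose X i := path_entry i x; pose L i := path_entry i l.
pose fr i := free_path lam a (z0 i ord0) (path_entry i ww).
pose Lb i := regulator_path (fr i).
have n1 : (0 : R) < m.+1%:R by [].
have n2 : (0 : R) < m.+2%:R by [].
have e0 i : 0 <= e i by apply: le_trans (err i (Rplus0 R) _).
have eps1 : 0 <= 1 - eps.
  by apply: le_trans (rho_le ord0 ord_max _).
have Lreg i t : L i t = regulator (path_sub (X i) (L i)) t.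
  have [_ /(_ i) comp] := refl.
  by apply: (complementary_regulator comp) => s; rewrite /= subrK.
have [D hD] := choice (fun i => path_sup (L i) (Lb i) T0).
have D1 i s : Rplus_val s <= T -> `|L i s - Lb i s| <= D i := (hD i).1 s.
have D0 i : 0 <= D i by apply: le_trans (D1 i (Rplus0 R) _).
have D2 i C : (forall s, Rplus_val s <= T -> `|L i s - Lb i s| <= C) -> D i <= C := (hD i).2 C.
pose B i := m.+1%:R^-1 * \sum_(j | j != i) (1 - eps) * D j + e i.
(* The free parts differ by the interaction with the differences of local times, plus the error made
   when the copies' local times replace [a * lam]. *)
have free_err i s : Rplus_val s <= T -> `|path_sub (X i) (L i) s - fr i s| <= B i.
  move=> sT.
  have -> : path_sub (X i) (L i) s - fr i s =
     m.+1%:R^-1 * \sum_(j | j != i) rho i j * (L j s - Lb j s) +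
     (m.+1%:R^-1 * \sum_(j | j != i) rho i j * Lb j s - a * lam s).
    rewrite addrA -mulrDr -big_split/=.
    have -> : \sum_(j | j != i) (rho i j * (L j s - Lb j s) + rho i j * Lb j s) =
       \sum_(j | j != i) rho i j * l s j ord0.
      by apply: eq_bigr => j _; rewrite -mulrDr subrK.
    have -> : path_sub (X i) (L i) s = x s i ord0 - l s i ord0 by [].
    have -> : fr i s = Rplus_val (z0 i ord0) + ww s i ord0 + a * lam s by [].
    by rewrite (reflection_entry i s refl) !mxE; ring.
  rewrite (le_trans (ler_normD _ _))// lerD//; last exact: err.
  rewrite normrM ger0_norm ?invr_ge0// ler_wpM2l ?invr_ge0//.
  rewrite (le_trans (ler_norm_sum _ _ _))// ler_sum// => j ji.
  by rewrite normrM ler_pM// ?rho_le ?D1// eq_sym.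
have DB i : D i <= B i.
  apply: D2 => s sT; rewrite Lreg; apply: regulator_lip => u us.
  exact: free_err (le_trans us sT).
have sumD : eps * \sum_i D i <= \sum_i e i.
  have : \sum_i D i <= \sum_i B i by apply: ler_sum => i _.
  rewrite /B big_split/= -mulr_sumr.
  under [X in _ <= _ * X + _]eq_bigr do rewrite -mulr_sumr.
  rewrite -mulr_sumr sum_others mulrCA mulKf ?gt_eqF// mulrBl mul1r; lra.
have Bi i : B i <= e i + 2 / eps * (m.+2%:R^-1 * \sum_j e j).
  rewrite /B addrC lerD2l -mulr_sumr.
  have h1 : \sum_(j | j != i) D j <= \sum_j D j.
    by rewrite [leRHS](bigD1 i)//= lerDr.
  have h2 : \sum_j D j <= eps^-1 * \sum_j e j by rewrite ler_pdivlMl.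
  have s0 : 0 <= \sum_j e j by rewrite sumr_ge0.
  have s1 : 0 <= \sum_(j | j != i) D j by rewrite sumr_ge0.
  apply: (@le_trans _ _ (m.+1%:R^-1 * (eps^-1 * \sum_j e j))).
    rewrite ler_wpM2l ?invr_ge0// (le_trans _ h2)// (le_trans _ h1)//.
    by rewrite ler_piMl//; lra.
  have -> : 2 / eps * (m.+2%:R^-1 * \sum_j e j) = (2 / m.+2%:R) * (eps^-1 * \sum_j e j) by ring.
  rewrite ler_wpM2r ?mulr_ge0 ?invr_ge0 ?(ltW eps0)//.
  by rewrite ler_pdivlMr// mulrC ler_pdivrMr// -natrM ler_nat mulSn mul1n addSn ltnS leq_addl.
move=> i s sT.
have h : `|path_sub (X i) (L i) s - fr i s| <= B i by exact: free_err.
have h2 : `|L i s - Lb i s| <= B i by exact: le_trans (D1 i s sT) (DB i).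
split; last exact: le_trans h2 (Bi i).
have -> : x s i ord0 - (limit_map lam a (z0 i ord0) (path_entry i ww) s).1 =
    (path_sub (X i) (L i) s - fr i s) + (L i s - Lb i s).
  have -> : path_sub (X i) (L i) s = x s i ord0 - L i s by [].
  have -> : (limit_map lam a (z0 i ord0) (path_entry i ww) s).1 = fr i s + Lb i s by [].
  by ring.
exact: aux (Bi i) h h2.
Qed.

Context (P : probability (hat_space R) R).
Context (rho : forall m, 'I_m.+2 -> 'I_m.+2 -> R) (eps : R).
Hypothesis eps0 : 0 < eps.
Hypothesis rho_le : forall m (i j : 'I_m.+2), i != j -> `|rho i j| <= 1 - eps.
Hypothesis rho_avg : forall e : R, 0 < e -> \forall m \near \oo, forall i : 'I_m.+2,
  `|m.+1%:R^-1 * \sum_(j | j != i) rho i j - a| <= e.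
Hypothesis refl : forall m, {ae P, forall w, reflection_map
  (fun t => map_mx (@Rplus_val R) (hat_X0 m w) + hat_W m w t)
  (reflection_matrix (@rho m)) (hat_X m w) (hat_L m w)}.
Hypothesis dev : forall Tm eta : R, 0 < eta ->
  \forall m \near \oo, forall r : 'I_m.+2 -> R, (forall j, `|r j| <= 1) ->
    exists2 V, mean_le P V eta & forall w s, Rplus_val s <= Tm ->
      `|weighted_dev (fun m => @limit_copy R a lam m) lam r w s| <= V w.

Lemma coupling_sup (T eta : R) : 0 <= T -> 0 < eta ->
  \forall m \near \oo, forall i : 'I_m.+2,
  exists2 V, mean_le P V eta &
    {ae P, forall w, forall s, Rplus_val s <= T ->
      `|(hat_XL w i s).1 - (limit_copy a lam i w s).1| <= 2 * V w /\
      `|(hat_XL w i s).2 - (limit_copy a lam i w s).2| <= V w}.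
Proof.
move=> T0 eta0.
have aux1 (e' b' : R) : e' + b' * e' = e' * (1 + b') by ring.
have [La hLa] := path_bounded lam T.
have La0 : 0 <= La by apply: le_trans (hLa (Rplus0 R) _).
have c0 : 0 < 1 + 2 / eps by rewrite addr_gt0// divr_gt0.
(* Errors e_i of mean [ka] give the final bound the mean ka(1 + 2/eps) = eta. *)
pose ka := eta / (1 + 2 / eps).
have ka0 : 0 < ka by rewrite divr_gt0.
have ka4 : 0 < ka / 4 by rewrite divr_gt0.
have la1 : 0 < La + 1 by rewrite ltr_wpDl.
(* Row averages this close to [a] contribute at most ka/2, as [lam] is bounded by [La] on [0, T]. *)
have de0 : 0 < ka / 2 / (La + 1) by rewrite divr_gt0// divr_gt0.
have H1 := dev T ka4; have H2 := rho_avg de0.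
apply: filterS2 H1 H2 => m H1 H2.
(* Setting the diagonal to 0 turns the row sum into a weighted sum over all copies. The change of
   normalization costs (m+2)/(m+1), at most 2, whence the factor 2 in [e]. *)
pose r (i j : 'I_m.+2) : R := if j == i then 0 else rho i j.
have r1 i j : `|r i j| <= 1.
  rewrite /r; case: eqP => [_|/eqP ji]; first by rewrite normr0.
  by rewrite (le_trans (rho_le _)) 1?eq_sym// gerBl ltW.
pose V i := s2val (cid2 (H1 (r i) (r1 i))).
have mV i : mean_le P (V i) (ka / 4) := s2valP (cid2 (H1 (r i) (r1 i))).
have hV i w s : Rplus_val s <= T ->
    `|weighted_dev (fun m => @limit_copy R a lam m) lam (r i) w s| <= V i w :=
  s2valP' (cid2 (H1 (r i) (r1 i))) w s.
have V0 i w : 0 <= V i w by case: (mV i).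
pose e i w := 2 * V i w + ka / 2.
have me i : mean_le P (e i) ka.
  apply: (@mean_le_weaken _ _ _ _ _ (2 * (ka / 4) + ka / 2)).
    by rewrite le_eqVlt; apply/orP; left; apply/eqP; field.
  apply: mean_leD; first exact: mean_leZ.
  by apply: mean_le_cst; rewrite divr_ge0// ltW.
have err w i s : Rplus_val s <= T ->
    `|m.+1%:R^-1 * \sum_(j | j != i) rho i j *
       (limit_map lam a (hat_X0 m w j ord0) (path_entry j (hat_W m w)) s).2 - a * lam s| <= e i w.
  move=> sT; set S := m.+1%:R^-1 * \sum_(j | j != i) rho i j - a.
  have n1 : m.+1%:R != 0 :> R by rewrite pnatr_eq0.
  have n2 : m.+2%:R != 0 :> R by rewrite pnatr_eq0.
  (* The error splits into the fluctuation of local times about [lam] and the deviation [S] of the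
     row average of the weights. *)
  have -> : m.+1%:R^-1 * \sum_(j | j != i) rho i j *
       (limit_map lam a (hat_X0 m w j ord0) (path_entry j (hat_W m w)) s).2 - a * lam s =
     (m.+2%:R / m.+1%:R) * weighted_dev (fun m => @limit_copy R a lam m) lam (r i) w s + S * lam s.
    have -> : weighted_dev (fun m => @limit_copy R a lam m) lam (r i) w s = m.+2%:R^-1 *
        \sum_(j | j != i) (rho i j * (limit_copy a lam j w s).2 - rho i j * lam s).
      rewrite /weighted_dev (bigD1 i)//= /r eqxx mul0r add0r; congr (_ * _).
      by apply: eq_bigr => j /negbTE ->; rewrite mulrBr.
    rewrite sumrB -mulr_suml /S /limit_copy; move: (\sum_(_ | _) _) (\sum_(_ | _) _) => s1 s2.
    by move: (m.+1%:R) (m.+2%:R) n1 n2 => p q n1 n2; field; rewrite n1 n2.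
  rewrite (le_trans (ler_normD _ _))// lerD//.
    rewrite normrM ger0_norm ?divr_ge0// ler_pM ?divr_ge0//; last exact: hV.
    by rewrite ler_pdivrMr// -natrM ler_nat mulSn mul1n addSn ltnS leq_addl.
  rewrite normrM (@le_trans _ _ (ka / 2 / (La + 1) * La))//.
    by rewrite ler_pM// ?H2 ?hLa.
  by rewrite mulrAC ler_pdivrMr// ler_pM2l ?lerDl// divr_gt0.
move=> i.
exists (fun w => e i w + 2 / eps * (m.+2%:R^-1 * \sum_j e j w)).
  apply: (@mean_le_weaken _ _ _ _ _ (ka + 2 / eps * (m.+2%:R^-1 * \sum_(j < m.+2) ka))).
    rewrite sumr_const card_ord -[X in _^-1 * X]mulr_natl mulKf ?pnatr_eq0//.
    by rewrite aux1 /ka divfK// gt_eqF.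
  apply: mean_leD => //; apply: mean_leZ; first by rewrite divr_ge0// ltW.
  by apply: mean_leZ; [rewrite invr_ge0|exact: mean_le_sum].
apply: filterS (refl m) => w reflw s sT.
exact: (coupling_bound eps0 (@rho_le m) T0 reflw (err w) i sT).
Qed.

Lemma coupling_mean (eta : R) : 0 < eta -> \forall m \near \oo, forall i : 'I_m.+2,
  exists2 V, mean_le P V eta &
    {ae P, forall w, pdist2 (hat_XL w i) (limit_copy a lam i w) <= V w}.
Proof.
have aux (u v : R) : 2 * u + v + (u + v) = 3 * u + 2 * v by ring.
(* Beyond [T] each of the two coordinates costs at most the weight (1 + T)^-1; this choice makes
   both together at most eta/3. *)
move=> eta0; pose T := 6 / eta.
have T0 : 0 <= T by rewrite divr_ge0// ltW.
have e9 : 0 < eta / 9 by rewrite divr_gt0.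
have Teta : 2 * (1 + T)^-1 <= eta / 3.
  have h : 0 < 1 + T by rewrite ltr_pwDl.
  rewrite ler_pdivrMr// mulrDr mulr1 /T.
  have -> : eta / 3 * (6 / eta) = 2 by field; rewrite gt_eqF.
  by rewrite lerDr divr_ge0// ltW.
apply: filterS (coupling_sup T0 e9) => m H i.
have [V mV hV] := H i; exists (fun w => 3 * V w + 2 * (1 + T)^-1).
  apply: (@mean_le_weaken _ _ _ _ _ (3 * (eta / 9) + eta / 3)).
    by rewrite (_ : _ + _ = eta * (2 / 3)) ?ler_piMr ?(ltW eta0) ?ler_pdivrMr ?mul1r ?ler_nat//;
      field.
  apply: mean_leD; first exact: mean_leZ.
  by apply: mean_le_weaken Teta _; apply: mean_le_cst; rewrite mulr_ge0// invr_ge0 addr_ge0.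
have [_ V0 _] := mV; apply: filterS hV => w hw; rewrite -aux lerD//.
  apply: pdist_local => //; first by rewrite mulr_ge0.
  by move=> s sT; have [] := hw s sT.
by apply: pdist_local => // s sT; have [] := hw s sT.
Qed.

End coupling.

(** * Convergence of tagged particles *)

Section portmanteau.
Context (R : realType) (E : ptopologicalType) (D : E -> E -> R) (mD : metrizes D).
Context (e : nat -> E) (de : dense_seq D e).
Context (f : E -> R) (cf : continuous f) (M : R) (fM : forall x, `|f x| <= M).

Lemma infconv_bound j x : `|infconv D e f j x| <= M.
Proof.
rewrite ler_norml; apply/andP; split; last first.
  apply: (le_trans (infconv_le mD de cf fM x j)).
  by have := fM x; rewrite ler_norml => /andP[].
apply: infconv_ge => n; rewrite -[leLHS]addr0 lerD//.
  by have := fM (e n); rewrite ler_norml => /andP[].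
by rewrite mulr_ge0// metrizes_ge0.
Qed.

Context d (T : measurableType d) (P : probability T R) (Y : T -> E).
Hypothesis mY : forall n, measurable_fun setT (fun w => D (Y w) (e n)).

Lemma bounded_rv_continuous : bounded_rv (f \o Y).
Proof.
apply: (@bounded_rv_cvg _ _ _ (fun j w => infconv D e f j (Y w)) _ M).
- by move=> j; exact: (measurable_infconv mD fM j mY).
- by move=> j w; exact: infconv_bound.
- by move=> w; exact: (infconv_cvg mD de cf fM).
Qed.

Lemma bl_below (eps : R) : 0 < eps ->
  exists g, [/\ bl D g, forall x, g x <= f x & Ex P (f \o Y) - eps <= Ex P (g \o Y)].
Proof.
move=> eps0.
have : Ex P (fun w => infconv D e f j (Y w)) @[j --> \oo] --> Ex P (f \o Y).
  apply: (@Ex_cvg _ _ _ _ _ _ M).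
  - by move=> j; exact: (measurable_infconv mD fM j mY).
  - by move=> j w; exact: infconv_bound.
  - by move=> w; exact: (infconv_cvg mD de cf fM).
move/cvgrPdist_le => /(_ _ eps0) [j _ /(_ j (leqnn j)) h].
exists (infconv D e f j); split.
- exact: (infconv_bl mD de cf fM).
- by move=> x; exact: (infconv_le mD de cf fM).
- by move: h; rewrite ler_norml => /andP[_]; rewrite /comp; lra.
Qed.

End portmanteau.

Section portmanteau_cvg.
Context (R : realType) (E : ptopologicalType) (D : E -> E -> R) (mD : metrizes D).
Context (e : nat -> E) (de : dense_seq D e).

Lemma bl_dist y : (exists M, forall x, D x y <= M) -> bl D (fun x => D x y).
Proof.
have [_ DC Dt _] := mD.
move=> [M hM]; split; first by exists M => x; rewrite ger0_norm ?metrizes_ge0.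
exists 1 => // x z; rewrite mul1r ler_norml; apply/andP; split.
  by have := Dt z x y; rewrite (DC z x); lra.
by have := Dt x z y; lra.
Qed.

(** A Lipschitz minorant nearly optimal under the limit law gives an asymptotic lower bound; the
    same argument for -f gives the upper one. *)
Lemma cvg_of_bl d (T : measurableType d) (P : probability T R) (Y : nat -> T -> E)
    d' (T' : measurableType d') (P' : probability T' R) (Y' : T' -> E)
    (f : E -> R) :
  (forall m n, measurable_fun setT (fun w => D (Y m w) (e n))) ->
  (forall n, measurable_fun setT (fun w => D (Y' w) (e n))) ->
  (forall g, bl D g -> Ex P (g \o Y m) @[m --> \oo] --> Ex P' (g \o Y')) ->
  continuous f -> (exists M, forall x, `|f x| <= M) ->
  Ex P (f \o Y m) @[m --> \oo] --> Ex P' (f \o Y').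
Proof.
move=> mY mY' H cf [M fM]; apply/cvgrPdist_le => eps eps0.
have e2 : 0 < eps / 2 by rewrite divr_gt0.
have aux1 (u v w : R) : u - eps / 2 <= v -> `|v - w| <= eps / 2 -> u - eps <= w.
  by rewrite ler_norml => ? /andP[? ?]; lra.
have aux2 (u v : R) : u - eps <= v -> - u - eps <= - v -> `|u - v| <= eps.
  by move=> ? ?; rewrite ler_norml; apply/andP; split; lra.
have low h : continuous h -> (forall x, `|h x| <= M) ->
    \forall m \near \oo, Ex P' (h \o Y') - eps <= Ex P (h \o Y m).
  move=> ch hM; have [g [bg gh hg]] := bl_below mD de ch hM P' mY' e2.
  have /cvgrPdist_le/(_ _ e2) := H g bg; apply: filterS => m /(aux1 _ _ _ hg) h1.
  apply: (le_trans h1); apply: Ex_le.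
  - have [[M' gM'] _] := bg.
    exact: (bounded_rv_continuous mD de (bl_continuous mD bg) gM' (mY m)).
  - exact: (bounded_rv_continuous mD de ch hM (mY m)).
  - by move=> w; exact: gh.
have cNf : continuous (fun x => - f x) by move=> x; apply: continuousN; exact: cf.
have NfM x : `|- f x| <= M by rewrite normrN.
have h1 := low f cf fM; have h2 := low _ cNf NfM.
apply: filterS2 h1 h2 => m h1 h2; apply: aux2 => //.
have NE d1 (T1 : measurableType d1) (P1 : probability T1 R) (Z : T1 -> E) :
    (forall n, measurable_fun setT (fun w => D (Z w) (e n))) ->
    Ex P1 ((fun x => - f x) \o Z) = - Ex P1 (f \o Z).
  move=> mZ; have bf := bounded_rv_continuous mD de cf fM mZ.
  rewrite -mulN1r -ExZ//; congr Ex; apply/funext => w; by rewrite mulN1r.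
by move: h2; rewrite !NE.
Qed.

End portmanteau_cvg.

Lemma cvg_finite_sum (R : realType) (I : finType) (F : I -> nat -> R) (l : I -> R) :
  (forall i, F i n @[n --> \oo] --> l i) ->
  \sum_i F i n @[n --> \oo] --> \sum_i l i.
Proof.
move=> H.
have addc : continuous (fun z : R * R => z.1 + z.2).
  by move=> z; apply: cvgD; [exact: cvg_fst|exact: cvg_snd].
apply: (@cvg_big R I +%R 0 xpredT addc nat \oo (index_enum I) F l) => i _.
exact: H.
Qed.

Section tagged.
Context (R : realType) (k : nat).
Local Notation E := (cpath R (R * R)%type).
Local Notation D2 := (fun x y : E => pdist2 x y).
Local Notation Dk := (fun x y : cpath R 'rV[(R * R)%type]_k => pdist_row x y).

Section skeleton.
Context (f : cpath R 'rV[(R * R)%type]_k -> R) (M C : R).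
Hypothesis fM : forall x, `|f x| <= M.
Hypothesis C0 : 0 <= C.
Hypothesis fC : forall x y, `|f x - f y| <= C * pdist_row x y.
Context (eta : R) (eta0 : 0 < eta) (N : nat).

Definition cell (v : {ffun 'I_k -> 'I_N}) (x : 'I_k -> E) : R :=
  \prod_i pou D2 (@dense_path2 R) eta (v i) (x i).

(** A finite linear combination of products of one-particle functionals, for which convergence is
    known; the coefficients are values of [f] at rows of dense paths. *)
Definition skeleton (x : 'I_k -> E) : R :=
  \sum_(v : {ffun 'I_k -> 'I_N}) f (path_row (fun i => @dense_path2 R (v i))) * cell v x.

Lemma cell_ge0 v x : 0 <= cell v x.
Proof. by apply: prodr_ge0 => i _; exact: pou_ge0. Qed.

Lemma sum_cell x : \sum_v cell v x =
  \prod_(i < k) (1 - pou_rest D2 (@dense_path2 R) eta N (x i)).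
Proof.
rewrite -(bigA_distr_bigA (fun i (v : 'I_N) => pou D2 (@dense_path2 R) eta v (x i))).
by apply: eq_bigr => i _; rewrite /pou_rest opprB addrC subrK.
Qed.

Lemma sum_cell_le1 x : \sum_v cell v x <= 1.
Proof.
rewrite sum_cell; have := @prodr_ile1 R 'I_k (index_enum 'I_k) xpredT
  (fun i => 1 - pou_rest D2 (@dense_path2 R) eta N (x i)); apply => i _.
by rewrite subr_ge0 pou_rest_le1 gerBl pou_rest_ge0.
Qed.

(** A cell of nonzero weight forces every coordinate to lie within 2 eta of its centre, so [f]
    varies by at most 2 C k eta there. The mass not covered by the first [N] dense paths costs at
    most [M]. *)
Lemma skeleton_near x : `|f (path_row x) - skeleton x| <=
  2 * C * k%:R * eta + M * (1 - \sum_v cell v x).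
Proof.
set p := \sum_v cell v x.
have p1 : 0 <= 1 - p by rewrite subr_ge0 sum_cell_le1.
have -> : f (path_row x) - skeleton x =
    \sum_(v : {ffun 'I_k -> 'I_N}) (f (path_row x) - f (path_row (fun i => @dense_path2 R (v
      i)))) * cell v x +
    f (path_row x) * (1 - p).
  rewrite /skeleton /p.
  under [X in _ = X + _]eq_bigr do rewrite mulrBl.
  by rewrite sumrB -mulr_sumr; ring.
rewrite (le_trans (ler_normD _ _))// lerD//; last first.
  by rewrite normrM (ger0_norm p1) ler_wpM2r.
have c0 : 0 <= 2 * C * k%:R * eta by rewrite mulr_ge0 ?(ltW eta0)// !mulr_ge0.
apply: (@le_trans _ _ (\sum_v (2 * C * k%:R * eta) * cell v x)); last first.
  by rewrite -mulr_sumr ler_piMr// sum_cell_le1.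
rewrite (le_trans (ler_norm_sum _ _ _))// ler_sum// => v _.
rewrite normrM (ger0_norm (cell_ge0 v x)).
have [/existsP [i /eqP hi]|/existsPn hv] :=
    boolP [exists i, pou D2 (@dense_path2 R) eta (v i) (x i) == 0].
  by rewrite /cell (bigD1 i)//= hi mul0r !mulr0.
rewrite ler_wpM2r ?cell_ge0// (le_trans (fC _ _))// -!mulrA mulrCA ler_wpM2l//.
rewrite /pdist_row (@le_trans _ _ (\sum_(i < k) 2 * eta))//; last first.
  by rewrite sumr_const card_ord -[X in X <= _]mulr_natl mulrCA.
apply: ler_sum => i _; rewrite leNgt; apply/negP => h.
have /negP := hv i; apply; apply/eqP; apply: pou_eq0 => //; apply/ltW.
apply: lt_le_trans h _.
rewrite le_eqVlt; apply/orP; left; apply/eqP; congr pdist2; apply/funext => t;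
by rewrite /= mxE.
Qed.

End skeleton.

Context d0 (T0 : measurableType d0) (P0 : probability T0 R) (XL : T0 -> E).
Hypothesis mXL : measurable_fun setT (XL : T0 -> borel E).
Context d (T : measurableType d) (P : probability T R) (Z : nat -> 'I_k -> T -> E).
Hypothesis mZ : forall m i, measurable_fun setT (Z m i : T -> borel E).
Context d' (T' : measurableType d') (P' : probability T' R) (Y : 'I_k -> T' -> E).
Hypothesis mY : forall i, measurable_fun setT (Y i : T' -> borel E).
Hypothesis Z_cvg : forall f : 'I_k -> E -> R, (forall i, bl D2 (f i)) ->
  Ex P (fun w => \prod_i f i (Z m i w)) @[m --> \oo] --> \prod_i Ex P0 (f i \o XL).
Hypothesis Y_indep : forall f : 'I_k -> E -> R, (forall i, bl D2 (f i)) ->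
  Ex P' (fun w => \prod_i f i (Y i w)) = \prod_i Ex P0 (f i \o XL).

(** The distance to a fixed row is a sum of functions of single paths. Through
    [bounded_rv_continuous] this handles continuous functionals of the row, with no need to know the
    Borel sets of the row space. *)
Lemma measurable_row_dist d1 (T1 : measurableType d1) (X : 'I_k -> T1 -> E)
    (y : cpath R 'rV[(R * R)%type]_k) :
  (forall i, measurable_fun setT (X i : T1 -> borel E)) ->
  measurable_fun setT (fun w => pdist_row (path_row (fun i => X i w)) y).
Proof.
move=> mX.
pose g (i : 'I_k) (x : E) : R := pdist2 x (path_map (@mx_entry_continuous (R * R)%type 1 k ord0
  i) y).
have -> : (fun w => pdist_row (path_row (fun i => X i w)) y) = (fun w => \sum_i g i (X i w)).
  apply/funext => w; apply: eq_bigr => i _; congr pdist2; apply/funext => t.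
  by rewrite /= mxE.
apply: measurable_sum => i.
have bg : bl D2 (g i).
  apply: (bl_dist (metrizes_pdist2 R)); exists 2 => x.
  have -> : (2 : R) = 1 + 1 by lra.
  by apply: lerD; apply: pdist_le => t; exact: pterm_le1.
by have [] := bounded_rv_comp (mX i) (bl_measurable (metrizes_pdist2 R) bg).
Qed.

Let brow d1 (T1 : measurableType d1) (X : 'I_k -> T1 -> E) f : bl Dk f ->
  (forall i, measurable_fun setT (X i : T1 -> borel E)) ->
  bounded_rv (fun w => f (path_row (fun i => X i w))).
Proof.
move=> bf mX; have [[M fM] _] := bf.
apply: (@bounded_rv_continuous _ _ Dk (metrizes_pdist_row R k) _ (@dense_row_dense R k) f
  (bl_continuous (metrizes_pdist_row R k) bf) M fM _ _ (fun w => path_row (fun i => X i w))).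
by move=> n; exact: measurable_row_dist.
Qed.

(** Skeletons converge term by term. The uncovered mass is itself one minus a sum of cell
    probabilities, so it converges as well and inherits its smallness from the limit law; this takes
    the place of a tightness argument. *)
Lemma row_cvg_bl f : bl Dk f ->
  Ex P (fun w => f (path_row (fun i => Z m i w))) @[m --> \oo] -->
  Ex P' (fun w => f (path_row (fun i => Y i w))).
Proof.
have aux (e A Sm Sy B am bb : R) : `|Sy - Sm| <= e / 8 -> `|bb - am| <= e / 8 ->
    `|B - Sy| <= e / 8 + bb -> `|A - Sm| <= e / 8 + am -> bb <= e / 8 -> `|B - A| <= e.
  rewrite !ler_norml => /andP[? ?] /andP[? ?] /andP[? ?] /andP[? ?] ?.
  by apply/andP; split; lra.
move=> bf; have [[M fM] [C C0 fC]] := bf.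
have M0 : 0 <= M by apply: le_trans (fM point).
apply/cvgrPdist_le => e e0.
pose eta := e / 8 / (2 * C * k%:R + 1).
have Ck0 : 0 <= 2 * C * k%:R by rewrite !mulr_ge0.
have eta0 : 0 < eta by rewrite !divr_gt0// ltr_wpDl.
have eta1 : 2 * C * k%:R * eta <= e / 8.
  by rewrite /eta mulrCA ler_piMr ?divr_ge0 ?(ltW e0)// ler_pdivrMr ?ltr_wpDl// mul1r lerDl.
have bpou v : bl D2 (pou D2 (@dense_path2 R) eta v) by apply: pou_bl => //; exact: metrizes_pdist2.
have bcell d1 (T1 : measurableType d1) (X : 'I_k -> T1 -> E) N (v : {ffun 'I_k -> 'I_N}) :
    (forall i, measurable_fun setT (X i : T1 -> borel E)) ->
    bounded_rv (fun w => cell eta v (fun i => X i w)).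
  move=> mX; apply: bounded_rv_prod => i.
  exact: (bounded_rv_comp (mX i) (bl_measurable (metrizes_pdist2 R) (bpou (v i)))).
pose q N := \sum_(v : {ffun 'I_k -> 'I_N}) \prod_i Ex P0 (pou D2 (@dense_path2 R) eta (v i) \o XL).
have bXL v : bounded_rv (pou D2 (@dense_path2 R) eta v \o XL).
  exact: (bounded_rv_comp mXL (bl_measurable (metrizes_pdist2 R) (bpou v))).
have qE N : q N = \prod_(i < k) (1 - Ex P0 (fun w => pou_rest D2 (@dense_path2 R) eta N (XL w))).
  rewrite /q -(bigA_distr_bigA (fun (i : 'I_k) (v : 'I_N) => Ex P0 (pou D2 (@dense_path2 R) eta
    v \o XL))).
  apply: eq_bigr => i _; rewrite -Ex_sum; last by move=> v; exact: bXL.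
  rewrite -[X in X - _](Ex_cst P0 1) -ExB//.
  - by congr Ex; apply/funext => w; rewrite /pou_rest opprB addrC subrK.
  - exact: bounded_rv_cst.
  - apply: (bounded_rv_comp mXL (bl_measurable (metrizes_pdist2 R) _)).
    by apply: pou_rest_bl => //; exact: metrizes_pdist2.
have q1 : q N @[N --> \oo] --> (1 : R).
  have prod1 : \prod_(i < k) (1 - Ex P0 (fun=> 0)) = 1 :> R.
    by rewrite big1// => i _; rewrite Ex_cst subr0.
  have mulc : continuous (fun z : R * R => z.1 * z.2).
    by move=> z; apply: cvgM; [exact: cvg_fst|exact: cvg_snd].
  have H : \prod_(i < k) (1 - Ex P0 (fun w => pou_rest D2 (@dense_path2 R) eta N (XL w)))
      @[N --> \oo] --> \prod_(i < k) (1 - Ex P0 (fun=> 0)).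
    apply: (@cvg_big R 'I_k *%R 1 xpredT mulc nat \oo (index_enum 'I_k)
      (fun _ N => 1 - Ex P0 (fun w => pou_rest D2 (@dense_path2 R) eta N (XL w)))
      (fun=> 1 - Ex P0 (fun=> 0))) => i _.
    apply: cvgB; first exact: cvg_cst.
    apply: (@Ex_cvg _ _ _ _ _ _ 1).
    - move=> N; have [] // := bounded_rv_comp mXL (bl_measurable (metrizes_pdist2 R)
        (pou_rest_bl (metrizes_pdist2 R) (@dense_path2 R) eta0 N)).
    - by move=> N w; rewrite ger0_norm ?pou_rest_le1 ?pou_rest_ge0.
    - by move=> w; exact: (pou_rest_cvg (@dense_path2_dense R) eta0).
  rewrite prod1 in H; apply: cvg_trans H; apply: near_eq_cvg; apply: nearW => N.
  by rewrite qE.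
have e1 : 0 < e / 8 / (M + 1) by rewrite divr_gt0 ?divr_gt0// ltr_wpDl.
(* [N] is chosen under the limit law alone; for large [m] the uncovered mass of [Z m] follows. *)
have /cvgrPdist_le/(_ _ e1) [N _ /(_ N (leqnn N)) hN] := q1.
have hN1 : M * (1 - q N) <= e / 8.
  apply: (@le_trans _ _ (M * (e / 8 / (M + 1)))).
    by rewrite ler_wpM2l// (le_trans (ler_norm _)).
  by rewrite mulrCA ler_piMr ?divr_ge0 ?(ltW e0)// ler_pdivrMr ?ltr_wpDl// mul1r lerDl.
pose c (v : {ffun 'I_k -> 'I_N}) := f (path_row (fun i => @dense_path2 R (v i))).
have Zc (v : {ffun 'I_k -> 'I_N}) : Ex P (fun w => cell eta v (fun i => Z m i w)) @[m --> \oo] -->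
    \prod_i Ex P0 (pou D2 (@dense_path2 R) eta (v i) \o XL).
  exact: (@Z_cvg (fun i => pou D2 (@dense_path2 R) eta (v i)) (fun i => bpou (v i))).
have Yc (v : {ffun 'I_k -> 'I_N}) : Ex P' (fun w => cell eta v (fun i => Y i w)) =
    \prod_i Ex P0 (pou D2 (@dense_path2 R) eta (v i) \o XL).
  exact: (@Y_indep (fun i => pou D2 (@dense_path2 R) eta (v i)) (fun i => bpou (v i))).
have near d1 (T1 : measurableType d1) (P1 : probability T1 R) (X : 'I_k -> T1 -> E) :
    (forall i, measurable_fun setT (X i : T1 -> borel E)) ->
    `|Ex P1 (fun w => f (path_row (fun i => X i w))) -
      \sum_v c v * Ex P1 (fun w => cell eta v (fun i => X i w))| <=
    e / 8 + M * (1 - \sum_(v : {ffun 'I_k -> 'I_N}) Ex P1 (fun w => cell eta v (fun i => X i w))).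
  move=> mX; have bc v := bcell _ _ X N v mX.
  have -> : \sum_v c v * Ex P1 (fun w => cell eta v (fun i => X i w)) =
      Ex P1 (fun w => skeleton f eta N (fun i => X i w)).
    rewrite /skeleton Ex_sum; last by move=> v; exact: bounded_rvZ.
    by apply: eq_bigr => v _; rewrite ExZ.
  have bs : bounded_rv (fun w => skeleton f eta N (fun i => X i w)).
    by apply: bounded_rv_sum => v; exact: bounded_rvZ.
  have -> : e / 8 + M * (1 - \sum_(v : {ffun 'I_k -> 'I_N}) Ex P1 (fun w => cell eta v (fun i =>
    X i w))) =
    Ex P1 (fun w => e / 8 + M * (1 - \sum_(v : {ffun 'I_k -> 'I_N}) cell eta v (fun i => X i w))).
    have bsum : bounded_rv (fun w => \sum_(v : {ffun 'I_k -> 'I_N}) cell eta v (fun i => X i w)).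
      by apply: bounded_rv_sum.
    have b1 : bounded_rv (fun w : T1 => 1 : R) by exact: bounded_rv_cst.
    rewrite ExD; [|exact: bounded_rv_cst|by apply: bounded_rvZ; exact: bounded_rvB].
    by rewrite Ex_cst ExZ ?ExB ?Ex_cst ?Ex_sum//; exact: bounded_rvB.
  rewrite -ExB//; last exact: brow.
  rewrite (le_trans (le_norm_Ex _ _))//; first by apply: bounded_rvB => //; exact: brow.
  apply: Ex_le.
  - by apply: bounded_rv_norm; apply: bounded_rvB => //; exact: brow.
  - apply: bounded_rvD; first exact: bounded_rv_cst.
    by apply: bounded_rvZ; apply: bounded_rvB; [exact: bounded_rv_cst|apply: bounded_rv_sum].
  - move=> w; apply: (le_trans (skeleton_near fM C0 fC eta0 N _)).
    by rewrite lerD2r.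
have H1 : \sum_v c v * Ex P (fun w => cell eta v (fun i => Z m i w)) @[m --> \oo] -->
    \sum_v c v * Ex P' (fun w => cell eta v (fun i => Y i w)).
  apply: cvg_finite_sum => v; apply: cvgMl_tmp; rewrite Yc; exact: Zc.
have H2 : M * (1 - \sum_(v : {ffun 'I_k -> 'I_N}) Ex P (fun w => cell eta v (fun i => Z m i w)))
  @[m --> \oo] -->
    M * (1 - q N).
  apply: cvgMl_tmp; apply: cvgB; first exact: cvg_cst.
  by apply: cvg_finite_sum => v; exact: Zc.
have e8 : 0 < e / 8 by rewrite divr_gt0.
have /cvgrPdist_le/(_ _ e8) H1' := H1.
have /cvgrPdist_le/(_ _ e8) H2' := H2.
have hY := near _ _ P' Y mY.
have YE : \sum_(v : {ffun 'I_k -> 'I_N}) Ex P' (fun w => cell eta v (fun i => Y i w)) = q N.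
  by apply: eq_bigr => v _; rewrite Yc.
rewrite YE in hY.
apply: filterS2 H1' H2' => m h1 h2; have hZ := near _ _ P (Z m) (mZ m).
exact: (aux e _ _ _ _ _ _ h1 h2 hY hZ hN1).
Qed.

End tagged.

(** * Convergence of empirical measures *)

Section modulus.
Context (R : realType) (T : R) (T0 : 0 <= T) (h : R) (h0 : 0 <= h).
Implicit Types y : cpath R R.

Definition modulus y : R := sup [set r | exists s t : Rplus R,
  [/\ Rplus_val s <= T, Rplus_val t <= T, `|Rplus_val s - Rplus_val t| <= h
    & r = `|y s - y t|]].

Let has_sup_modulus y : has_sup [set r | exists s t : Rplus R,
  [/\ Rplus_val s <= T, Rplus_val t <= T, `|Rplus_val s - Rplus_val t| <= h
    & r = `|y s - y t|]].
Proof.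
split.
  by exists 0, (Rplus0 R), (Rplus0 R); split; rewrite ?subrr ?normr0.
have [M hM] := path_bounded y T; exists (M + M) => _ [s [t [sT tT _ ->]]].
by rewrite (le_trans (ler_normB _ _))// lerD// hM.
Qed.

Lemma modulus_ge y s t : Rplus_val s <= T -> Rplus_val t <= T ->
  `|Rplus_val s - Rplus_val t| <= h -> `|y s - y t| <= modulus y.
Proof. by move=> sT tT st; apply: sup_upper_bound => //; exists s, t. Qed.

Lemma modulus_le y C : (forall s t : Rplus R, Rplus_val s <= T -> Rplus_val t <= T ->
  `|Rplus_val s - Rplus_val t| <= h -> `|y s - y t| <= C) -> modulus y <= C.
Proof.
move=> H; apply: ge_sup; first by case: (has_sup_modulus y).
by move=> _ [s [t [sT tT st ->]]]; exact: H.
Qed.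

Lemma modulus_ge0 y : 0 <= modulus y.
Proof.
have T00 : Rplus_val (Rplus0 R) <= T by [].
have := @modulus_ge y (Rplus0 R) (Rplus0 R) T00 T00.
by rewrite !subrr normr0; exact.
Qed.

Lemma modulus_lip y y' C : (forall t, Rplus_val t <= T -> `|y t - y' t| <= C) ->
  `|modulus y - modulus y'| <= 2 * C.
Proof.
have aux (u v a b : R) : `|u - a| <= C -> `|v - b| <= C -> `|u - v| <= `|a - b| + 2 * C.
  move=> h1 h2; have -> : u - v = (a - b) + ((u - a) - (v - b)) by ring.
  rewrite (le_trans (ler_normD _ _))// lerD2l (le_trans (ler_normB _ _))//; lra.
have aux2 (u v : R) : u <= v + 2 * C -> v <= u + 2 * C -> `|u - v| <= 2 * C.
  by move=> ? ?; rewrite ler_norml; apply/andP; split; lra.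
move=> H; have key (z z' : cpath R R) : (forall t, Rplus_val t <= T -> `|z t - z' t| <= C) ->
    modulus z <= modulus z' + 2 * C.
  move=> Hz; apply: modulus_le => s t sT tT st.
  apply: (le_trans (aux _ _ _ _ (Hz s sT) (Hz t tT))).
  by rewrite lerD2r; exact: modulus_ge.
by apply: aux2; apply: key => // t tT; rewrite distrC; exact: H.
Qed.

Lemma modulus_continuous : continuous (modulus : cpath R R -> R).
Proof.
move=> y; apply/(@cvgrPdist_le _ _ _ _ (nbhs_filter y)) => e e0.
have e20 : 0 < e / 2 by rewrite divr_gt0.
have e2 : 2 * (e / 2) <= e by lra.
have := @cpath_nbhs R R y T _ (entourage_ball R (PosNum e20)).
apply: filterS => y' yy'; apply: le_trans e2; apply: modulus_lip => t tT.
exact/ltW/yy'.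
Qed.

End modulus.

Lemma modulus_cvg (R : realType) (T : R) (y : cpath R R) : 0 <= T ->
  modulus T N.+1%:R^-1 y @[N --> \oo] --> (0 : R).
Proof.
move=> T0; apply/cvgrPdist_le => e e0.
have [de de0 H] := path_unif y T e0.
exists (Num.truncn de^-1) => // N /= hN.
rewrite sub0r normrN ger0_norm ?modulus_ge0// modulus_le// => s t sT tT st.
apply/ltW/H => //; apply: le_lt_trans st _.
rewrite invf_plt ?posrE// (lt_le_trans (truncnS_gt _))// ler_nat ltnS//.
Qed.

Section particles.
Context (R : realType) d (T : measurableType d) (P : probability T R).
Context d0 (T0 : measurableType d0) (P0 : probability T0 R).
Local Notation E := (cpath R (R * R)%type).
Local Notation D2 := (fun x y : E => pdist2 x y).
Context (XL : T0 -> E) (lam : cpath R R) (Z Y : forall m, 'I_m.+2 -> T -> E).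
Hypothesis mXL : measurable_fun setT (XL : T0 -> borel E).
Hypothesis mZ : forall m i, measurable_fun setT (@Z m i : T -> borel E).
Hypothesis bY : forall m (i : 'I_m.+2) f, bl D2 f -> bounded_rv (fun w => f (Y i w)).
Hypothesis lln : forall f (eta : R), bl D2 f -> 0 < eta ->
  \forall m \near \oo, forall r : 'I_m.+2 -> R, (forall j, `|r j| <= 1) ->
    Ex P (fun w => `|m.+2%:R^-1 * \sum_j r j * (f (Y j w) - Ex P0 (f \o XL))|) <= eta.
Hypothesis coupled : forall eta : R, 0 < eta -> \forall m \near \oo, forall i : 'I_m.+2,
  exists2 V, mean_le P V eta & {ae P, forall w, pdist2 (Z i w) (Y i w) <= V w}.

Let bZ m (i : 'I_m.+2) (f : E -> R) : continuous f -> (exists M, forall x, `|f x| <= M) ->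
  bounded_rv (fun w => f (Z i w)).
Proof.
move=> cf bf; apply: (bounded_rv_comp (g := f : borel E -> R) (mZ i)).
by split => //; exact: continuous_borelR.
Qed.

Let bblZ m (i : 'I_m.+2) f : bl D2 f -> bounded_rv (fun w => f (Z i w)).
Proof. by move=> bf; exact: (bounded_rv_comp (mZ i) (bl_measurable (metrizes_pdist2 R) bf)). Qed.

Lemma bl_coupled f (eta : R) : bl D2 f -> 0 < eta ->
  \forall m \near \oo, forall i : 'I_m.+2,
    Ex P (fun w => `|f (Z i w) - f (Y i w)|) <= eta.
Proof.
move=> bf eta0; have [_ [C C0 fC]] := bf.
have C1 : 0 < C + 1 by rewrite ltr_wpDl.
have e0 : 0 < eta / (C + 1) by rewrite divr_gt0.
apply: filterS (coupled e0) => m H i; have [V mV hV] := H i.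
have [mCV CV0 hCV] := mean_leZ C0 mV.
have bd : bounded_rv (fun w => `|f (Z i w) - f (Y i w)|).
  by apply: bounded_rv_norm; apply: bounded_rvB; [exact: bblZ|exact: bY].
have aeV : {ae P, forall w, `| `|f (Z i w) - f (Y i w)| | <= C * V w}.
  apply: filterS hV => w hw; rewrite normr_id (le_trans (fC _ _))//.
  by rewrite ler_wpM2l.
have := le_trans (Ex_le_integral bd mCV CV0 aeV) hCV.
rewrite lee_fin => /(le_trans (ler_norm _)) /le_trans; apply.
by rewrite mulrCA ler_piMr ?(ltW eta0)// ler_pdivrMr// mul1r lerDl.
Qed.

Lemma prod_dist I (s : seq I) (a c : I -> R) M : 1 <= M ->
  (forall i, `|a i| <= M) -> (forall i, `|c i| <= M) ->
  `|\prod_(i <- s) a i - \prod_(i <- s) c i| <= M ^+ size s * \sum_(i <- s) `|a i - c i|.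
Proof.
move=> M1 aM cM; have M0 : 0 <= M := le_trans ler01 M1.
elim: s => [|i s IH]; first by rewrite !big_nil subrr normr0 mulr0.
rewrite !big_cons /=.
have -> : a i * \prod_(j <- s) a j - c i * \prod_(j <- s) c j =
    (a i - c i) * \prod_(j <- s) a j + c i * (\prod_(j <- s) a j - \prod_(j <- s) c j) by ring.
rewrite (le_trans (ler_normD _ _))// [leRHS]mulrDr lerD// normrM.
  rewrite mulrC ler_wpM2r// (le_trans (prod_norm_le _ M0 aM))// exprS ler_peMl//.
  by rewrite exprn_ge0.
by rewrite exprS -mulrA ler_pM.
Qed.

Lemma tagged_product k (f : 'I_k -> E -> R) : (forall i, bl D2 (f i)) ->
  Ex P (fun w => \prod_i f i (Y (inord i : 'I_m.+2) w)) @[m --> \oo] -->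
    \prod_i Ex P0 (f i \o XL) ->
  Ex P (fun w => \prod_i f i (Z (inord i : 'I_m.+2) w)) @[m --> \oo] -->
    \prod_i Ex P0 (f i \o XL).
Proof.
move=> bf H; have [M [C [M1 C0 lf]]] := bl_lipf_uniform bf.
have M0 : 0 <= M := le_trans ler01 M1.
have size_index : size (index_enum 'I_k) = k.
  by rewrite -[RHS]card_ord cardT enumT /index_enum unlock.
apply/cvgrPdist_le => e e0.
have aux (u v w : R) : `|u - v| <= e / 2 -> `|w - v| <= e / 2 -> `|u - w| <= e.
  by rewrite !ler_norml => /andP[? ?] /andP[? ?]; apply/andP; split; lra.
have e2 : 0 < e / 2 by rewrite divr_gt0.
have K0 : 0 < M ^+ k * k%:R + 1 by rewrite ltr_wpDl// mulr_ge0// exprn_ge0.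
have e3 : 0 < e / 2 / (M ^+ k * k%:R + 1) by rewrite divr_gt0.
have /cvgrPdist_le/(_ _ e2) H1 := H.
have H2 : \forall m \near \oo, forall i : 'I_k, forall j : 'I_m.+2,
    Ex P (fun w => `|f i (Z j w) - f i (Y j w)|) <= e / 2 / (M ^+ k * k%:R + 1).
  by apply: filter_forall => i; exact: bl_coupled.
apply: filterS2 H1 H2 => m h1 h2; apply: (aux _ _ _ h1).
have bz : bounded_rv (fun w => \prod_i f i (Z (inord i : 'I_m.+2) w)).
  by apply: bounded_rv_prod => i; exact: bblZ.
have by' : bounded_rv (fun w => \prod_i f i (Y (inord i : 'I_m.+2) w)).
  by apply: bounded_rv_prod => i; exact: bY.
have bd i : bounded_rv (fun w => `|f i (Z (inord i : 'I_m.+2) w) - f i (Y (inord i : 'I_m.+2) w)|).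
  by apply: bounded_rv_norm; apply: bounded_rvB; [exact: bblZ|exact: bY].
rewrite -ExB// (le_trans (le_norm_Ex _ _))//; first exact: bounded_rvB.
apply: (@le_trans _ _ (Ex P (fun w => M ^+ k * \sum_i
    `|f i (Z (inord i : 'I_m.+2) w) - f i (Y (inord i : 'I_m.+2) w)|))).
  apply: Ex_le; [by apply: bounded_rv_norm; exact: bounded_rvB
    |by apply: bounded_rvZ; exact: bounded_rv_sum|].
  move=> w; have := @prod_dist _ (index_enum 'I_k)
    (fun i => f i (Z (inord i : 'I_m.+2) w)) (fun i => f i (Y (inord i : 'I_m.+2) w)) M M1
    (fun i => (lf i).1 _) (fun i => (lf i).1 _).
  by rewrite size_index.
rewrite ExZ; last exact: bounded_rv_sum.
rewrite Ex_sum//.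
apply: (@le_trans _ _ (M ^+ k * \sum_(i < k) e / 2 / (M ^+ k * k%:R + 1))).
  by rewrite ler_wpM2l ?exprn_ge0// ler_sum.
rewrite sumr_const card_ord -[X in _ * X <= _]mulr_natl.
rewrite [leLHS](_ : _ = e / 2 * (M ^+ k * k%:R / (M ^+ k * k%:R + 1))); last by ring.
by rewrite ler_piMr ?(ltW e2)// ler_pdivrMr// mul1r lerDl.
Qed.

Definition average_dev (f : E -> R) m (w : T) : R :=
  m.+2%:R^-1 * \sum_j f (@Z m j w) - Ex P0 (f \o XL).

Lemma average_cst n (c : R) : n.+1%:R^-1 * \sum_(i < n.+1) c = c.
Proof. by rewrite sumr_const card_ord -[X in _ * X]mulr_natl mulKf. Qed.

Lemma average_dev_rv f m : continuous f -> (exists M, forall x, `|f x| <= M) ->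
  bounded_rv (average_dev f m).
Proof.
move=> cf bf; apply: bounded_rvB; last exact: bounded_rv_cst.
by apply: bounded_rvZ; apply: bounded_rv_sum => j; exact: bZ.
Qed.

Lemma average_bl f (eta : R) : bl D2 f -> 0 < eta ->
  \forall m \near \oo, Ex P (fun w => `|average_dev f m w|) <= eta.
Proof.
move=> bf eta0; have e2 : 0 < eta / 2 by rewrite divr_gt0.
have H1 := lln bf e2; have H2 := bl_coupled bf e2.
apply: filterS2 H1 H2 => m H1 H2.
have one1 (j : 'I_m.+2) : `|1 : R| <= 1 by rewrite normr1.
pose A w := m.+2%:R^-1 * \sum_(j < m.+2) `|f (Z j w) - f (Y j w)|.
pose B w := `|m.+2%:R^-1 * \sum_(j < m.+2) 1 * (f (Y j w) - Ex P0 (f \o XL))|.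
have bd j : bounded_rv (fun w => `|f (@Z m j w) - f (Y j w)|).
  by apply: bounded_rv_norm; apply: bounded_rvB; [exact: bblZ|exact: bY].
have bA : bounded_rv A by apply: bounded_rvZ; exact: bounded_rv_sum.
have bB : bounded_rv B.
  apply: bounded_rv_norm; apply: bounded_rvZ; apply: bounded_rv_sum => j.
  by apply: bounded_rvZ; apply: bounded_rvB; [exact: bY|exact: bounded_rv_cst].
apply: (@le_trans _ _ (Ex P (fun w => A w + B w))).
  apply: Ex_le.
  - apply: bounded_rv_norm; apply: average_dev_rv; last by case: bf.
    exact: (bl_continuous (metrizes_pdist2 R) bf).
  - exact: bounded_rvD.
  move=> w; rewrite /average_dev.
  have -> : m.+2%:R^-1 * \sum_(j < m.+2) f (Z j w) - Ex P0 (f \o XL) =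
     m.+2%:R^-1 * \sum_(j < m.+2) (f (Z j w) - f (Y j w)) +
     m.+2%:R^-1 * \sum_(j < m.+2) 1 * (f (Y j w) - Ex P0 (f \o XL)).
    rewrite -mulrDr -big_split -{1}(average_cst m.+1 (Ex P0 (f \o XL))) -mulrBr -sumrB.
    by congr (_ * _); apply: eq_bigr => j _ /=; ring.
  rewrite (le_trans (ler_normD _ _))// lerD2r normrM ger0_norm ?invr_ge0//.
  by rewrite ler_wpM2l ?invr_ge0// ler_norm_sum.
rewrite ExD// [leRHS]splitr lerD//; last exact: H1.
rewrite ExZ; last exact: bounded_rv_sum.
rewrite Ex_sum// -[leRHS](average_cst m.+1); apply: ler_wpM2l; first by rewrite invr_ge0.
by apply: ler_sum => j _; exact: H2.
Qed.

(** [f] is squeezed between [g1] and [- g2], bounded Lipschitz, whose means under the limit law are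
    within eta/4 of that of [f]. The averages of [g1] and [g2] over the particles are already
    controlled. *)
Lemma average_continuous_functional f (eta : R) :
  continuous f -> (exists M, forall x, `|f x| <= M) -> 0 < eta ->
  \forall m \near \oo, Ex P (fun w => `|average_dev f m w|) <= eta.
Proof.
have aux1 (u v a c : R) : u <= v -> a - eta / 4 <= c -> - `|u - c| - eta / 4 <= v - a.
  by have : - `|u - c| <= u - c by [rewrite lerNl -normrN; exact: ler_norm]; lra.
have aux2 (u a c : R) : 0 < eta -> - a - eta / 4 <= u -> - c - eta / 4 <= - u -> 0 <= a -> 0 <= c ->
    `|u| <= a + c + eta / 2.
  by move=> ? ? ? ? ?; rewrite ler_norml; apply/andP; split; lra.
move=> cf [M fM] eta0; have e4 : 0 < eta / 4 by rewrite divr_gt0.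
have mD n : measurable_fun setT (fun w => pdist2 (XL w) (@dense_path2 R n)).
  have bg : bl D2 (fun x => pdist2 x (@dense_path2 R n)).
    apply: (bl_dist (metrizes_pdist2 R)); exists 2 => x.
    have -> : (2 : R) = 1 + 1 by lra.
    by apply: lerD; apply: pdist_le => t; exact: pterm_le1.
  by have [] := bounded_rv_comp mXL (bl_measurable (metrizes_pdist2 R) bg).
have low h : continuous h -> (forall x, `|h x| <= M) -> exists2 g, bl D2 g &
    forall m w, - `|average_dev g m w| - eta / 4 <= average_dev h m w.
  move=> ch hM; have [g [bg gh hg]] :=
    bl_below (metrizes_pdist2 R) (@dense_path2_dense R) ch hM P0 mD e4.
  exists g => // m w; apply: aux1 hg; rewrite ler_wpM2l ?invr_ge0//.
  by apply: ler_sum => j _; exact: gh.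
have cNf : continuous (fun x => - f x) by move=> x; apply: continuousN; exact: cf.
have NfM x : `|- f x| <= M by rewrite normrN.
have [g1 bg1 hg1] := low f cf fM.
have [g2 bg2 hg2] := low _ cNf NfM.
have bfXL : bounded_rv (f \o XL).
  apply: (bounded_rv_comp (g := f : borel E -> R) mXL).
  by split; [exact: continuous_borelR|exists M].
have NE m w : average_dev (fun x => - f x) m w = - average_dev f m w.
  rewrite /average_dev sumrN mulrN opprB addrC; congr (_ + _).
  have -> : (fun x => - f x) \o XL = (fun w => -1 * (f \o XL) w).
    by apply/funext => x; rewrite mulN1r.
  by rewrite ExZ// mulN1r opprK.
have H1 := average_bl bg1 e4; have H2 := average_bl bg2 e4.
apply: filterS2 H1 H2 => m H1 H2.
have b1 g : bl D2 g -> bounded_rv (fun w => `|average_dev g m w|).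
  move=> bg; apply: bounded_rv_norm; apply: average_dev_rv; last by case: bg.
  exact: (bl_continuous (metrizes_pdist2 R) bg).
apply: (@le_trans _ _ (Ex P (fun w => `|average_dev g1 m w| +
    `|average_dev g2 m w| + eta / 2))).
  apply: Ex_le.
  - by apply: bounded_rv_norm; apply: average_dev_rv => //; exists M.
  - by apply: bounded_rvD; [apply: bounded_rvD; exact: b1|exact: bounded_rv_cst].
  move=> w; apply: aux2 => //; by rewrite -NE.
rewrite ExD; [|by apply: bounded_rvD; exact: b1|exact: bounded_rv_cst].
rewrite ExD; [|exact: b1|exact: b1].
by rewrite Ex_cst; move: (Ex P _) (Ex P _) H1 H2 => u v; lra.
Qed.

(** The supremum over time reduces to grid times plus an oscillation. The oscillation of t -> phi(x
    t) at scale 1/(N+1) is itself a bounded continuous functional of the path, so its average over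
    particles is close to its mean under the limit law, which tends to 0 as [N] grows. *)
Lemma uniform_empirical (phi : R * R -> R) (Tm eta : R) : 0 <= Tm -> 0 < eta ->
  continuous phi -> (exists M, forall x, `|phi x| <= M) ->
  \forall m \near \oo, exists2 V, mean_le P V eta &
    forall w t, Rplus_val t <= Tm ->
      `|m.+2%:R^-1 * \sum_j phi (@Z m j w t) - Ex P0 (fun w => phi (XL w t))| <= V w.
Proof.
have aux (x v ck c u a : R) : `|x - v| <= u -> `|ck - c| <= a ->
    `|x - c| <= `|v - ck| + `|u - a| + 2 * a.
  move=> h1 h2; have -> : x - c = (v - ck) + ((x - v) + (ck - c)) by ring.
  rewrite (le_trans (ler_normD _ _))// -[leRHS]addrA lerD2l (le_trans (ler_normD _ _))//.
  by have := ler_norm (u - a); lra.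
move=> Tm0 eta0 cphi [M phiM].
pose H N (x : E) := modulus Tm N.+1%:R^-1 (path_map cphi x).
have i0 N : (0 : R) <= N.+1%:R^-1 by rewrite invr_ge0.
have cH N : continuous (H N).
  move=> x; apply: (@continuous_comp E (cpath R R) R (path_map cphi) (modulus Tm N.+1%:R^-1)).
    exact: path_map_continuous.
  exact: modulus_continuous.
have HM N x : `|H N x| <= 2 * M.
  rewrite ger0_norm ?modulus_ge0// modulus_le// => s t _ _ _.
  rewrite (le_trans (ler_normB _ _))// mulrDl mul1r.
  by apply: lerD; exact: phiM.
have bHXL N : bounded_rv (H N \o XL).
  apply: (bounded_rv_comp (g := H N : borel E -> R) mXL).
  by split; [exact: continuous_borelR|exists (2 * M)].
have EH : Ex P0 (H N \o XL) @[N --> \oo] --> Ex P0 (fun=> 0).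
  apply: (@Ex_cvg _ _ _ _ _ _ (2 * M)).
  - by move=> N; case: (bHXL N).
  - by move=> N w; exact: HM.
  - by move=> w; exact: modulus_cvg.
have e8 : 0 < eta / 8 by rewrite divr_gt0.
have e4 : 0 < eta / 4 by rewrite divr_gt0.
have /cvgrPdist_le/(_ _ e8) [N _ /(_ N (leqnn N)) hN] := EH.
rewrite Ex_cst sub0r normrN in hN.
have {}hN : Ex P0 (H N \o XL) <= eta / 8 by apply: le_trans hN; exact: ler_norm.
(* The number of grid points in [0, Tm], the origin included. *)
pose K := (Num.truncn (Tm * N.+1%:R)).+1.
pose ev k (x : E) := phi (x (grid R N k)).
have cev k : continuous (ev k).
  move=> x; apply: (@continuous_comp E (R * R)%type R (fun x : E => x (grid R N k)) phi).
    exact: path_eval_continuous.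
  exact: cphi.
have evM k x : `|ev k x| <= M by exact: phiM.
have eK : 0 < eta / 4 / K%:R by rewrite divr_gt0.
have H1 : \forall m \near \oo, forall k : 'I_K,
    Ex P (fun w => `|average_dev (ev k) m w|) <= eta / 4 / K%:R.
  by apply: filter_forall => k; apply: average_continuous_functional => //; exists M.
have H2 : \forall m \near \oo, Ex P (fun w => `|average_dev (H N) m w|) <= eta / 4.
  by apply: average_continuous_functional => //; exists (2 * M).
apply: filterS2 H1 H2 => m H1 H2.
have bev k : bounded_rv (fun w => `|average_dev (ev k) m w|).
  by apply: bounded_rv_norm; apply: average_dev_rv => //; exists M.
have bH : bounded_rv (fun w => `|average_dev (H N) m w|).
  by apply: bounded_rv_norm; apply: average_dev_rv => //; exists (2 * M).
have EH0 : 0 <= Ex P0 (H N \o XL) by apply: Ex_ge0 => w; exact: modulus_ge0.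
exists (fun w => \sum_(k < K) `|average_dev (ev k) m w| +
    `|average_dev (H N) m w| + 2 * Ex P0 (H N \o XL)).
  apply: (@mean_le_weaken _ _ _ _ _ (\sum_(k < K) eta / 4 / K%:R + eta / 4 + 2 * (eta / 8))).
    rewrite sumr_const card_ord -[X in X + _ + _]mulr_natl mulrC divfK ?pnatr_eq0//.
    by rewrite (_ : _ + _ + _ = eta * (3 / 4)) ?ler_piMr ?(ltW eta0) ?ler_pdivrMr ?mul1r
      ?ler_nat//; field.
  apply: mean_leD.
    apply: mean_leD; last exact: mean_le_rv.
    by apply: mean_le_sum => k; exact: mean_le_rv.
  apply: (@mean_le_weaken _ _ _ _ _ (2 * Ex P0 (H N \o XL))).
    by rewrite ler_wpM2l.
  by apply: mean_le_cst; rewrite mulr_ge0.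
move=> w t tT; pose k := Num.truncn (Rplus_val t * N.+1%:R).
have t0 := Rplus_ge0 t.
have kK : (k < K)%N by rewrite ltnS; apply: le_truncn; rewrite ler_wpM2r.
have /andP[k1 k2] := truncn_itv (mulr_ge0 t0 (ler0n R N.+1)).
have gt : Rplus_val (grid R N k) <= Rplus_val t by rewrite grid_val ler_pdivrMr.
have tg : `|Rplus_val t - Rplus_val (grid R N k)| <= N.+1%:R^-1.
  rewrite ger0_norm ?subr_ge0// lerBlDl grid_val.
  by rewrite -[X in _ + X]div1r -mulrDl natr1 ler_pdivlMr// ltW.
have osc (x : E) : `|phi (x t) - phi (x (grid R N k))| <= H N x.
  by apply: (@modulus_ge _ _ Tm0 _ (i0 N) (path_map cphi x) t (grid R N k)) => //;
    exact: le_trans gt tT.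
rewrite -addrA.
apply: (@le_trans _ _ (`|average_dev (ev k) m w| + (`|average_dev (H N) m w| +
   2 * Ex P0 (H N \o XL)))); last first.
  by rewrite lerD2r (bigD1 (Ordinal kK))//= lerDl sumr_ge0.
rewrite addrA /average_dev; apply: aux.
  rewrite -mulrBr -sumrB normrM ger0_norm ?invr_ge0// ler_wpM2l ?invr_ge0//.
  by rewrite (le_trans (ler_norm_sum _ _ _))// ler_sum.
have bphi s : bounded_rv (fun w => phi (XL w s)).
  apply: (bounded_rv_comp (g := (fun x : E => phi (x s)) : borel E -> R) mXL).
  split; last by exists M.
  apply: continuous_borelR => x.
  apply: (@continuous_comp E (R * R)%type R (fun x : E => x s) phi); last exact: cphi.
  exact: path_eval_continuous.
rewrite -ExB//; last exact: bphi.
rewrite (le_trans (le_norm_Ex _ _))//; first by apply: bounded_rvB; exact: bphi.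
apply: Ex_le => //; first by apply: bounded_rv_norm; apply: bounded_rvB; exact: bphi.
by move=> u; rewrite distrC; exact: osc.
Qed.

End particles.

(** * Convergence in probability as convergence of a filter *)

Section likely.
Context (R : realType) d (T : measurableType d) (P : probability T R) (I : Type).
Context (X : nat -> T -> I).

(* The sets containing [X m] with probability tending to 1, in a form which
   does not require them to be measurable. *)
Definition likely : set_system I := [set A | forall eta : R, 0 < eta ->
  \forall m \near \oo, exists2 V, mean_le P V eta &
    {ae P, forall w, ~ A (X m w) -> 1 <= V w}].

Lemma likely_filter : Filter likely.
Proof.
split.
- move=> eta eta0; near=> m; exists (fun=> 0); last first.
    by apply: aeW => w nT; exfalso; exact: nT.
  by apply: mean_le_weaken (ltW eta0) _; exact: mean_le_cst.
- move=> A B HA HB eta eta0; have e2 : 0 < eta / 2 by rewrite divr_gt0.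
  apply: filterS2 (HA _ e2) (HB _ e2) => m [V mV hV] [U mU hU].
  have [_ V0 _] := mV; have [_ U0 _] := mU.
  exists (fun w => V w + U w).
    by apply: (@mean_le_weaken _ _ _ _ _ (eta / 2 + eta / 2)); [rewrite -splitr|exact: mean_leD].
  apply: filterS2 hV hU => w hV hU nAB.
  have [Aw|nA] := pselect (A (X m w)).
    rewrite (le_trans (hU _)) ?lerDr//.
    by move=> Bw; exact: nAB.
  by rewrite (le_trans (hV nA)) ?lerDl.
- move=> A B AB HA eta eta0; apply: filterS (HA _ eta0) => m [V mV hV].
  exists V => //; apply: filterS hV => w hw nB; apply: hw => Aw.
  exact/nB/AB.
Unshelve. all: end_near. Qed.

Lemma likely_cvg A : likely A -> (forall m, measurable (X m @^-1` (~` A))) ->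
  (P (X m @^-1` (~` A)) @[m --> \oo] --> 0)%E.
Proof.
move=> HA mA; suff : Ex P \1_(X m @^-1` (~` A)) @[m --> \oo] --> (0 : R).
  move=> h; have : ((Ex P \1_(X m @^-1` (~` A)))%:E @[m --> \oo] --> 0%:E)%E.
    by apply: cvg_EFin => //; exact: nearW.
  by under eq_fun do rewrite Ex_indic//.
apply/cvgrPdist_le => eta eta0; apply: filterS (HA _ eta0) => m [V [mV V0 hV] aeV].
rewrite sub0r normrN -lee_fin; apply: le_trans hV.
apply: Ex_le_integral => //; first exact: bounded_rv_indic.
apply: filterS aeV => w hw; rewrite indicE.
case: (boolP (w \in _)) => [|_]; last by rewrite normr0.
by rewrite inE normr1 => /hw.
Qed.

(** Markov's inequality in dominated form: where the uniform bound [de] fails, V/de is at least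
    1. *)
Lemma likely_bound (dist : I -> Rplus R -> R) (Tm de : R) : 0 < de ->
  (forall eta, 0 < eta -> \forall m \near \oo, exists2 V, mean_le P V eta &
    {ae P, forall w, forall t, Rplus_val t <= Tm -> `|dist (X m w) t| <= V w}) ->
  likely [set i | forall t, Rplus_val t <= Tm -> `|dist i t| < de].
Proof.
move=> de0 H eta eta0; have e0 : 0 < eta * de by rewrite mulr_gt0.
apply: filterS (H _ e0) => m [V mV hV].
exists (fun w => de^-1 * V w).
  apply: (@mean_le_weaken _ _ _ _ _ (de^-1 * (eta * de))).
    by rewrite mulrCA mulVf ?mulr1// gt_eqF.
  by apply: mean_leZ => //; rewrite invr_ge0 ltW.
apply: filterS hV => w hw /existsNP [t /not_implyP [tT /negP]].
rewrite -leNgt => h; rewrite ler_pdivlMl// mulr1 (le_trans h)//.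
exact: hw.
Qed.

End likely.

(** The weak uniform structure is an initial one, so an entourage contains a finite intersection of
    conditions on single test functions, and a filter is stable under finite intersections. *)
Lemma cvg_cpath_Prob (R : realType) (E : ptopologicalType) (I : Type)
    (F : set_system I) (FF : Filter F) (g : I -> cpath R (Prob R E)) (x : cpath R (Prob R E)) :
  (forall (f : bounded_continuous R E) T (de : R), 0 < de -> \forall i \near F,
    forall t, Rplus_val t <= T ->
      `|(\int[x t]_y sval f y)%R - (\int[g i t]_y sval f y)%R| < de) ->
  g @ F --> x.
Proof.
move=> H; apply: cvg_cpath => T V [W /= [B [J _ JB] BW] WV].
have := @filter_bigI I _ J (fun p => [set i | forall t, Rplus_val t <= T ->
  (projT1 p).2 (Prob_integrals (x t), Prob_integrals (g i t))]) F FF.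
move=> HJ; apply: filterS (HJ _).
  by move=> i Hi t tT; apply: WV; apply: BW; rewrite -JB => p /= pJ; exact: Hi.
move=> [[f A] /= /asboolP [C entC CA]] _ /=.
move: entC; rewrite -entourage_ballE => -[e /= e0 eC].
apply: filterS (H f T e e0) => i Hi t tT.
by apply: CA; apply: eC; exact: Hi.
Qed.

(** * Measurability of the observables of the particle system *)

Section hat_maps.
Context (R : realType) (m : nat).
Let n := m.+2.
Local Notation C3 := (cpath R 'cV[R]_(n + (n + n))).

Let entry_X (i : 'I_n) (M : 'cV[R]_(n + (n + n))) : R := usubmx (dsubmx M) i ord0.
Let entry_L (i : 'I_n) (M : 'cV[R]_(n + (n + n))) : R := dsubmx (dsubmx M) i ord0.

Let entry_X_continuous i : continuous (entry_X i).
Proof.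
rewrite (_ : entry_X i = fun M => M (rshift n (lshift n i)) ord0); last first.
  by apply/funext => M; rewrite /entry_X !mxE.
exact: mx_entry_continuous.
Qed.

Let entry_L_continuous i : continuous (entry_L i).
Proof.
rewrite (_ : entry_L i = fun M => M (rshift n (rshift n i)) ord0); last first.
  by apply/funext => M; rewrite /entry_L !mxE.
exact: mx_entry_continuous.
Qed.

Let entries_continuous i : continuous (fun M => (entry_X i M, entry_L i M)).
Proof.
move=> M; exact: (@cvg_pair _ _ _ (nbhs M) _ _ (nbhs_filter M) _ _ _ _
  (@entry_X_continuous i M) (@entry_L_continuous i M)).
Qed.

Let XL_map i (x : C3) : cpath R (R * R)%type := path_map (@entries_continuous i) x.

Let mu_map (x : C3) : cpath R (Prob R (R * R)%type) :=
  mkpath (@empirical_path_continuous R (R * R)%type m.+1 (XL_map ^~ x)).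

Let lambda_map (x : C3) : cpath R R := path_average (fun i => path_map (@entry_L_continuous i) x).

Let XL_mapE w i : hat_XL w i = XL_map i (w m).2.
Proof. exact/continuousEP. Qed.

Let mu_mapE w : hat_mu m w = mu_map (w m).2.
Proof. exact/continuousEP. Qed.

Let lambda_mapE w : hat_lambda m w = lambda_map (w m).2.
Proof. exact/continuousEP. Qed.

Let mcoord : measurable_fun setT ((fun w => (w m).2) : hat_space R -> borel C3).
Proof. exact: (measurableT_comp measurable_snd (@measurable_hat_coord R m)). Qed.

Lemma measurable_hat_XL (i : 'I_m.+2) :
  measurable_fun setT ((fun w => hat_XL w i) : hat_space R -> borel (cpath R (R * R)%type)).
Proof.
under eq_fun do rewrite XL_mapE.
have mm : measurable_fun setT (XL_map i : borel C3 -> borel (cpath R (R * R)%type)).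
  by apply: continuous_borel; exact: path_map_continuous.
exact: (measurableT_comp mm mcoord).
Qed.

Let average_near (x : C3) (f : 'I_n -> 'cV[R]_(n + (n + n)) -> R) T (de : R) :
  (forall i, continuous (f i)) -> 0 < de ->
  nbhs x [set y : C3 | forall t, Rplus_val t <= T ->
    `|n%:R^-1 * \sum_i f i (x t) - n%:R^-1 * \sum_i f i (y t)| < de].
Proof.
move=> cf de0; have d2 : 0 < de / 2 by rewrite divr_gt0.
have d21 : de / 2 < de by lra.
have H i : nbhs x [set y : C3 | forall t, Rplus_val t <= T ->
    ball (f i (x t)) (de / 2) (f i (y t))].
  have := @path_map_continuous R _ _ (f i) (cf i) x _
    (@cpath_nbhs R R (path_map (cf i) x) T _ (entourage_ball R (PosNum d2))).
  exact.
apply: filterS (@filter_forall _ _ _ (nbhs x) (nbhs_filter x) H) => y Hy t tT.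
apply: le_lt_trans d21.
rewrite -mulrBr -sumrB normrM ger0_norm ?invr_ge0// -[leRHS](average_cst m.+1).
rewrite ler_wpM2l ?invr_ge0// (le_trans (ler_norm_sum _ _ _))// ler_sum// => i _.
exact/ltW/Hy.
Qed.

Let lambda_map_continuous : continuous lambda_map.
Proof.
move=> x; apply: (@cvg_cpath R R _ (nbhs x) (nbhs_filter x)) => T V.
rewrite -entourage_ballE => -[e /= e0 eV].
have := average_near x T (@entry_L_continuous) e0.
by apply: filterS => y Hy t tT; apply: eV; exact: Hy.
Qed.

Let mu_map_continuous : continuous mu_map.
Proof.
move=> x; apply: (@cvg_cpath_Prob R _ _ (nbhs x) (nbhs_filter x)) => f T de de0.
have [cf _] := svalP f.
have cfi i : continuous (fun M => sval f (entry_X i M, entry_L i M)).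
  move=> M; apply: (@continuous_comp _ _ _ (fun M => (entry_X i M, entry_L i M)) (sval f)).
    exact: entries_continuous.
  exact: cf.
have := average_near x T cfi de0; apply: filterS => y Hy t tT.
by rewrite /mu_map /= /empirical_path !Rintegral_empirical; exact: Hy.
Qed.

(** The pair is a continuous function of the canonical path of size-[m] coordinates. Continuity of
    the pair, rather than measurability of its components, covers every open set of the product
    space. *)
Lemma measurable_hat_limit (U : set (cpath R (Prob R (R * R)%type) * cpath R R)) : open U ->
  measurable ((fun w : hat_space R => (hat_mu m w, hat_lambda m w)) @^-1` (~` U)).
Proof.
move=> oU.
have -> : (fun w : hat_space R => (hat_mu m w, hat_lambda m w)) @^-1` (~` U) =
    ~` ((fun w : hat_space R => (w m).2) @^-1` ((fun x => (mu_map x, lambda_map x)) @^-1` U)).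
  apply/seteqP; split => w /=; by rewrite mu_mapE lambda_mapE.
apply: measurableC; rewrite -[X in measurable X]setTI; apply: mcoord => //.
apply: sub_sigma_algebra.
have : continuous (fun x => (mu_map x, lambda_map x)).
  move=> x; exact: (@cvg_pair _ _ _ (nbhs x) _ _ (nbhs_filter x) _ _ _ _
    (@mu_map_continuous x) (@lambda_map_continuous x)).
by move/continuousP; exact.
Qed.

End hat_maps.

(** * Quenched convergence *)

Section quenched.
Context (R : realType) (b sigma a : R) (mu0 : Prob R (Rplus R)).
Context (nu : forall m : nat, Prob R 'cV[Rplus R]_m.+2).
Hypothesis nu_exchangeable : forall m, exchangeable (nu m).
Hypothesis nu_marginals : forall m, has_marginals (nu m) mu0.
Hypothesis nu_chaotic : cvg_in_probability (fun m => nu m)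
  (fun m x => empirical_measure R (fun i => x i ord0)) mu0.
Context d0 (T0 : measurableType d0) (P0 : probability T0 R).
Context (X0 : T0 -> Rplus R) (W0 : T0 -> cpath R R).
Context (XL : {RV P0 >-> borel (cpath R (R * R)%type)}) (lam : cpath R R).
Hypothesis sol : limit_solution P0 b sigma a mu0 X0 W0 XL lam.
Local Notation E := (cpath R (R * R)%type).
Local Notation D2 := (fun x y : E => pdist2 x y).

(** With [lam] given, complementarity identifies the local time with the regulator of the free path
    by [complementary_regulator]; the position then follows from the equation. *)
Lemma solution_limit_map : {ae P0, forall w t, (XL w : E) t = limit_map lam a (X0 w) (W0 w) t}.
Proof.
have [_ _ _ [aeXL _] _] := sol; apply: filterS aeXL => w [eqX comp] t.
have eqL s : ((XL w : E) s).2 = regulator (free_path lam a (X0 w) (W0 w)) s.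
  apply: (complementary_regulator comp) => u.
  have -> : free_path lam a (X0 w) (W0 w) u = Rplus_val (X0 w) + W0 w u + a * lam u by [].
  by rewrite eqX; ring.
have eqX' : ((XL w : E) t).1 = Rplus_val (X0 w) + W0 w t + ((XL w : E) t).2 + a * lam t.
  exact: eqX.
rewrite [LHS]surjective_pairing eqX' eqL.
congr (_, _).
rewrite -[RHS]/(Rplus_val (X0 w) + W0 w t + a * lam t + regulator (free_path lam a (X0 w) (W0
  w)) t).
by ring.
Qed.

Let mXL : measurable_fun setT (XL : T0 -> borel E). Proof. exact: measurable_funP. Qed.

Let mXLt t : measurable_fun setT (fun w => ((XL w : E) t).2).
Proof.
have c : continuous (fun x : E => (x t).2).
  move=> x; apply: (@continuous_comp E (R * R)%type R (fun x : E => x t) snd).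
    exact: path_eval_continuous.
  exact: cvg_snd.
exact: (measurableT_comp (continuous_borelR c) mXL).
Qed.

(** A version of the local time that is nonnegative everywhere, as truncation requires; the original
    is so only almost surely. *)
Let Z t w : R := Num.max 0 ((XL w : E) t).2.

Let mZ t : measurable_fun setT (Z t).
Proof. by apply: measurable_maxr. Qed.

Let aeZ : {ae P0, forall w t, ((XL w : E) t).2 = Z t w}.
Proof.
apply: filterS solution_limit_map => w h t; rewrite /Z max_r// h.
exact: regulator_ge0.
Qed.

Let intZ t : (\int[P0]_w (Z t w)%:E = (lam t)%:E)%E.
Proof.
have [_ _ _ [_ /(_ t) <-] _] := sol; rewrite unlock.
apply: ae_eq_integral => //; [exact/measurable_EFinP|exact/measurable_EFinP/mXLt|].
by apply: filterS aeZ => w h _; rewrite /= -h.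
Qed.

Lemma solution_lam_mono (s t : Rplus R) : Rplus_val s <= Rplus_val t -> lam s <= lam t.
Proof.
move=> st; rewrite -lee_fin -!intZ; apply: ae_ge0_le_integral => //.
- by move=> w _; rewrite lee_fin le_max lexx.
- exact/measurable_EFinP.
- by move=> w _; rewrite lee_fin le_max lexx.
- exact/measurable_EFinP.
apply: filterS2 aeZ solution_limit_map => w hZ h _; rewrite lee_fin -!hZ !h.
exact: regulator_mono.
Qed.

Lemma solution_local_time t :
  Ex P0 (local_time t K \o (XL : T0 -> E)) @[K --> \oo] --> lam t.
Proof.
have cl (K : nat) : continuous (clamp (K%:R : R)).
  exact: clamp_continuous.
have bl1 (K : nat) : bounded_rv (fun w => clamp (K%:R : R) (Z t w)).
  split; last by exists K%:R => w; exact: clamp_bounded.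
  exact: (measurableT_comp (continuous_measurable_fun (cl K)) (mZ t)).
have bl2 (K : nat) : bounded_rv (local_time t K \o (XL : T0 -> E)).
  exact: (bounded_rv_comp mXL (bl_measurable (metrizes_pdist2 R) (local_time_bl t K))).
have Z0 w : 0 <= Z t w by rewrite le_max lexx.
have := integral_truncation (P := P0) Z0 bl1; rewrite intZ => /fine_cvgP[_ /=].
move=> H; apply: cvg_trans H; apply: near_eq_cvg; apply: nearW => K /=.
apply: eq_ae_Ex => //; apply: filterS aeZ => w h.
by rewrite -h.
Qed.

Context (P : probability (hat_space R) R) (rho : forall m, 'I_m.+2 -> 'I_m.+2 -> R) (eps : R).
Hypothesis eps0 : 0 < eps.
Hypothesis rho_le : forall m (i j : 'I_m.+2), i != j -> `|rho i j| <= 1 - eps.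
Hypothesis rho_avg : forall e : R, 0 < e -> \forall m \near \oo, forall i : 'I_m.+2,
  `|m.+1%:R^-1 * \sum_(j | j != i) rho i j - a| <= e.
Hypothesis law : quenched_law b sigma nu rho P.

Let mX0 : measurable_fun setT (X0 : T0 -> borel (Rplus R)).
Proof. by case: sol => -[]. Qed.
Let X0_law (A : set (borel (Rplus R))) : measurable A -> P0 (X0 @^-1` A) = mu0 A.
Proof. by case: sol => -[_ h] _ _ _ _; exact: h. Qed.
Let BW0 : brownian_motion P0 b sigma W0. Proof. by case: sol. Qed.
Let X0W0 : independent_pair P0 (X0 : T0 -> borel (Rplus R)) (W0 : T0 -> borel (cpath R R)).
Proof. by case: sol. Qed.
Let hat_X0_law m (A : set (borel 'cV[Rplus R]_m.+2)) : measurable A ->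
  P (@hat_X0 R m @^-1` A) = nu m A.
Proof. by case: (law m) => h _ _ _; exact: h. Qed.
Let hat_W_bm m : brownian_motion_n P b sigma (@hat_W R m).
Proof. by case: (law m). Qed.
Let hat_X0W m : independent_pair P (@hat_X0 R m)
  (@hat_W R m : hat_space R -> borel (cpath R 'cV[R]_m.+2)).
Proof. by case: (law m). Qed.
Let refl m : {ae P, forall w, reflection_map
  (fun t => map_mx (@Rplus_val R) (hat_X0 m w) + hat_W m w t)
  (reflection_matrix (@rho m)) (hat_X m w) (hat_L m w)}.
Proof. by case: (law m). Qed.

Local Notation Y := (fun m => @limit_copy R a lam m).
Local Notation Zh := (fun m (i : 'I_m.+2) (w : hat_space R) => hat_XL w i).

Let bY m (i : 'I_m.+2) f : bl D2 f -> bounded_rv (fun w => f (limit_copy a lam i w)).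
Proof. by move=> bf; exact: (bounded_rv_copy a lam hat_W_bm). Qed.

Let EY m (i : 'I_m.+2) f : bl D2 f ->
  Ex P (fun w => f (limit_copy a lam i w)) = Ex P0 (f \o (XL : T0 -> E)).
Proof.
move=> bf; exact: (Ex_copy nu_marginals mX0 X0_law BW0 X0W0 mXL solution_limit_map
  hat_X0_law hat_W_bm hat_X0W).
Qed.

Let lln f (eta : R) : bl D2 f -> 0 < eta ->
  \forall m \near \oo, forall r : 'I_m.+2 -> R, (forall j, `|r j| <= 1) ->
    Ex P (fun w => `|m.+2%:R^-1 * \sum_j r j * (f (limit_copy a lam j w) - Ex P0 (f \o (XL : T0
      -> E)))|) <= eta.
Proof.
move=> bf eta0; exact: (weighted_lln nu_exchangeable nu_chaotic mX0 X0_law BW0 X0W0 mXL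
  solution_limit_map hat_X0_law hat_W_bm hat_X0W bf eta0).
Qed.

Let dev (Tm eta : R) : 0 < eta ->
  \forall m \near \oo, forall r : 'I_m.+2 -> R, (forall j, `|r j| <= 1) ->
    exists2 V, mean_le P V eta & forall w s, Rplus_val s <= Tm ->
      `|weighted_dev Y lam r w s| <= V w.
Proof.
apply: (@weighted_dev_uniform R _ _ P _ _ P0 XL Y lam bY EY lln).
- by move=> m i w t; exact: regulator_ge0.
- by move=> m i w s t st; exact: regulator_mono.
- exact: solution_lam_mono.
- exact: solution_local_time.
Qed.

Let coupled (eta : R) : 0 < eta -> \forall m \near \oo, forall i : 'I_m.+2,
  exists2 V, mean_le P V eta & {ae P, forall w, pdist2 (hat_XL w i) (limit_copy a lam i w) <= V w}.
Proof. by move=> eta0; exact: (coupling_mean eps0 rho_le rho_avg refl dev eta0). Qed.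

Let mhat m (i : 'I_m.+2) : measurable_fun setT
  ((fun w => hat_XL w i) : hat_space R -> borel E).
Proof. exact: measurable_hat_XL. Qed.

Context d' (T' : measurableType d') (P' : probability T' R).
Context (XLi : nat -> {RV P' >-> borel E}).
Hypothesis XLi_law : forall i (A : set (borel E)),
  measurable A -> distribution P' (XLi i) A = distribution P0 XL A.
Hypothesis XLi_independent : independent_family P' predT (fun i => XLi i).

Lemma quenched_tagged k : cvg_in_law P (fun m w => hat_tagged m w k)
  P' (fun w => path_row (fun i : 'I_k => XLi i w)).
Proof.
move=> f; have [cf [M fM]] := svalP f.
have mXLi i : measurable_fun setT (XLi i : T' -> borel E) by exact: measurable_funP.
have EXLi i (g : E -> R) : bounded_rv (g : borel E -> R) ->
    Ex P' (g \o (XLi i : T' -> E)) = Ex P0 (g \o (XL : T0 -> E)).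
  move=> bg; have h1 := Ex_law (mXLi i) (mu := distribution P' (XLi i)) (fun _ _ => erefl) bg.
  have h2 := Ex_law mXL (mu := distribution P' (XLi i)) (fun A mA => esym (XLi_law i mA)) bg.
  by rewrite h1 h2.
have inj : injective (fun i : 'I_k => (i : nat)) by exact: val_inj.
apply: (@cvg_of_bl _ _ _ (metrizes_pdist_row R k) _ (@dense_row_dense R k) _ _ P
  (fun m w => hat_tagged m w k) _ _ P' (fun w => path_row (fun i : 'I_k => XLi i w))).
- move=> m n; apply: (@measurable_row_dist R k _ _ (fun i w => hat_XL w (inord i : 'I_m.+2))) => i.
  exact: mhat.
- by move=> n; apply: (@measurable_row_dist R k _ _ (fun i w => (XLi i w : E))) => i; exact: mXLi.
- move=> g bg.
  apply: (@row_cvg_bl R k _ _ P0 XL mXL _ _ P (fun m i w => hat_XL w (inord i : 'I_m.+2))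
    (fun m i => mhat _) _ _ P' (fun i w => XLi i w) (fun i => mXLi i)) => // h bh.
    have hY := tagged_copies_cvg nu_exchangeable nu_chaotic mX0 X0_law BW0 X0W0 mXL
      solution_limit_map hat_X0_law hat_W_bm hat_X0W bh.
    apply: (@tagged_product R _ _ P _ _ P0 XL Zh Y) => //.
  have bbh i : bounded_rv (h i : borel E -> R) := bl_measurable (metrizes_pdist2 R) (bh i).
  rewrite (@Ex_indep_family _ _ _ P' _ predT _ _ (fun (i : 'I_k) w => XLi i w : borel E) h
    (index_enum 'I_k) (independent_family_inj inj XLi_independent)) ?index_enum_uniq//.
  by apply: eq_bigr => i _; exact: EXLi.
- exact: cf.
- by exists M.
Qed.

Lemma quenched_empirical : cvg_in_probability (fun=> P)
  (fun m w => (hat_mu m w, hat_lambda m w)) (law_path P0 XL, lam).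
Proof.
move=> U oU Ux.
pose X m (w : hat_space R) := (hat_mu m w, hat_lambda m w).
have FF := likely_filter P X.
apply: likely_cvg; last by move=> m; exact: measurable_hat_limit.
have nU : nbhs (law_path P0 XL, lam) U by exact: open_nbhs_nbhs.
(* As a filter statement the claim splits into the two components, and the first of them into single
   test functions. *)
suff : id @ likely P X --> (law_path P0 XL, lam) by move=> /(_ U nU).
have c1 : fst @ likely P X --> law_path P0 XL.
  apply: cvg_cpath_Prob => f T de de0.
  have [cf [M fM]] := svalP f.
  pose dist (i : cpath R (Prob R (R * R)%type) * cpath R R) t : R :=
    (\int[law_path P0 XL t]_y sval f y)%R - (\int[i.1 t]_y sval f y)%R.
  have T0' : 0 <= Num.max 0 T by rewrite le_max lexx.
  suff H : likely P X [set i | forall t, Rplus_val t <= Num.max 0 T -> `|dist i t| < de].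
    by apply: (@filterS _ _ FF _ _ _ H) => i hi t tT; apply: hi; rewrite le_max tT orbT.
  apply: likely_bound => // eta eta0.
  have := @uniform_empirical R _ _ P _ _ P0 XL Zh Y mXL (fun m => @mhat m) bY lln coupled
    (sval f) (Num.max 0 T) eta T0' eta0 cf (ex_intro _ M fM).
  apply: filterS => m [V mV hV]; exists V => //; apply: aeW => w t tT.
  rewrite distrC /dist.
  have -> : (\int[(X m w).1 t]_y sval f y)%R = m.+2%:R^-1 * \sum_(j < m.+2) sval f (hat_XL w j t).
    exact: Rintegral_empirical.
  have -> : (\int[law_path P0 XL t]_y sval f y)%R = Ex P0 (fun w => sval f ((XL w : E) t)).
    have bf : bounded_rv (sval f : borel (R * R)%type -> R).
      by split; [exact: continuous_borelR|exists M].
    by rewrite (Ex_law (measurable_RV_at XL t) (mu := law_path P0 XL t : probability _ _)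
      (fun _ _ => erefl) bf).
  exact: hV.
have c2 : snd @ likely P X --> lam.
  apply: (@cvg_cpath R R _ (likely P X) FF) => T V; rewrite -entourage_ballE => -[de /= de0 deV].
  pose dist (i : cpath R (Prob R (R * R)%type) * cpath R R) t : R := lam t - i.2 t.
  have T0' : 0 <= Num.max 0 T by rewrite le_max lexx.
  suff H : likely P X [set i | forall t, Rplus_val t <= Num.max 0 T -> `|dist i t| < de].
    apply: (@filterS _ _ FF _ _ _ H) => i hi t tT; apply: deV; apply: hi.
    by rewrite le_max tT orbT.
  apply: likely_bound => // eta eta0; have e2 : 0 < eta / 2 by rewrite divr_gt0.
  have H1 := dev (Num.max 0 T) e2.
  have H2 := coupling_sup eps0 rho_le rho_avg refl dev T0' e2.
  apply: filterS2 H1 H2 => m H1 H2.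
  have one1 (j : 'I_m.+2) : `|1 : R| <= 1 by rewrite normr1.
  have [V1 mV1 hV1] := H1 _ one1.
  pose V2 i := s2val (cid2 (H2 i)).
  have mV2 i : mean_le P (V2 i) (eta / 2) := s2valP (cid2 (H2 i)).
  have hV2 i : \forall w \ae P, forall s, Rplus_val s <= Num.max 0 T ->
      `|(hat_XL w i s).1 - (limit_copy a lam i w s).1| <= 2 * V2 i w /\
      `|(hat_XL w i s).2 - (limit_copy a lam i w s).2| <= V2 i w := s2valP' (cid2 (H2 i)).
  (* [V1] bounds the fluctuation of the average local time of the copies, the other term the average
     coupling distance of the local times. *)
  exists (fun w => V1 w + m.+2%:R^-1 * \sum_i V2 i w).
    apply: (@mean_le_weaken _ _ _ _ _ (eta / 2 + m.+2%:R^-1 * \sum_(i < m.+2) eta / 2)).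
      by rewrite average_cst -splitr.
    by apply: mean_leD => //; apply: mean_leZ; [rewrite invr_ge0|exact: mean_le_sum].
  have aeF : Filter (almost_everywhere P) by exact: ae_filter_ringOfSetsType.
  apply: filterS (filter_forall aeF hV2) => w hw t tT.
  rewrite distrC /dist.
  have -> : (X m w).2 t - lam t = weighted_dev Y lam (fun _ : 'I_m.+2 => 1) w t +
      m.+2%:R^-1 * \sum_(j < m.+2) ((hat_XL w j t).2 - (limit_copy a lam j w t).2).
    have -> : (X m w).2 t = m.+2%:R^-1 * \sum_(j < m.+2) (hat_XL w j t).2 by [].
    rewrite -[X in _ - X = _](average_cst m.+1) -mulrBr /weighted_dev -mulrDr -sumrB -big_split.
    by congr (_ * _); apply: eq_bigr => j _ /=; ring.
  rewrite (le_trans (ler_normD _ _))// lerD//; first exact: hV1.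
  rewrite normrM ger0_norm ?invr_ge0// ler_wpM2l ?invr_ge0//.
  rewrite (le_trans (ler_norm_sum _ _ _))// ler_sum// => j _.
  by have [] := hw j t tT.
have H := @cvg_pair _ _ _ (likely P X) _ _ FF _ _ _ _ c1 c2.
by move=> A /H hA; apply: (@filterS _ _ FF _ _ _ hA) => -[x y].
Qed.

End quenched.

(** * Annealed convergence *)

Lemma Ex_cvg_ae d (T : measurableType d) (R : realType) (P : probability T R)
    (F : nat -> T -> R) (l M : R) : (forall n, measurable_fun setT (F n)) ->
  (forall n x, `|F n x| <= M) -> {ae P, forall x, F n x @[n --> \oo] --> l} ->
  Ex P (F n) @[n --> \oo] --> l.
Proof.
move=> mF FM Fl; rewrite -[X in _ --> X](Ex_cst P).
have bF n : bounded_rv (F n) by split => //; exists M.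
have /(fine_cvgP _ _)[_] : (\int[P]_x (F n x)%:E @[n --> \oo] --> (Ex P (fun=> l))%:E)%E.
  rewrite EFin_Ex; last exact: bounded_rv_cst.
  have [] // := @dominated_convergence _ _ _ P setT measurableT
    (fun n x => (F n x)%:E) (fun=> l%:E) (fun=> M%:E).
  - by move=> n; exact/measurable_EFinP.
  - apply: filterS Fl => x h _; apply: cvg_EFin => //; exact: nearW.
  - by apply: bounded_rv_integrable; exact: bounded_rv_cst.
  - by apply: aeW => x n _; rewrite /= lee_fin.
by [].
Qed.

Section annealed.
Context (R : realType) dXi (Xi : measurableType dXi) (Q : probability Xi R).
Context d (T : measurableType d) (K : Xi -> probability T R).
Hypothesis mK : forall A : set T, measurable A -> measurable_fun setT (fun xi => K xi A).
Context (QQ : probability (Xi * T)%type R).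
Hypothesis QQE : forall (A : set Xi) (B : set T), measurable A -> measurable B ->
  QQ (A `*` B) = (\int[Q]_(xi in A) K xi B)%E.

Lemma bounded_rv_kernel (A : set T) : measurable A -> bounded_rv (fun xi => fine (K xi A)).
Proof.
move=> mA; split; first exact: (measurableT_comp (fine_measurable measurableT) (mK mA)).
exists 1 => xi; rewrite ger0_norm ?fine_ge0// -lee_fin fineK ?fin_num_measure//.
exact: probability_le1.
Qed.

Lemma annealed_measure (A : set T) : measurable A ->
  (QQ (snd @^-1` A) = (Ex Q (fun xi => fine (K xi A)))%:E)%E.
Proof.
move=> mA; rewrite EFin_Ex; last exact: bounded_rv_kernel.
rewrite (_ : snd @^-1` A = setT `*` A); last first.
  by apply/seteqP; split => -[x y] //= [].
rewrite QQE//; apply: eq_integral => xi _.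
by rewrite fineK// fin_num_measure.
Qed.

(** One combination [G] of kernel masses is uniformly close to the quenched means and has nearly the
    annealed mean. The first fact makes quenched means measurable as limits, and both together give
    the disintegration formula. *)
Let kernel_approx (F : T -> R) (e : R) : bounded_rv F -> 0 < e ->
  exists G, [/\ bounded_rv G, forall xi, `|Ex (K xi) F - G xi| <= e
    & `|Ex QQ (fun z => F z.2) - Ex Q G| <= e].
Proof.
move=> bF e0; have [mF [M FM]] := bF.
have [n [c [B [mB h]]]] := @simple_approx R M e e0.
have mFB v : measurable (F @^-1` B v) by rewrite -[X in measurable X]setTI; exact: mF.
have bs : bounded_rv (fun x => \sum_v c v * \1_(B v) (F x)).
  by apply: bounded_rv_sum => v; apply: bounded_rvZ; exact: bounded_rv_indic_comp.
exists (fun xi => \sum_v c v * fine (K xi (F @^-1` B v))); split.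
- by apply: bounded_rv_sum => v; apply: bounded_rvZ; exact: bounded_rv_kernel.
- move=> xi; have -> : \sum_v c v * fine (K xi (F @^-1` B v)) =
      Ex (K xi) (fun x => \sum_v c v * \1_(B v) (F x)).
    rewrite Ex_sum; last by move=> v; apply: bounded_rvZ; exact: bounded_rv_indic_comp.
    apply: eq_bigr => v _; rewrite ExZ; last exact: bounded_rv_indic_comp.
    by rewrite indic_preimage Ex_indicE.
  by apply: Ex_near => // x; exact: h.
have -> : Ex Q (fun xi => \sum_v c v * fine (K xi (F @^-1` B v))) =
    Ex QQ (fun z => \sum_v c v * \1_(B v) (F z.2)).
  have bsnd v : bounded_rv (fun z : Xi * T => \1_(B v) (F z.2) : R).
    apply: (bounded_rv_comp (g := fun x => \1_(B v) (F x)) measurable_snd).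
    exact: bounded_rv_indic_comp.
  rewrite !Ex_sum; first last.
  - by move=> v; apply: bounded_rvZ; exact: bounded_rv_kernel.
  - by move=> v; exact: bounded_rvZ.
  apply: eq_bigr => v _; rewrite !ExZ//; last exact: bounded_rv_kernel.
  congr (_ * _); apply: EFin_inj; rewrite -annealed_measure//.
  have -> : (fun z : Xi * T => \1_(B v) (F z.2) : R) = \1_(snd @^-1` (F @^-1` B v)).
    exact: (indic_preimage R (B v) (fun z : Xi * T => F z.2)).
  rewrite Ex_indic// -[X in measurable X]setTI; exact: measurable_snd.
apply: Ex_near.
- exact: (bounded_rv_comp measurable_snd bF).
- exact: (bounded_rv_comp measurable_snd bs).
- by move=> z; exact: h.
Qed.

Lemma bounded_rv_Ex_kernel F : bounded_rv F -> bounded_rv (fun xi => Ex (K xi) F).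
Proof.
move=> bF; have [_ [M FM]] := bF; split; last first.
  by exists M => xi; exact: norm_Ex_le.
have n0 n : (0 : R) < n.+1%:R^-1 by rewrite invr_gt0.
pose G n := sval (cid (kernel_approx bF (n0 n))).
have hG n : [/\ bounded_rv (G n), forall xi, `|Ex (K xi) F - G n xi| <= n.+1%:R^-1
    & `|Ex QQ (fun z => F z.2) - Ex Q (G n)| <= n.+1%:R^-1] := svalP (cid (kernel_approx bF (n0
      n))).
apply: (measurable_fun_cvg (h := G)); first by move=> n; case: (hG n) => -[].
move=> xi _; apply/cvgrPdist_le => e e0.
exists (Num.truncn e^-1) => // n /= hn; have [_ h _] := hG n.
rewrite (le_trans (h xi))// invf_ple ?posrE//.
by rewrite (le_trans (ltW (truncnS_gt _)))// ler_nat.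
Qed.

Lemma annealed_Ex F : bounded_rv F ->
  Ex QQ (fun z => F z.2) = Ex Q (fun xi => Ex (K xi) F).
Proof.
move=> bF; apply/eqP; rewrite -subr_eq0; apply/eqP.
apply: (@norm_le_small_eq0 _ _ 2) => e e0.
have [G [bG h1 h2]] := kernel_approx bF e0.
rewrite -(subrK (Ex Q G) (Ex QQ _)) -addrA (le_trans (ler_normD _ _))//.
rewrite mulrDl mul1r lerD// distrC; apply: Ex_near => //.
exact: bounded_rv_Ex_kernel.
Qed.

Lemma annealed_cvg_in_law (E : ptopologicalType) (X : nat -> T -> E)
    d' (T' : measurableType d') (P' : probability T' R) (Y : T' -> E) :
  (forall (f : bounded_continuous R E) m, bounded_rv (fun w => sval f (X m w))) ->
  {ae Q, forall xi, cvg_in_law (K xi) X P' Y} ->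
  cvg_in_law QQ (fun m z => X m z.2) P' Y.
Proof.
move=> bX H f; have [_ [M fM]] := svalP f.
have -> : (fun m => (\int[QQ]_z sval f (X m z.2))%R) =
    (fun m => Ex Q (fun xi => Ex (K xi) (fun w => sval f (X m w)))).
  by apply/funext => m; exact: (annealed_Ex (bX f m)).
apply: (@Ex_cvg_ae _ _ _ Q _ _ M).
- by move=> m; case: (bounded_rv_Ex_kernel (bX f m)).
- by move=> m xi; exact: norm_Ex_le.
- by apply: filterS H => xi; exact.
Qed.

Lemma annealed_cvg_in_probability (E : topologicalType) (X : nat -> T -> E) (c : E) :
  (forall U m, open U -> measurable (X m @^-1` (~` U))) ->
  {ae Q, forall xi, cvg_in_probability (fun=> K xi) X c} ->
  cvg_in_probability (fun=> QQ) (fun m z => X m z.2) c.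
Proof.
move=> mX H U oU Uc.
have -> : (fun m => QQ ((fun z => X m z.2) @^-1` (~` U))) =
    (fun m => (Ex Q (fun xi => fine (K xi (X m @^-1` (~` U)))))%:E).
  by apply/funext => m; rewrite -annealed_measure//; exact: mX.
apply: cvg_EFin; first exact: nearW.
apply: (@Ex_cvg_ae _ _ _ Q _ _ 1).
- by move=> m; case: (bounded_rv_kernel (mX U m oU)).
- move=> m xi; rewrite ger0_norm ?fine_ge0// -lee_fin fineK ?fin_num_measure//; try exact: mX.
  exact: probability_le1 (mX U m oU).
- by apply: filterS H => xi /(_ U oU Uc) /fine_cvgP [].
Qed.

End annealed.

Theorem theorem2p7 (R : realType) (b sigma : R) (sigma_gt0 : 0 < sigma)
    (mu0 : Prob R (Rplus R))
    (nu : forall m : nat, Prob R 'cV[Rplus R]_m.+2)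
    (nu_exchangeable : forall m, exchangeable (nu m))
    (nu_marginals : forall m, has_marginals (nu m) mu0)
    (nu_chaotic : cvg_in_probability (fun m => nu m)
       (fun m x => empirical_measure R (fun i => x i ord0)) mu0)
    (dXi : measure_display) (Xi : measurableType dXi) (Q : probability Xi R)
    (rho : forall m : nat, 'I_m.+2 -> 'I_m.+2 -> Xi -> R)
    (rho_measurable : forall m (i j : 'I_m.+2), i != j ->
       measurable_fun setT (rho m i j))
    (eps : R) (eps_gt0 : 0 < eps)
    (rho_bounded : forall xi m (i j : 'I_m.+2), i != j ->
       `|rho m i j xi| <= 1 - eps)
    (a : R)
    (rho_mean : forall m (i j : 'I_m.+2), i != j ->
       (\int[Q]_xi (rho m i j xi)%:E = a%:E)%E)
    (rho_independent : forall m (i : 'I_m.+2),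
       independent_family Q [pred j | j != i] (rho m i))
    (Qq : Xi -> probability (hat_space R) R)
    (Qq_measurable : forall A : set (hat_space R), measurable A ->
       measurable_fun setT (fun xi => Qq xi A))
    (Qq_quenched : forall xi,
       quenched_law b sigma nu (fun m i j => rho m i j xi) (Qq xi))
    (QQ : probability (Xi * hat_space R)%type R)
    (QQ_annealed : forall (A : set Xi) (B : set (hat_space R)),
       measurable A -> measurable B ->
       QQ (A `*` B) = (\int[Q]_(xi in A) Qq xi B)%E)
    (dO : measure_display) (Omega : measurableType dO)
    (P : probability Omega R) (X0 : Omega -> Rplus R)
    (W : Omega -> cpath R R)
    (XL : {RV P >-> borel (cpath R (R * R)%type)}) (lambda : cpath R R)
    (XL_solution : limit_solution P b sigma a mu0 X0 W XL lambda)
    (dO' : measure_display) (Omega' : measurableType dO')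
    (P' : probability Omega' R)
    (XLi : nat -> {RV P' >-> borel (cpath R (R * R)%type)})
    (XLi_law : forall i (A : set (borel (cpath R (R * R)%type))),
       measurable A -> distribution P' (XLi i) A = distribution P XL A)
    (XLi_independent : independent_family P' predT (fun i => XLi i))
    (k : nat) :
  [/\ cvg_in_law QQ (fun m z => hat_tagged m z.2 k)
        P' (fun w => path_row (fun i : 'I_k => XLi i w)),
      cvg_in_probability (fun=> QQ)
        (fun m z => (hat_mu m z.2, hat_lambda m z.2)) (law_path P XL, lambda)
    & {ae Q, forall xi,
        cvg_in_law (Qq xi) (fun m w => hat_tagged m w k)
          P' (fun w => path_row (fun i : 'I_k => XLi i w)) /\
        cvg_in_probability (fun=> Qq xi)
          (fun m w => (hat_mu m w, hat_lambda m w)) (law_path P XL, lambda)}].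
Proof.

have rho1 xi m (i j : 'I_m.+2) : i != j -> `|rho m i j xi| <= 1.
  by move=> /(rho_bounded xi) h; apply: (le_trans h); rewrite gerBl ltW.
(* The exceptional null set comes from the row averages alone; outside it both quenched convergences
   hold. *)
have good := row_average_concentrates rho_measurable rho1 rho_mean rho_independent.
have tagged : {ae Q, forall xi, cvg_in_law (Qq xi) (fun m w => hat_tagged m w k)
    P' (fun w => path_row (fun i : 'I_k => XLi i w))}.
  apply: filterS good => xi h.
  exact: (quenched_tagged nu_exchangeable nu_marginals nu_chaotic XL_solution eps_gt0
    (fun m i j => rho_bounded xi m i j) h (Qq_quenched xi) XLi_law XLi_independent).
have empirical : {ae Q, forall xi, cvg_in_probability (fun=> Qq xi)
    (fun m w => (hat_mu m w, hat_lambda m w)) (law_path P XL, lambda)}.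
  apply: filterS good => xi h.
  exact: (quenched_empirical nu_exchangeable nu_marginals nu_chaotic XL_solution eps_gt0
    (fun m i j => rho_bounded xi m i j) h (Qq_quenched xi)).
split.
- apply: (annealed_cvg_in_law Qq_measurable QQ_annealed) tagged => f m.
  have [cf [M fM]] := svalP f.
  apply: (bounded_rv_continuous (metrizes_pdist_row R k) (@dense_row_dense R k) cf fM) => n.
  apply: (@measurable_row_dist R k _ _ (fun i w => hat_XL w (inord i : 'I_m.+2))) => i.
  exact: measurable_hat_XL.
- apply: (annealed_cvg_in_probability Qq_measurable QQ_annealed) empirical => U m oU.
  exact: measurable_hat_limit.
- by apply: filterS2 tagged empirical.
Qed.
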